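(* For fixed integers/reals $\lambda,a,b$ with $\lambda$ a nonzero integer and $0\le a<b\le1$, $$H(x,x^a,x^b;P_\lambda)\gg_{a,b,\lambda}\frac{x}{\log x}$$ for all sufficiently large $x$.
   Context: For $0<y<z$ and a positive integer $n$, $\tau(n;y,z)$ denotes the number of divisors $d$ of $n$ with $y<d\le z$. For a set $\mathcal A$ of positive integers, $H(x,y,z;\mathcal A)$ is the number of $n\le x$ with $n\in\mathcal A$ and $\tau(n;y,z)\ge1$. $P_\lambda=\{q+\lambda: q\text{ prime}\}$. *)

(* Defs.v *)
From HB Require Import structures.
From mathcomp Require Import all_boot all_order all_algebra.
From mathcomp Require Import all_classical all_reals all_analysis.

Set Implicit Arguments.
Unset Strict Implicit.
Unset Printing Implicit Defensive.

Import Order.TTheory GRing.Theory Num.Theory.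
Import numFieldNormedType.Exports.

Local Open Scope classical_set_scope.
Local Open Scope ring_scope.

Definition tau (R : realType) (n : nat) (y z : R) : nat :=
  count (fun d : nat => y < d%:R <= z) (divisors n).

(* The counted integers are 1 <= n <= floor x.  The set A lives in int so that
   {q + lambda} can be given literally for negative lambda; its nonpositive
   elements are never counted. *)
Definition H (R : realType) (x y z : R) (A : set int) : nat :=
  count (fun n : nat => (n%:Z \in A) && (1 <= tau n y z)%N)
        (iota 1 (Num.truncn x)).

Definition shifted_primes (lambda : int) : set int :=
  [set q%:Z + lambda | q in [set q : nat | prime q]].

(* Main.v *)
(* Proof idea.  Let 0 < a1 < b1 < 1/2 with b1 - a1 small, and let d run over the
   primes in (x^a1, x^b1].  The nonprincipal characters to a prime modulus d are
   primitive of conductor d > x^a1, so Vaughan's identity and the large sieve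
   give, with a power saving and without any input on zeros of L-functions,
     sum_d sum_(n <= x, d | n + lambda) Lambda(n) = (1 + o(1)) psi(x) sum_d 1/d.
   Characters never appear: a bilinear form over m k = - lambda (mod d) is
   bounded by Cauchy-Schwarz over the residue of m and the additive large sieve.
   Chebyshev gives psi(x) >> x and Mertens gives sum_d 1/d >> 1; as n + lambda has
   O(1) prime factors exceeding x^a1, a positive proportion of the primes q <= x
   have q + lambda divisible by such a d.  If a < 1/2 take (a1, b1] inside (a, b];
   if a >= 1/2 use the codivisor of d, with (a1, b1] inside (1 - b, 1 - a]. *)

Require Import Defs.
From HB Require Import structures.
From mathcomp Require Import all_boot all_order all_algebra.
From mathcomp Require Import all_classical all_reals all_analysis.
From mathcomp Require Import zify ring lra.

Set Implicit Arguments.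
Unset Strict Implicit.
Unset Printing Implicit Defensive.

Import Order.TTheory GRing.Theory Num.Theory.
Import numFieldNormedType.Exports.

Local Open Scope classical_set_scope.
Local Open Scope ring_scope.

(** * The large sieve *)

(** Modulo a prime not dividing lambda, the congruence m k = - lambda pairs each nonzero class s of
    m with the class - lambda / s of k. Inversion permutes the units, so after centring only the
    variances of the coefficients over residue classes matter, and these are what the large sieve
    bounds on average over d. Two constraints shape the estimates. The condition m k <= N couples
    the variables of the bilinear form; it is removed by recursive bisection at the cost of a
    logarithm. With moduli in (P, Q] and both variables above V, the squared bilinear sum is, up to
    logarithms, N (N + Q^2 N / V + Q^4) / P^2. For V = x^(1/8) the middle term saves a power of x
    only if b1 - a1 < 1/16, and the last one only if 2 b1 - a1 < 1/2; this is why the window of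
    primes is short and below x^(1/2). In the codivisor case n / d has to be bounded below, so
    primes up to about x^(1-sg) are discarded. This loses at most a constant times x^(1-sg), which
    is absorbed by the same power saving. *)

(** The squared modulus of the geometric sum of $e^{\mathrm{i}jt}$ over $j<L$, that is, $L$ times
    the Fejer kernel; real and imaginary parts are kept apart so that all analysis stays in [R]. *)
Definition fejer (R : realType) (L : nat) (t : R) : R :=
  (\sum_(0 <= i < L) cos (i%:R * t)) ^+ 2 +
  (\sum_(0 <= i < L) sin (i%:R * t)) ^+ 2.

Lemma mul_sin_sum_cos (R : realType) (L : nat) (t : R) :
  2 * sin (t / 2) * \sum_(0 <= i < L) cos (i%:R * t) =
  sin ((L%:R - 2^-1) * t) + sin (t / 2).
Proof.
elim: L => [|L IH].
  rewrite big_nil mulr0.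
  have -> : (0%:R - 2^-1) * t = - (t / 2) by rewrite mulr0n; field.
  by rewrite sinN; ring.
rewrite big_nat_recr //= mulrDr IH.
have -> : (L.+1%:R - 2^-1) * t = L%:R * t + t / 2 by rewrite -natr1; field.
have -> : (L%:R - 2^-1) * t = L%:R * t - t / 2 by field.
by rewrite sinB sinD; ring.
Qed.

Lemma mul_sin_sum_sin (R : realType) (L : nat) (t : R) :
  2 * sin (t / 2) * \sum_(0 <= i < L) sin (i%:R * t) =
  cos (t / 2) - cos ((L%:R - 2^-1) * t).
Proof.
elim: L => [|L IH].
  rewrite big_nil mulr0.
  have -> : (0%:R - 2^-1) * t = - (t / 2) by rewrite mulr0n; field.
  by rewrite cosN; ring.
rewrite big_nat_recr //= mulrDr IH.
have -> : (L.+1%:R - 2^-1) * t = L%:R * t + t / 2 by rewrite -natr1; field.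
have -> : (L%:R - 2^-1) * t = L%:R * t - t / 2 by field.
by rewrite cosB cosD; ring.
Qed.

Lemma fejer_ge0 (R : realType) (L : nat) (t : R) : 0 <= fejer L t.
Proof. by rewrite addr_ge0 // sqr_ge0. Qed.

(** Squaring and adding the two telescoped sums leaves $2-2\cos(u+v)\le 4$. *)
Lemma sqr_sin_mul_fejer (R : realType) (L : nat) (t : R) :
  sin (t / 2) ^+ 2 * fejer L t <= 1.
Proof.
have := mul_sin_sum_cos L t; have := mul_sin_sum_sin L t.
rewrite /fejer; set S := \sum_(0 <= i < L) sin _; set C := \sum_(0 <= i < L) cos _.
set u := t / 2; set v := (_ - _) * t => hS hC.
have : 4 * (sin u ^+ 2 * (C ^+ 2 + S ^+ 2)) = 2 - 2 * cos (u + v).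
  transitivity ((2 * sin u * C) ^+ 2 + (2 * sin u * S) ^+ 2); first by ring.
  rewrite hS hC cosD.
  transitivity ((cos u ^+ 2 + sin u ^+ 2) + (cos v ^+ 2 + sin v ^+ 2) -
    2 * (cos u * cos v - sin u * sin v)); first by ring.
  by rewrite !cos2Dsin2; ring.
have := cos_geN1 (u + v); lra.
Qed.

Lemma fejerE (R : realType) (L : nat) (t : R) :
  fejer L t = \sum_(0 <= i < L) \sum_(0 <= j < L) cos ((i%:R - j%:R) * t).
Proof.
rewrite /fejer !expr2 !big_distrlr /= -big_split /=; apply: eq_bigr => i _.
rewrite -big_split /=; apply: eq_bigr => j _.
by rewrite mulrBl cosB.
Qed.

Lemma sum_sin_antisym (R : realType) (L : nat) (t : R) :
  \sum_(0 <= i < L) \sum_(0 <= j < L) sin ((i%:R - j%:R) * t) = 0.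
Proof.
set S := LHS; suff : S = - S by lra.
rewrite {1}/S exchange_big /= -sumrN; apply: eq_bigr => i _.
rewrite -sumrN; apply: eq_bigr => j _.
by rewrite -sinN -mulNr opprB.
Qed.

Lemma fejer_le (R : realType) (L : nat) (t : R) : fejer L t <= L%:R ^+ 2.
Proof.
rewrite fejerE.
apply: (@le_trans _ _ (\sum_(0 <= i < L) \sum_(0 <= j < L) 1)).
  by apply: ler_sum => i _; apply: ler_sum => j _; exact: cos_le1.
by rewrite !sumr_const_nat subn0 -[X in X <= _]mulr_natr expr2.
Qed.

Lemma cos_sin_2pin (R : realType) (n : nat) :
  (cos (n%:R * (2 * pi)) = 1 :> R) * (sin (n%:R * (2 * pi)) = 0 :> R).
Proof.
have c1 : cos (2 * pi) = 1 :> R by rewrite mulr_natl cos2pi.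
have s1 : sin (2 * pi) = 0 :> R by rewrite mulr_natl sin2pi.
elim: n => [|n [IHc IHs]]; first by rewrite mulr0n mul0r cos0 sin0.
by rewrite -natr1 mulrDl mul1r cosD sinD IHc IHs c1 s1 !(mulr0, mul0r, mulr1, subr0, addr0).
Qed.

Lemma sum_cos_orthogonality (R : realType) (d m m' : nat) : (0 < d)%N ->
  \sum_(0 <= h < d) cos (h%:R * (2 * pi / d%:R) * (m%:R - m'%:R)) =
  (if m == m' %[mod d] then d%:R else 0) :> R.
Proof.
move=> d0.
wlog le : m m' / (m' <= m)%N.
  move=> hw; case: (leqP m' m) => [/hw //|/ltnW /hw].
  rewrite eq_sym => <-; apply: eq_bigr => h _.
  by rewrite -cosN -mulrN opprB.
rewrite -(subnKC le); set j := (m - m')%N.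
rewrite natrD addrAC subrr add0r.
have -> : (m' + j == m' %[mod d]) = (j %% d == 0)%N.
  by rewrite -{2}(addn0 m') eqn_modDl mod0n.
have dn0 : d%:R != 0 :> R by rewrite pnatr_eq0 -lt0n.
have [q [r [rd ->]]] : exists q r, ((r < d) /\ j = q * d + r)%N.
  by exists (j %/ d)%N, (j %% d)%N; rewrite ltn_mod d0 -divn_eq.
rewrite modnMDl modn_small //.
transitivity (\sum_(0 <= h < d) cos (h%:R * (2 * pi / d%:R * r%:R)) : R).
  apply: eq_bigr => h _.
  have -> : h%:R * (2 * pi / d%:R) * (q * d + r)%:R =
    (h * q)%:R * (2 * pi) + h%:R * (2 * pi / d%:R * r%:R) :> R.
    by rewrite natrD !natrM; field.
  by rewrite cosD !cos_sin_2pin mul1r mul0r subr0.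
case: eqVneq => [->|r0].
  transitivity (\sum_(0 <= h < d) (1 : R)); last by rewrite sumr_const_nat subn0.
  by apply: eq_bigr => h _; rewrite mulr0n !mulr0 cos0.
(* Since $dt$ is a multiple of $2\pi$, the right side of the closed form vanishes, while
   $\sin(t/2)=\sin(\pi r/d)\neq0$ for $0<r<d$. *)
have := mul_sin_sum_cos d (2 * pi / d%:R * r%:R : R).
set t := 2 * pi / d%:R * r%:R; set S := \sum_(_ <= _ < _) _.
have -> : (d%:R - 2^-1) * t = r%:R * (2 * pi) - t / 2 by rewrite /t; field.
rewrite sinB !cos_sin_2pin mul0r mul1r sub0r addNr.
have s0 : sin (t / 2) != 0.
  rewrite gt_eqF // sin_gt0_pi //.
  have -> : t / 2 = pi * (r%:R / d%:R) by rewrite /t; field.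
  have d1 : 0 < d%:R :> R by rewrite ltr0n.
  rewrite mulr_gt0 ?pi_gt0 ?divr_gt0 ?ltr0n // ?lt0n //=.
  by rewrite -[ltRHS]mulr1 ltr_pM2l ?pi_gt0 // ltr_pdivrMr // mul1r ltr_nat.
by move=> /eqP; rewrite !mulf_eq0 (negPf s0) pnatr_eq0 /= => /eqP.
Qed.

(** * Cauchy-Schwarz, duality and the large sieve inequality *)

(** Lagrange's identity: twice the defect in Cauchy-Schwarz is the double sum of
    $(f_ig_j-f_jg_i)^2$. *)
Lemma sqr_sum_mul_le (R : realType) (I : Type) (r : seq I) (P : pred I) (f g : I -> R) :
  (\sum_(i <- r | P i) f i * g i) ^+ 2 <=
  (\sum_(i <- r | P i) f i ^+ 2) * (\sum_(i <- r | P i) g i ^+ 2).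
Proof.
rewrite -subr_ge0 -(pmulr_rge0 _ (ltr0Sn R 1)).
set F := \sum_(i <- r | P i) f i ^+ 2; set G := \sum_(i <- r | P i) g i ^+ 2.
set X := \sum_(i <- r | P i) _.
suff -> : 2 * (F * G - X ^+ 2) =
    \sum_(i <- r | P i) \sum_(j <- r | P j) (f i * g j - f j * g i) ^+ 2.
  by apply: sumr_ge0 => i _; apply: sumr_ge0 => j _; exact: sqr_ge0.
transitivity (F * G + G * F - 2 * (X * X)); first by ring.
rewrite /F /G /X !big_distrlr /= mulr_sumr -big_split /= -sumrB.
apply: eq_bigr => i _; rewrite mulr_sumr -big_split /= -sumrB.
by apply: eq_bigr => j _; ring.
Qed.

(** The left side is the squared modulus of $\sum_i (C_i-\mathrm{i}S_i)e^{\mathrm{i}t\theta_i}$ in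
    real form. *)
Lemma sqr_trig_sum_expand (R : realType) (I : finType) (A : {pred I})
    (C S th : I -> R) (t : R) :
  (\sum_(i in A) (C i * cos (t * th i) + S i * sin (t * th i))) ^+ 2 +
  (\sum_(i in A) (C i * sin (t * th i) - S i * cos (t * th i))) ^+ 2 =
  \sum_(i in A) \sum_(j in A)
    ((C i * C j + S i * S j) * cos (t * (th i - th j)) +
     (S i * C j - C i * S j) * sin (t * (th i - th j))).
Proof.
rewrite !expr2 !big_distrlr /= -big_split /=; apply: eq_bigr => i _.
rewrite -big_split /=; apply: eq_bigr => j _.
by rewrite [t * (_ - _)]mulrBr cosB sinB; ring.
Qed.

(** Each of the first [L - M] values of [j] is followed by a full window [i = j, ..., j + M - 1].
    This trades the sharp interval of length [M] for a double sum over differences, on which the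
    Fejer kernel appears. *)
Lemma sum_diff_ge (R : realType) (L M : nat) (f : R -> R) : (M <= L)%N ->
  (forall t, 0 <= f t) ->
  (L - M)%:R * \sum_(0 <= m < M) f m%:R <=
  \sum_(0 <= i < L) \sum_(0 <= j < L) f (i%:R - j%:R).
Proof.
move=> ML f0; rewrite exchange_big /=.
rewrite (big_cat_nat (leq0n (L - M)%N) (leq_subr M L)) /=.
apply: ler_wpDr.
  by apply: sumr_ge0 => i _; apply: sumr_ge0.
rewrite mulr_natl -[X in _ *+ X]subn0 -sumr_const_nat.
apply: ler_sum_nat => i /andP[_ iLM].
have iM : (i + M <= L)%N by lia.
have i0 : (i <= L)%N by lia.
rewrite (big_cat_nat (leq0n i) i0) /=.
rewrite (big_cat_nat (leq_addr M i) iM) /=.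
apply: ler_wpDl; first by apply: sumr_ge0.
apply: ler_wpDr; first by apply: sumr_ge0.
suff -> : \sum_(i <= j < i + M) f (j%:R - i%:R) = \sum_(0 <= m < M) f m%:R by [].
rewrite -{1}[i]add0n big_addn addKn.
by apply: eq_bigr => m _; rewrite natrD addrK.
Qed.

(* Fejer weights make the quadratic form diagonally dominant (Schur's test). *)
Lemma dual_large_sieve (R : realType) (I : finType) (A : {pred I})
    (C S th : I -> R) (L M : nat) (B : R) : (M <= L)%N ->
  (forall i, i \in A -> \sum_(j in A) fejer L (th i - th j) <= B) ->
  (L - M)%:R * \sum_(0 <= m < M)
     (\sum_(i in A) (C i * cos (m%:R * th i) + S i * sin (m%:R * th i))) ^+ 2 <=
  B * \sum_(i in A) (C i ^+ 2 + S i ^+ 2).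
Proof.
move=> ML hB.
(* Only the first square is to be bounded. The second completes it to a squared modulus, whose
   expansion depends on the differences of the [th i] alone. *)
pose f t := (\sum_(i in A) (C i * cos (t * th i) + S i * sin (t * th i))) ^+ 2 +
  (\sum_(i in A) (C i * sin (t * th i) - S i * cos (t * th i))) ^+ 2.
have f0 t : 0 <= f t by rewrite addr_ge0 // sqr_ge0.
apply: (@le_trans _ _ ((L - M)%:R * \sum_(0 <= m < M) f m%:R)).
  apply: ler_wpM2l => //; apply: ler_sum => m _.
  by rewrite lerDl sqr_ge0.
apply: (le_trans (sum_diff_ge ML f0)).
have -> : \sum_(0 <= i < L) \sum_(0 <= j < L) f (i%:R - j%:R) =
    \sum_(i in A) \sum_(j in A) (C i * C j + S i * S j) * fejer L (th i - th j).
  transitivity (\sum_(p in A) \sum_(q in A) \sum_(0 <= i < L) \sum_(0 <= j < L)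
     ((C p * C q + S p * S q) * cos ((i%:R - j%:R) * (th p - th q)) +
     (S p * C q - C p * S q) * sin ((i%:R - j%:R) * (th p - th q)))).
    under eq_bigr do under eq_bigr do rewrite /f sqr_trig_sum_expand.
    under eq_bigr do (rewrite exchange_big /=; under eq_bigr do rewrite exchange_big /=).
    rewrite exchange_big /=; apply: eq_bigr => p _.
    by rewrite exchange_big.
  apply: eq_bigr => p _; apply: eq_bigr => q _.
  under eq_bigr do rewrite big_split /= -!mulr_sumr.
  by rewrite big_split /= -!mulr_sumr sum_sin_antisym mulr0 addr0 -fejerE.
have fejerC t : fejer L (- t) = fejer L t.
  rewrite !fejerE; apply: eq_bigr => i _; apply: eq_bigr => j _.
  by rewrite mulrN cosN.
apply: (@le_trans _ _ (\sum_(i in A) \sum_(j in A)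
   (2^-1 * ((C i ^+ 2 + S i ^+ 2) * fejer L (th i - th j)) +
    2^-1 * ((C j ^+ 2 + S j ^+ 2) * fejer L (th j - th i))))).
  apply: ler_sum => i _; apply: ler_sum => j _.
  rewrite -(opprB (th i)) fejerC -mulrDr -mulrDl mulrA.
  apply: ler_wpM2r; first exact: fejer_ge0.
  have := sqr_ge0 (C i - C j); have := sqr_ge0 (S i - S j); nra.
under eq_bigr do rewrite big_split /=.
rewrite big_split /= [X in _ + X]exchange_big /= -big_split /= mulr_sumr.
apply: ler_sum => i iA.
rewrite -!mulr_sumr.
have -> : forall y z : R, 2^-1 * (y * z) + 2^-1 * (y * z) = z * y by move=> y z; field.
by apply: ler_wpM2r; [rewrite addr_ge0 // sqr_ge0 | exact: hB].
Qed.

(** Duality: the left sum [T] is the pairing of [a] with the adjoint sum [P]. Cauchy-Schwarz and the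
    dual inequality applied to the coefficients [C], [S] bound $T^2$ by a multiple of $T$, and one
    factor cancels. *)
Lemma large_sieve (R : realType) (I : finType) (A : {pred I})
    (th : I -> R) (a : nat -> R) (L M : nat) (B : R) : (M <= L)%N -> 0 <= B ->
  (forall i, i \in A -> \sum_(j in A) fejer L (th i - th j) <= B) ->
  (L - M)%:R * \sum_(i in A) ((\sum_(0 <= m < M) a m * cos (m%:R * th i)) ^+ 2 +
                    (\sum_(0 <= m < M) a m * sin (m%:R * th i)) ^+ 2) <=
  B * \sum_(0 <= m < M) a m ^+ 2.
Proof.
move=> ML B0 hB.
pose C i := \sum_(0 <= m < M) a m * cos (m%:R * th i).
pose S i := \sum_(0 <= m < M) a m * sin (m%:R * th i).
pose T := \sum_(i in A) (C i ^+ 2 + S i ^+ 2).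
set N := \sum_(0 <= m < M) a m ^+ 2; change ((L - M)%:R * T <= B * N).
have T0 : 0 <= T by apply: sumr_ge0 => i _; rewrite addr_ge0 // sqr_ge0.
have N0 : 0 <= N by apply: sumr_ge0 => i _; rewrite sqr_ge0.
pose P m := \sum_(i in A) (C i * cos (m%:R * th i) + S i * sin (m%:R * th i)).
have TE : T = \sum_(0 <= m < M) a m * P m.
  rewrite /P /T; under [RHS]eq_bigr do rewrite mulr_sumr.
  rewrite exchange_big /=; apply: eq_bigr => i _.
  rewrite !expr2 {1}/C {1}/S !mulr_suml -big_split /=.
  by apply: eq_bigr => m _; ring.
have cs : T ^+ 2 <= N * \sum_(0 <= m < M) P m ^+ 2.
  by rewrite TE; exact: sqr_sum_mul_le.
have dl := dual_large_sieve C S ML hB.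
have [T00|T0'] := eqVneq T 0; first by rewrite T00 mulr0 mulr_ge0.
have Tp : 0 < T by rewrite lt_neqAle eq_sym T0'.
rewrite -(ler_pM2r Tp) -mulrA -expr2.
apply: (@le_trans _ _ ((L - M)%:R * (N * \sum_(0 <= m < M) P m ^+ 2))).
  exact: ler_wpM2l.
by rewrite mulrCA [leRHS]mulrAC [leRHS]mulrC; exact: ler_wpM2l.
Qed.

(** * Decay of the kernel and spacing of the fractions h/d *)

(** A weak form of Jordan's inequality. On $[0,\pi/4]$ the cosine is at least $1/2$, hence $\sin
    y\ge y/2$ by the mean value theorem, and $\sin 2y=2\sin y\cos y$ doubles the range. *)
Lemma sin_ge_quarter (R : realType) (x : R) : 0 <= x <= pi / 2 -> x / 4 <= sin x.
Proof.
move=> /andP[x0 xp].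
have p2 := pi_ge2 R.
have [y yE] : exists y, x = y + y by exists (x / 2); field.
have y0 : 0 <= y by lra.
have yp : y <= pi / 4 by lra.
have hc (c : R) : 0 <= c <= pi / 4 -> 2^-1 <= cos c.
  move=> /andP[c0 cp].
  have ch : 0 <= cos (pi / 4 : R) by apply: cos_ge0_pihalf; lra.
  have : cos (pi / 4) <= cos c.
    case: (eqVneq c (pi / 4)) => [->//|ne].
    by apply: ltW; rewrite ltr_cos ?in_itv /= ?lt_neqAle ?ne ?cp //; lra.
  have := cos_pihalf R; rewrite (_ : pi / 2 = pi / 4 + pi / 4); last by field.
  rewrite cosD; have := cos2Dsin2 (pi / 4 : R); move: ch.
  set q := cos (pi / 4); set s := sin _; rewrite !expr2 => q0 h1 h2 qc.
  nra.
rewrite yE sinD.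
have sy : y / 2 <= sin y.
  case: (ltP 0 y) => [yp0|]; last first.
    move=> yn; have -> : y = 0 by lra.
    by rewrite mul0r sin0 lexx.
  have [|c /[!in_itv] /= /andP[c0 cy]] := @MVT R sin cos 0 y yp0.
    by apply: continuous_subspaceT => z; exact: continuous_sin.
  rewrite sin0 !subr0 => ->.
  have : 2^-1 <= cos c by apply: hc; lra.
  by move=> h; rewrite mulrC; apply: ler_wpM2r.
have : 2^-1 <= cos y by apply: hc; lra.
nra.
Qed.

(** The decay is in the distance from [t] to the nearest integer, here [t] or [1 - t]; adding both
    terms avoids the minimum. *)
Lemma fejer_le_inv_sqr (R : realType) (L : nat) (t : R) : 0 < t < 1 ->
  fejer L (2 * pi * t) <= 4 * (t ^-1) ^+ 2 + 4 * ((1 - t)^-1) ^+ 2.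
Proof.
move=> /andP[t0 t1].
have p2 := pi_ge2 R.
have := sqr_sin_mul_fejer L (2 * pi * t).
rewrite (_ : 2 * pi * t / 2 = pi * t); last by field.
have F0 := fejer_ge0 L (2 * pi * t).
set F := fejer _ _ in F0 *.
have key (s u : R) : 0 < u -> u / 2 <= s -> s ^+ 2 * F <= 1 -> F <= 4 * (u^-1) ^+ 2.
  move=> u0 us h.
  have hh : (u / 2) ^+ 2 <= s ^+ 2 by rewrite lerXn2r ?nnegrE //; lra.
  have : (u / 2) ^+ 2 * F <= 1 by apply: le_trans h; exact: ler_wpM2r.
  have -> : 4 * u^-1 ^+ 2 = 1 / (u / 2) ^+ 2 by field; lra.
  have q0 : 0 < (u / 2) ^+ 2 by rewrite exprn_gt0 // divr_gt0.
  by rewrite ler_pdivlMr // mulrC.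
have t'0 : 0 < 1 - t by lra.
case: (lerP t (2^-1)) => tl h.
- apply: (@le_trans _ _ (4 * t^-1 ^+ 2)); last by rewrite lerDl mulr_ge0 // sqr_ge0.
  apply: key h => //.
  have : pi * t / 4 <= sin (pi * t) by apply: sin_ge_quarter; nra.
  nra.
- apply: (@le_trans _ _ (4 * (1 - t)^-1 ^+ 2)); last by rewrite lerDr mulr_ge0 // sqr_ge0.
  apply: key h => //.
  have -> : sin (pi * t) = sin (pi * (1 - t)).
    by rewrite mulrBr mulr1 sinB sinpi cospi mul0r sub0r mulN1r opprK.
  have : pi * (1 - t) / 4 <= sin (pi * (1 - t)) by apply: sin_ge_quarter; nra.
  nra.
Qed.

Lemma sum_inv_sqr_le (R : realType) (n : nat) :
  \sum_(1 <= v < n.+1) (v%:R^-1) ^+ 2 <= 2 :> R.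
Proof.
case: n => [|n]; first by rewrite big_geq.
apply: (@le_trans _ _ (2 - n.+1%:R^-1)); last by rewrite gerBl invr_ge0.
elim: n => [|n IH]; first by rewrite big_nat1 invr1 expr1n; lra.
rewrite big_nat_recr //=; apply: (le_trans (lerD IH (lexx _))).
have a0 : 0 < n.+1%:R :> R by rewrite ltr0n.
rewrite -[n.+2%:R]natr1; set a := n.+1%:R in a0 *.
rewrite -subr_ge0.
have -> : 2 - (a + 1)^-1 - (2 - a^-1 + (a + 1)^-1 ^+ 2) = (a * (a + 1) ^+ 2)^-1.
  by field; lra.
by rewrite invr_ge0 mulr_ge0 // ?sqr_ge0 // ltW.
Qed.

Lemma sum_inj_le (R : realType) (I : finType) (P : pred I) (phi : I -> nat)
    (g : nat -> R) (J : nat) :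
  (forall x y, P x -> P y -> phi x = phi y -> x = y) ->
  (forall i, P i -> phi i < J)%N -> (forall u, 0 <= g u) ->
  \sum_(i | P i) g (phi i) <= \sum_(0 <= u < J) g u.
Proof.
move=> inj lt g0.
have -> : \sum_(i | P i) g (phi i) = \sum_(u <- [seq phi i | i <- enum P]) g u.
  by rewrite big_map big_enum.
have un : uniq [seq phi i | i <- enum P].
  by rewrite map_inj_in_uniq ?enum_uniq // => x y; rewrite !mem_enum; exact: inj.
rewrite [leRHS](bigID (mem [seq phi i | i <- enum P])) /=.
apply: ler_wpDr; first exact: sumr_ge0.
rewrite -[leRHS]big_filter [leRHS](perm_big [seq phi i | i <- enum P]) //=.
rewrite perm_sym; apply: uniq_perm => //; first by rewrite filter_uniq // iota_uniq.
move=> u; rewrite mem_filter mem_index_iota /=.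
case: (boolP (u \in _)) => //= /mapP[i]; rewrite mem_enum => iA ->.
by rewrite lt.
Qed.

(** The points occupy distinct cells of the grid of mesh [1 / J]. For cells at distance [u], going
    around the circle as well, two points are at least [(u - 1) / J] apart; so the kernel values
    decay like inverse squares, and only neighbouring cells need the trivial bound $L^2$. *)
Lemma sum_fejer_spaced_le (R : realType) (I : finType) (A : {pred I})
    (x : I -> R) (j : I -> nat) (J L : nat) :
  (forall i, i \in A -> 0 < x i < 1) -> (forall i, i \in A -> j i < J)%N ->
  (forall i, i \in A -> (j i)%:R <= J%:R * x i < (j i).+1%:R) ->
  {in A &, injective j} ->
  forall i, i \in A ->
  \sum_(k in A) fejer L (2 * pi * x i - 2 * pi * x k) <=
  8 * L%:R ^+ 2 + 32 * J%:R ^+ 2.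
Proof.
move=> hx jJ hj inj i iA.
have fejerC t : fejer L (- t) = fejer L t :> R.
  rewrite !fejerE; apply: eq_bigr => p _; apply: eq_bigr => q _.
  by rewrite mulrN cosN.
(* [kap] bounds the kernel at cell distance [u] in one direction; [g] adds the distance [J - u]
   taken the other way around the circle. *)
pose kap (u : nat) : R := if (u <= 1)%N then L%:R ^+ 2 else 4 * J%:R ^+ 2 * (u.-1%:R^-1) ^+ 2.
have kap0 u : 0 <= kap u.
  by rewrite /kap; case: ifP => _; rewrite ?sqr_ge0 // !mulr_ge0 // sqr_ge0.
pose g u := kap u + kap (J - u)%N.
have g0 u : 0 <= g u by rewrite addr_ge0.
have key p q : p \in A -> q \in A -> (j q <= j p)%N ->
    fejer L (2 * pi * x p - 2 * pi * x q) <= g (j p - j q)%N.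
  move=> pA qA; rewrite /g; set u := (j p - j q)%N.
  case: (leqP u 1) => u1 qp.
    by apply: ler_wpDr => //; rewrite /kap u1 fejer_le.
  case: (leqP (J - u) 1) => u2.
    by apply: ler_wpDl => //; rewrite /kap u2 fejer_le.
  have [e1 e2 u3 u4 Jp] : [/\ j p = u.-1 + (j q).+1, J = (J - u).-1 + ((j p).+1 - j q),
     0 < u.-1, 0 < (J - u).-1 & 0 < J]%N.
    by have := jJ p pA; move: qp u1 u2; rewrite /u; clear; split; lia.
  rewrite -mulrBr.
  have /andP[xp0 xp1] := hx p pA; have /andP[xq0 xq1] := hx q qA.
  have /andP[jp0 jp1] := hj p pA; have /andP[jq0 jq1] := hj q qA.
  have J0 : 0 < J%:R :> R by rewrite ltr0n.
  set t := x p - x q.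
  have t1 : u.-1%:R <= J%:R * t.
    have : (j p)%:R = u.-1%:R + (j q).+1%:R :> R by rewrite -natrD -e1.
    by move: jp0 jq1; rewrite /t mulrBr; clear; lra.
  have t2 : (J - u).-1%:R <= J%:R * (1 - t).
    have : J%:R = (J - u).-1%:R + ((j p).+1%:R - (j q)%:R) :> R.
      by rewrite -natrB ?(leq_trans qp) // -natrD -e2.
    by move: jp1 jq0; rewrite mulrBr mulr1 /t mulrBr; clear; lra.
  have p1 : 0 < u.-1%:R :> R by rewrite ltr0n.
  have p2 : 0 < (J - u).-1%:R :> R by rewrite ltr0n.
  have t0 : 0 < t by rewrite -(pmulr_rgt0 _ J0); apply: lt_le_trans t1.
  have t0' : 0 < 1 - t by rewrite -(pmulr_rgt0 _ J0); apply: lt_le_trans t2.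
  have inv (v w : R) : 0 < v -> 0 < w -> v <= J%:R * w ->
      4 * w^-1 ^+ 2 <= 4 * J%:R ^+ 2 * v^-1 ^+ 2.
    move=> v0 w0 h; rewrite -mulrA ler_pM2l // -exprMn lerXn2r ?nnegrE ?mulr_ge0 ?invr_ge0 ?(ltW v0) ?(ltW w0) //.
    by rewrite -[w^-1]mul1r ler_pdivrMr // mulrAC ler_pdivlMr // mul1r.
  apply: (le_trans (fejer_le_inv_sqr _ _)); first by rewrite t0 -subr_gt0.
  rewrite /kap leqNgt u1 /= leqNgt u2 /=.
  by apply: lerD; apply: inv.
have J0 : (0 < J)%N by apply: leq_ltn_trans (jJ i iA).
have ks : \sum_(0 <= u < J.+1) kap u <= 2 * L%:R ^+ 2 + 8 * J%:R ^+ 2.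
  rewrite big_ltn // big_ltn // addrA.
  apply: lerD; first by rewrite /kap /=; lra.
  rewrite big_add1 /= (eq_big_nat _ _ (F2 := fun v : nat => 4 * J%:R ^+ 2 * v%:R^-1 ^+ 2)).
    rewrite -mulr_sumr -{2}(prednK J0).
    have -> : 8 * J%:R ^+ 2 = 4 * J%:R ^+ 2 * 2 :> R by ring.
    by apply: ler_wpM2l; [rewrite mulr_ge0 // sqr_ge0 | exact: sum_inv_sqr_le].
  by move=> v /andP[v1 _]; rewrite /kap ltnNge v1.
have gsum : \sum_(0 <= u < J) g u <= 4 * L%:R ^+ 2 + 16 * J%:R ^+ 2.
  rewrite big_split /= [X in _ + X]big_nat_rev /=.
  have h1 : \sum_(0 <= u < J) kap u <= \sum_(0 <= u < J.+1) kap u.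
    by rewrite big_nat_recr //= lerDl.
  have h2 : \sum_(0 <= u < J) kap (J - (0 + J - u.+1))%N <= \sum_(0 <= u < J.+1) kap u.
    rewrite big_nat_recl //=; apply: ler_wpDl => //.
    by apply: ler_sum_nat => u /andP[_ uJ]; rewrite add0n subKn // (leq_trans _ uJ).
  lra.
rewrite (bigID (fun k => j k <= j i)%N) /=.
have h1 : \sum_(k in A | (j k <= j i)%N) fejer L (2 * pi * x i - 2 * pi * x k) <=
    \sum_(0 <= u < J) g u.
  apply: le_trans (_ : \sum_(k in A | (j k <= j i)%N) g (j i - j k)%N <= _).
    by apply: ler_sum => k /andP[kA le]; exact: key.
  apply: sum_inj_le => //.
    move=> p q /andP[pA lep] /andP[qA leq] e; apply: inj => //; move: lep leq e; clear; lia.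
  by move=> k /andP[kA le]; have := jJ i iA; move: le; clear; lia.
have h2 : \sum_(k in A | ~~ (j k <= j i)%N) fejer L (2 * pi * x i - 2 * pi * x k) <=
    \sum_(0 <= u < J) g u.
  apply: le_trans (_ : \sum_(k in A | ~~ (j k <= j i)%N) g (j k - j i)%N <= _).
    apply: ler_sum => k /andP[kA]; rewrite -ltnNge => /ltnW le.
    by rewrite -opprB fejerC; exact: key.
  apply: sum_inj_le => //.
    move=> p q /andP[pA lep] /andP[qA leq] e; apply: inj => //; move: lep leq e; clear; lia.
  by move=> k /andP[kA le]; have := jJ k kA; move: le; clear; lia.
lra.
Qed.

(** If $h/d$ exceeded $h'/d'$, the gap would be at least $1/(dd')\ge 1/Q^2$, and the two multiples
    by $Q^2$ could not share the integer part [k]. *)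
Lemma cross_mul_floor_lt (Q d h d' h' k : nat) : (d <= Q)%N -> (d' <= Q)%N ->
  (0 < d)%N -> (0 < d')%N ->
  (h * Q ^ 2 %/ d = k)%N -> (h' * Q ^ 2 %/ d' = k)%N -> (h * d' <= h' * d)%N.
Proof.
move=> dQ dQ' d0 d0' e e'.
have l1 : (h * Q ^ 2 < k.+1 * d)%N by rewrite -ltn_divLR // e.
have l2 : (k * d' <= h' * Q ^ 2)%N by rewrite -leq_divRL // e'.
rewrite leqNgt; apply/negP => lt.
have Q2 : (d * d' <= Q ^ 2)%N by rewrite expnS expn1 leq_mul.
nia.
Qed.

(* Distinct fractions h/d with d <= Q are at distance at least 1/Q^2. *)
Lemma farey_floor_inj (Q d h d' h' : nat) : prime d -> prime d' ->
  (d <= Q)%N -> (d' <= Q)%N -> (0 < h < d)%N -> (0 < h' < d')%N ->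
  (h * Q ^ 2 %/ d = h' * Q ^ 2 %/ d')%N -> (d = d') /\ (h = h').
Proof.
move=> pd pd' dQ dQ' /andP[h0 hd] /andP[h0' hd'] e.
have d0 := prime_gt0 pd; have d0' := prime_gt0 pd'.
have E : (h * d' = h' * d)%N.
  by apply/eqP; rewrite eqn_leq (cross_mul_floor_lt dQ dQ' d0 d0' e erefl)
     (cross_mul_floor_lt dQ' dQ d0' d0 (esym e) erefl).
have ed : d = d'.
  have : (d %| h * d')%N by rewrite E dvdn_mull.
  rewrite Euclid_dvdM // gtnNdvd //= => /prime_nt_dvdP; apply => //.
  by rewrite gtn_eqF ?prime_gt1.
split=> //; move: E; rewrite ed => /eqP; rewrite eqn_pmul2r // => /eqP //.
Qed.

(** The cells are those of mesh $1/Q^2$: for prime moduli every fraction h/d with 0 < h < d is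
    reduced, so no cell holds two of them. *)
Lemma large_sieve_primes (R : realType) (Q M : nat) (a : nat -> R) :
  \sum_(0 <= d < Q.+1 | prime d) \sum_(1 <= h < d)
     ((\sum_(0 <= m < M) a m * cos (m%:R * (2 * pi * (h%:R / d%:R)))) ^+ 2 +
      (\sum_(0 <= m < M) a m * sin (m%:R * (2 * pi * (h%:R / d%:R)))) ^+ 2) <=
  160 * (M%:R + Q%:R ^+ 2) * \sum_(0 <= m < M) a m ^+ 2.
Proof.
pose I : finType := ('I_Q.+1 * 'I_Q.+1)%type.
pose A : {pred I} := [pred p : I | prime p.1 && (0 < p.2 < p.1)%N].
pose x (p : I) : R := p.2%:R / p.1%:R.
pose j (p : I) := (p.2 * Q ^ 2 %/ p.1)%N.
(* With this [L] both [L - M] and [L / 2] are comparable to $M+Q^2$. Row sums are at most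
   $8L^2+32Q^4\le 40L^2$, and dividing by $L-M\ge L/2$ leaves $80L=160(M+Q^2)$. *)
pose L := (2 * (M + Q ^ 2))%N.
set W := fun t : R => (\sum_(0 <= m < M) a m * cos (m%:R * (2 * pi * t))) ^+ 2 +
      (\sum_(0 <= m < M) a m * sin (m%:R * (2 * pi * t))) ^+ 2.
have -> : \sum_(0 <= d < Q.+1 | prime d) \sum_(1 <= h < d) W (h%:R / d%:R) =
    \sum_(p in A) W (x p).
  rewrite big_mkord -(pair_big_dep (fun d : 'I_Q.+1 => prime d)
     (fun d h : 'I_Q.+1 => (0 < h < d)%N) (fun d h : 'I_Q.+1 => W (h%:R / d%:R))) /=.
  apply: eq_bigr => d pd.
  rewrite (big_nat_widen _ _ Q.+1) ?(ltnW (ltn_ord d)) //.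
  rewrite big_nat_cond.
  rewrite [RHS](_ : _ = \sum_(0 <= h < Q.+1 | (0 < h < d)%N) W (h%:R / d%:R)); last by rewrite big_mkord.
  rewrite [RHS]big_nat_cond (big_ltn_cond (m := 0)) //=.
  by apply: eq_bigl => h; clear; lia.
have [Q0|Q0] := posnP Q.
  rewrite big_pred0 ?mulr_ge0 ?addr_ge0 ?sqr_ge0 ?sumr_ge0 // => [i _|p]; first exact: sqr_ge0.
  by apply/negbTE; apply/negP => /andP[/= pp]; have h : (1 < Q)%N := leq_trans (prime_gt1 pp) (ltn_ord p.1); rewrite Q0 in h.
have hx p : p \in A -> 0 < x p < 1.
  move=> /andP[/= pp /andP[h0 h1]].
  have d0 : 0 < p.1%:R :> R by rewrite ltr0n prime_gt0.
  apply/andP; split; first by rewrite divr_gt0 // ltr0n.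
  by rewrite /x ltr_pdivrMr // mul1r ltr_nat.
have ML : (M <= L)%N by rewrite /L; clear; lia.
have hB : forall i, i \in A ->
    \sum_(k in A) fejer L (2 * pi * x i - 2 * pi * x k) <= 40 * L%:R ^+ 2 :> R.
  move=> i iA; apply: (@le_trans _ _ (8 * L%:R ^+ 2 + 32 * (Q ^ 2)%:R ^+ 2)).
    apply: (@sum_fejer_spaced_le R I A x j) => //.
    - move=> p /andP[/= pp /andP[h0 h1]].
      rewrite /j ltn_divLR ?prime_gt0 // mulnC ltn_pmul2l // expn_gt0 Q0 //.
    - move=> p /andP[/= pp /andP[h0 h1]].
      have d0 : 0 < p.1%:R :> R by rewrite ltr0n prime_gt0.
      rewrite /x mulrA ler_pdivlMr // ltr_pdivrMr // -!natrM ler_nat ltr_nat.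
      by rewrite (mulnC (Q ^ 2)%N) -leq_divRL ?prime_gt0 // leqnn -ltn_divLR ?prime_gt0 // ltnSn.
    - move=> [d h] [d' h'] /andP[/= pd hd] /andP[/= pd' hd'] e.
      have [||/val_inj -> /val_inj -> //] := farey_floor_inj pd pd' _ _ hd hd' e.
        by rewrite -ltnS.
      by rewrite -ltnS.
  have : (Q ^ 2)%:R ^+ 2 <= L%:R ^+ 2 :> R.
    by rewrite lerXn2r ?nnegrE // ler_nat /L; clear; lia.
  lra.
have B0 : 0 <= 40 * L%:R ^+ 2 :> R by rewrite mulr_ge0 // sqr_ge0.
have LM0 : 0 < (M + Q ^ 2)%:R :> R by rewrite ltr0n addn_gt0 expn_gt0 Q0 orbT.
have LM : (M + Q ^ 2)%:R <= (L - M)%:R :> R by rewrite ler_nat /L; clear; lia.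
set T := \sum_(p in A) _; set N := \sum_(0 <= m < M) _.
have h : (L - M)%:R * T <= 40 * L%:R ^+ 2 * N := large_sieve a ML B0 hB.
have T0 : 0 <= T by apply: sumr_ge0 => i _; rewrite addr_ge0 // sqr_ge0.
have LE : L%:R = 2 * (M + Q ^ 2)%:R :> R by rewrite /L natrM.
rewrite LE in h.
have -> : M%:R + Q%:R ^+ 2 = (M + Q ^ 2)%:R :> R by rewrite natrD natrX.
rewrite -(ler_pM2l LM0); apply: (le_trans (ler_wpM2r T0 LM)).
apply: (le_trans h).
by rewrite le_eqVlt; apply/orP; left; apply/eqP; ring.
Qed.

(** * Bilinear forms in residue classes *)

(** The variance of [a] over the residue classes modulo [d], seen on the Fourier side: omitting the
    frequency [h = 0] removes the mean. *)
Definition resvar (R : realType) (d M : nat) (a : nat -> R) : R :=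
  d%:R^-1 * \sum_(1 <= h < d)
    ((\sum_(0 <= m < M) a m * cos (m%:R * (2 * pi * (h%:R / d%:R)))) ^+ 2 +
     (\sum_(0 <= m < M) a m * sin (m%:R * (2 * pi * (h%:R / d%:R)))) ^+ 2).

Lemma resvar_ge0 (R : realType) (d M : nat) (a : nat -> R) : 0 <= resvar d M a.
Proof.
rewrite mulr_ge0 ?invr_ge0 //; apply: sumr_ge0 => h _.
by rewrite addr_ge0 // sqr_ge0.
Qed.

Lemma sqr_sum_residues (R : realType) (F : finType) (phi : nat -> F)
    (M : nat) (a : nat -> R) :
  \sum_s (\sum_(0 <= m < M | phi m == s) a m) ^+ 2 =
  \sum_(0 <= m < M) \sum_(0 <= m' < M | phi m == phi m') a m * a m'.
Proof.
transitivity (\sum_s \sum_(0 <= m < M | phi m == s)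
    \sum_(0 <= m' < M | phi m == phi m') a m * a m').
  apply: eq_bigr => s _; rewrite expr2 big_distrlr /=.
  by apply: eq_bigr => m /eqP <-; apply: eq_bigl => m'; rewrite eq_sym.
rewrite (exchange_big_dep xpredT) //=; apply: eq_bigr => m _.
by rewrite (big_pred1 (phi m)).
Qed.

(* Parseval for the additive characters modulo d. *)
Lemma resvarE (R : realType) (F : finType) (phi : nat -> F) (d M : nat)
    (a : nat -> R) : (0 < d)%N -> #|F| = d ->
  (forall m m', (phi m == phi m') = (m == m' %[mod d])) ->
  \sum_s (\sum_(0 <= m < M | phi m == s) a m - (\sum_(0 <= m < M) a m) / d%:R) ^+ 2 =
  resvar d M a.
Proof.
move=> d0 cF hphi.
have dn0 : d%:R != 0 :> R by rewrite pnatr_eq0 -lt0n.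
set T := \sum_(0 <= m < M) a m.
transitivity (\sum_s (\sum_(0 <= m < M | phi m == s) a m) ^+ 2 - T ^+ 2 / d%:R).
  transitivity (\sum_s ((\sum_(0 <= m < M | phi m == s) a m) ^+ 2 -
    2 * (T / d%:R) * (\sum_(0 <= m < M | phi m == s) a m) + (T / d%:R) ^+ 2)).
    by apply: eq_bigr => s _; ring.
  rewrite big_split sumrB /= -mulr_sumr sumr_const cF.
  rewrite (exchange_big_dep xpredT) //=.
  rewrite (eq_bigr a) => [|m _]; last by rewrite (big_pred1 (phi m)).
  by rewrite -/T -[X in _ + X]mulr_natr; field.
pose U (h : nat) : R :=
  (\sum_(0 <= m < M) a m * cos (m%:R * (2 * pi * (h%:R / d%:R)))) ^+ 2 +
  (\sum_(0 <= m < M) a m * sin (m%:R * (2 * pi * (h%:R / d%:R)))) ^+ 2.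
have -> : resvar d M a = d%:R^-1 * \sum_(1 <= h < d) U h by [].
rewrite sqr_sum_residues.
apply: (mulfI dn0); rewrite mulrA divff // mul1r mulrBr mulrCA divff // mulr1.
have -> : T ^+ 2 = U 0%N.
  rewrite /U (eq_bigr a) => [|m _]; last by rewrite mul0r !mulr0 cos0 mulr1.
  rewrite [X in _ + X ^+ 2]big1 => [|m _]; last by rewrite mul0r !mulr0 sin0 mulr0.
  by rewrite expr0n addr0.
(* Restoring the frequency [h = 0], which equals $T^2$, completes the range of [h] so that
   orthogonality applies. *)
apply: (addIr (U 0%N)); rewrite subrK addrC -big_ltn //.
transitivity (\sum_(0 <= m < M) \sum_(0 <= m' < M) \sum_(0 <= h < d)
   a m * a m' * cos (h%:R * (2 * pi / d%:R) * (m%:R - m'%:R))).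
  rewrite mulr_sumr; apply: eq_bigr => m _.
  rewrite big_mkcond mulr_sumr /=; apply: eq_bigr => m' _.
  rewrite -mulr_sumr sum_cos_orthogonality // hphi.
  by case: ifP => _; [rewrite mulrC | rewrite !mulr0].
under [LHS]eq_bigr do rewrite exchange_big /=.
rewrite exchange_big /=; apply: eq_bigr => h _.
rewrite /U !expr2 !big_distrlr /= -big_split /=; apply: eq_bigr => m _.
rewrite -big_split /=; apply: eq_bigr => m' _.
have -> : h%:R * (2 * pi / d%:R) * (m%:R - m'%:R) =
   m%:R * (2 * pi * (h%:R / d%:R)) - m'%:R * (2 * pi * (h%:R / d%:R)) :> R by field.
by rewrite cosB; ring.
Qed.

(** * Multiplicative pairing over a prime field and the discrepancy [disc] *)

(** The map $s\mapsto c/s$ permutes the units. Once [A] is centred at its mean over the units, any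
    constant may be subtracted from [B] before Cauchy-Schwarz. That mean minimises the sum of
    squares, so an arbitrary [al] is allowed, and adding the class 0 only enlarges both factors;
    both can then be the variances over all classes. *)
Lemma sum_units_bilinear_le (R : realType) (F : finFieldType) (A B : F -> R)
    (c : F) (al be : R) : c != 0 ->
  (\sum_(s | s != 0) A s * B (c / s) -
   (\sum_(s | s != 0) A s) * (\sum_(s | s != 0) B s) / #|F|.-1%:R) ^+ 2 <=
  (\sum_s (A s - al) ^+ 2) * (\sum_s (B s - be) ^+ 2).
Proof.
move=> c0.
have q1 : (0 < #|F|.-1)%N by have := card_finNzRing_gt1 F; case: #|F| => [|[]].
set q := #|F|.-1%:R : R.
have qn0 : q != 0 by rewrite pnatr_eq0 -lt0n.
have cst (k : R) : \sum_(s : F | s != 0) k = q * k.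
  rewrite sumr_const mulr_natl; congr (_ *+ _).
  by rewrite cardC1.
have reB (G : R -> R) : \sum_(s | s != 0) G (B (c / s)) = \sum_(s | s != 0) G (B s).
  rewrite [RHS](reindex (fun s => c / s)) /=.
    by apply: eq_bigl => s; rewrite mulf_eq0 invr_eq0 negb_or c0.
  by exists (fun s => c / s) => s _; rewrite invfM invrK mulrA divff // mul1r.
set TA := \sum_(s | s != 0) A s; set TB := \sum_(s | s != 0) B s.
have -> : \sum_(s | s != 0) A s * B (c / s) - TA * TB / q =
    \sum_(s | s != 0) (A s - TA / q) * (B (c / s) - be).
  transitivity (\sum_(s | s != 0) (A s * B (c / s) - be * A s -
      (TA / q) * B (c / s) + TA / q * be)); last by apply: eq_bigr => s _; ring.
  rewrite big_split !sumrB /= -!mulr_sumr (reB id) -/TA -/TB cst; field.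
  exact: qn0.
apply: (le_trans (sqr_sum_mul_le _ _ _ _)).
rewrite (reB (fun y => (y - be) ^+ 2)).
apply: ler_pM; try by apply: sumr_ge0 => s _; exact: sqr_ge0.
  apply: (@le_trans _ _ (\sum_(s | s != 0) (A s - al) ^+ 2)).
    have -> : \sum_(s | s != 0) (A s - al) ^+ 2 =
      \sum_(s | s != 0) (A s - TA / q) ^+ 2 + q * (TA / q - al) ^+ 2.
      have z : \sum_(s | s != 0) (A s - TA / q) = 0 by rewrite sumrB cst -/TA; field.
      transitivity (\sum_(s | s != 0) ((A s - TA / q) ^+ 2 + (TA / q - al) ^+ 2 +
         (2 * (TA / q - al)) * (A s - TA / q))).
        by apply: eq_bigr => s _; ring.
      by rewrite !big_split /= -[X in _ + X]mulr_sumr z mulr0 addr0 cst.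
    by rewrite lerDl mulr_ge0 // ?sqr_ge0 // ler0n.
  rewrite [leRHS](bigID (fun s => s != 0)) /= lerDl.
  by apply: sumr_ge0 => s _; exact: sqr_ge0.
rewrite [leRHS](bigID (fun s => s != 0)) /= lerDl.
by apply: sumr_ge0 => s _; exact: sqr_ge0.
Qed.

(* The indicator of n = - lam (mod d) minus its mean over the units modulo d. *)
Definition disc (R : realType) (lam : int) (d n : nat) : R :=
  (d%:Z %| n%:Z + lam)%Z%:R - (~~ (d %| n)%N)%:R / d.-1%:R.

Lemma natr_Fp_eq0 (p n : nat) : prime p -> (n%:R == 0 :> 'F_p) = (p %| n)%N.
Proof. by move=> pp; rewrite (dvdn_pcharf (pchar_Fp pp)). Qed.

Lemma intr_Fp_eq0 (p : nat) (z : int) : prime p -> (z%:~R == 0 :> 'F_p) = (p%:Z %| z)%Z.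
Proof.
move=> pp; case: z => n; first by rewrite -pmulrn natr_Fp_eq0.
by rewrite NegzE mulrNz oppr_eq0 -pmulrn natr_Fp_eq0 // dvdzN.
Qed.

Lemma eqn_mod_Fp (p m m' : nat) : prime p ->
  (m%:R == m'%:R :> 'F_p) = (m == m' %[mod p]).
Proof.
move=> pp; wlog le : m m' / (m <= m')%N.
  by move=> hw; case: (leqP m m') => [/hw//|/ltnW /hw]; rewrite eq_sym [RHS]eq_sym.
by rewrite eq_sym -subr_eq0 -natrB // natr_Fp_eq0 // eq_sym eqn_mod_dvd.
Qed.

(** For [m] prime to [d] the congruence says that the class of [k] is [c / phi m], with [c] the
    class of [- lam]. Rows with [d] dividing [m] vanish, because [c] is a unit and the mean in
    [disc] is taken over units only. *)
Lemma bilinear_disc_le (R : realType) (lam : int) (d M K : nat) (a b : nat -> R) :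
  prime d -> ~~ (d%:Z %| lam)%Z ->
  (\sum_(0 <= m < M) \sum_(0 <= k < K) a m * b k * disc R lam d (m * k)) ^+ 2 <=
  resvar d M a * resvar d K b.
Proof.
move=> pd dl.
have cd := card_Fp pd.
pose phi (n : nat) : 'F_d := n%:R.
have hphi m m' : (phi m == phi m') = (m == m' %[mod d]) by exact: eqn_mod_Fp.
rewrite -(resvarE M a (prime_gt0 pd) cd hphi) -(resvarE K b (prime_gt0 pd) cd hphi).
pose c : 'F_d := - lam%:~R.
have c0 : c != 0 by rewrite oppr_eq0 intr_Fp_eq0.
apply: le_trans (sum_units_bilinear_le _ _ _ _ c0).
rewrite le_eqVlt; apply/orP; left; apply/eqP; congr (_ ^+ 2).
rewrite cd.
set A := fun s => \sum_(0 <= m < M | phi m == s) a m.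
set B := fun s => \sum_(0 <= m < K | phi m == s) b m.
have sumA (M0 : nat) (a0 : nat -> R) (G : 'F_d -> R) :
    \sum_(s | s != 0) (\sum_(0 <= m < M0 | phi m == s) a0 m) * G s =
    \sum_(0 <= m < M0 | phi m != 0) a0 m * G (phi m).
  under eq_bigr do rewrite mulr_suml.
  rewrite (exchange_big_dep (fun m => phi m != 0)) /=; last by move=> s m s0 /eqP ->.
  apply: eq_bigr => m m0; rewrite (big_pred1 (phi m)) // => s /=.
  by case: (eqVneq s (phi m)) => [->|ne]; rewrite ?m0 ?andbF.
have TA : \sum_(s | s != 0) A s = \sum_(0 <= m < M | phi m != 0) a m.
  by have := sumA M a (fun=> 1); under eq_bigr do rewrite mulr1; under [RHS]eq_bigr do rewrite mulr1.
have TB : \sum_(s | s != 0) B s = \sum_(0 <= m < K | phi m != 0) b m.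
  by have := sumA K b (fun=> 1); under eq_bigr do rewrite mulr1; under [RHS]eq_bigr do rewrite mulr1.
rewrite TA TB sumA /B.
transitivity (\sum_(0 <= m < M | phi m != 0) \sum_(0 <= k < K | phi k == c / phi m) a m * b k -
  \sum_(0 <= m < M | phi m != 0) \sum_(0 <= k < K | phi k != 0) a m * b k / d.-1%:R); last first.
  congr (_ - _); first by apply: eq_bigr => m _; rewrite mulr_sumr.
  rewrite big_distrlr /= mulr_suml; apply: eq_bigr => m _.
  by rewrite mulr_suml.
rewrite -sumrB [RHS]big_mkcond /=; apply: eq_bigr => m _.
have dvdE n : (d%:Z %| n%:Z + lam)%Z = (phi n == c).
  by rewrite -intr_Fp_eq0 // rmorphD /= -pmulrn addr_eq0.
case: eqVneq => [m0|m0] /=.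
  rewrite big1 // => k _; rewrite /disc dvdE.
  have mk : phi (m * k)%N = 0 by rewrite /phi natrM -/(phi m) m0 mul0r.
  rewrite mk eq_sym (negPf c0) -natr_Fp_eq0 // -/(phi _) mk eqxx mul0r subr0.
  by rewrite mulr0.
rewrite [X in _ = X - _]big_mkcond [X in _ = _ - X]big_mkcond -sumrB /=.
apply: eq_bigr => k _; rewrite /disc dvdE -natr_Fp_eq0 // -/(phi _).
have -> : phi (m * k)%N = phi m * phi k by rewrite /phi natrM.
rewrite mulf_eq0 (negPf m0) /=.
have -> : (phi m * phi k == c) = (phi k == c / phi m).
  by rewrite -[RHS](inj_eq (mulfI m0)) [phi m * (c / _)]mulrCA divff // mulr1.
by case: eqP => _; case: eqP => _ /=; ring.
Qed.

(** A second Cauchy-Schwarz, over [d], separates the two variances. The factor [1 / d] in each is at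
    most [1 / P], and the large sieve bounds what remains. *)
Lemma sum_primes_bilinear_disc_le (R : realType) (lam : int) (P Q M K : nat)
    (a b : nat -> R) : (0 < P)%N ->
  (forall d, prime d -> (P < d)%N -> ~~ (d%:Z %| lam)%Z) ->
  (\sum_(0 <= m < M) \sum_(0 <= k < K) a m * b k *
     \sum_(P.+1 <= d < Q.+1 | prime d) disc R lam d (m * k)) ^+ 2 <=
  160 ^+ 2 * (M%:R + Q%:R ^+ 2) * (K%:R + Q%:R ^+ 2) / P%:R ^+ 2 *
  (\sum_(0 <= m < M) a m ^+ 2) * (\sum_(0 <= k < K) b k ^+ 2).
Proof.
move=> P0 hP.
have P0' : 0 < P%:R :> R by rewrite ltr0n.
have var_le (M0 : nat) (a0 : nat -> R) :
    \sum_(P.+1 <= d < Q.+1 | prime d) resvar d M0 a0 <=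
    160 * (M0%:R + Q%:R ^+ 2) / P%:R * \sum_(0 <= m < M0) a0 m ^+ 2.
  rewrite mulrAC ler_pdivlMr // mulrC mulr_sumr.
  apply: le_trans (large_sieve_primes Q M0 a0).
  case: (leqP P.+1 Q.+1) => PQ; last first.
    rewrite big_geq ?(ltnW PQ) //; apply: sumr_ge0 => d _; apply: sumr_ge0 => h _.
    by rewrite addr_ge0 // sqr_ge0.
  rewrite [leRHS](big_cat_nat (leq0n P.+1) PQ) /=; apply: ler_wpDl.
    apply: sumr_ge0 => d _; apply: sumr_ge0 => h _.
    by rewrite addr_ge0 // sqr_ge0.
  rewrite big_nat_cond [leRHS]big_nat_cond; apply: ler_sum => d /andP[/andP[Pd _] pd].
  rewrite /resvar mulrA; apply: ler_piMl.
    by apply: sumr_ge0 => h _; rewrite addr_ge0 // sqr_ge0.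
  have d0 : 0 < d%:R :> R by rewrite ltr0n prime_gt0.
  by rewrite ler_pdivrMr // mul1r ler_nat ltnW.
have -> : \sum_(0 <= m < M) \sum_(0 <= k < K) a m * b k *
     (\sum_(P.+1 <= d < Q.+1 | prime d) disc R lam d (m * k)) =
   \sum_(P.+1 <= d < Q.+1 | prime d)
     \sum_(0 <= m < M) \sum_(0 <= k < K) a m * b k * disc R lam d (m * k).
  rewrite [RHS]exchange_big /=; apply: eq_bigr => m _.
  rewrite [RHS]exchange_big /=; apply: eq_bigr => k _.
  by rewrite mulr_sumr.
set E := fun d => \sum_(0 <= m < M) \sum_(0 <= k < K) a m * b k * disc R lam d (m * k).
have Ele : \sum_(P.+1 <= d < Q.+1 | prime d) `|E d| <=
    \sum_(P.+1 <= d < Q.+1 | prime d) Num.sqrt (resvar d M a) * Num.sqrt (resvar d K b).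
  rewrite big_nat_cond [leRHS]big_nat_cond; apply: ler_sum => d /andP[/andP[Pd _] pd].
  rewrite -sqrtrM ?resvar_ge0 // -sqrtr_sqr; apply: ler_wsqrtr.
  by apply: bilinear_disc_le => //; exact: hP.
apply: (@le_trans _ _ ((\sum_(P.+1 <= d < Q.+1 | prime d)
    Num.sqrt (resvar d M a) * Num.sqrt (resvar d K b)) ^+ 2)).
  rewrite -real_normK ?num_real // lerXn2r ?nnegrE //.
    by apply: sumr_ge0 => d _; rewrite mulr_ge0 // sqrtr_ge0.
  by apply: le_trans Ele; apply: ler_norm_sum.
apply: (le_trans (sqr_sum_mul_le _ _ _ _)).
under eq_bigr do rewrite sqr_sqrtr ?resvar_ge0 //.
under [X in _ * X <= _]eq_bigr do rewrite sqr_sqrtr ?resvar_ge0 //.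
have -> : 160 ^+ 2 * (M%:R + Q%:R ^+ 2) * (K%:R + Q%:R ^+ 2) / P%:R ^+ 2 *
    (\sum_(0 <= m < M) a m ^+ 2) * (\sum_(0 <= k < K) b k ^+ 2) =
  (160 * (M%:R + Q%:R ^+ 2) / P%:R * \sum_(0 <= m < M) a m ^+ 2) *
  (160 * (K%:R + Q%:R ^+ 2) / P%:R * \sum_(0 <= k < K) b k ^+ 2).
  by field; rewrite gt_eqF.
by apply: ler_pM; rewrite ?var_le //; apply: sumr_ge0 => d _; exact: resvar_ge0.
Qed.

(** * Decoupling the two variables of a bilinear form *)

Lemma sqrt_cauchy2 (R : realType) (x1 x2 y1 y2 : R) :
  0 <= x1 -> 0 <= x2 -> 0 <= y1 -> 0 <= y2 ->
  Num.sqrt x1 * Num.sqrt y1 + Num.sqrt x2 * Num.sqrt y2 <=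
  Num.sqrt (x1 + x2) * Num.sqrt (y1 + y2).
Proof.
move=> hx1 hx2 hy1 hy2.
rewrite -(@ler_pXn2r R 2) ?nnegrE ?addr_ge0 ?mulr_ge0 ?sqrtr_ge0 //.
rewrite [leRHS]exprMn !sqr_sqrtr ?addr_ge0 //.
rewrite -[in leRHS](sqr_sqrtr hx1) -[in leRHS](sqr_sqrtr hx2).
rewrite -[in leRHS](sqr_sqrtr hy1) -[in leRHS](sqr_sqrtr hy2).
have := sqr_ge0 (Num.sqrt x1 * Num.sqrt y2 - Num.sqrt x2 * Num.sqrt y1).
by move=> h; rewrite -subr_ge0; apply: (le_trans h); rewrite le_eqVlt; apply/orP; left; apply/eqP; ring.
Qed.

(* Bisection of the range of [k]: at each scale the region below the graph of [f]
   contributes one rectangle, and the rows split into two disjoint groups. *)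
Lemma triangular_truncation_aux (R : realType) (G : nat -> nat -> R) (C : R) (M K : nat) :
  0 <= C ->
  (forall a b : nat -> R,
     `|\sum_(0 <= m < M) \sum_(0 <= k < K) a m * b k * G m k| <=
     C * (Num.sqrt (\sum_(0 <= m < M) a m ^+ 2) * Num.sqrt (\sum_(0 <= k < K) b k ^+ 2))) ->
  forall (J s : nat) (f : nat -> nat) (a b : nat -> R),
  (forall m, f m <= s + 2 ^ J)%N ->
  `|\sum_(0 <= m < M) \sum_(0 <= k < K | (s <= k < f m)%N) a m * b k * G m k| <=
  J.+1%:R * C * (Num.sqrt (\sum_(0 <= m < M) a m ^+ 2) *
     Num.sqrt (\sum_(0 <= k < K | (s <= k < s + 2 ^ J)%N) b k ^+ 2)).
Proof.
move=> C0 hG.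
have sq0 (r : seq nat) (P : pred nat) (g : nat -> R) : 0 <= \sum_(k <- r | P k) g k ^+ 2.
  by apply: sumr_ge0 => k _; exact: sqr_ge0.
(* The hypothesis holds for arbitrary coefficients, so it passes to every product set by setting
   coefficients to 0. *)
have box (P Q : pred nat) (a b : nat -> R) :
    `|\sum_(0 <= m < M | P m) \sum_(0 <= k < K | Q k) a m * b k * G m k| <=
    C * (Num.sqrt (\sum_(0 <= m < M | P m) a m ^+ 2) *
         Num.sqrt (\sum_(0 <= k < K | Q k) b k ^+ 2)).
  have := hG (fun m => if P m then a m else 0) (fun k => if Q k then b k else 0).
  have sqE (n : nat) (P0 : pred nat) (g : nat -> R) :
      \sum_(0 <= m < n) (if P0 m then g m else 0) ^+ 2 = \sum_(0 <= m < n | P0 m) g m ^+ 2.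
    by rewrite [RHS]big_mkcond; apply: eq_bigr => m _; case: ifP; rewrite ?expr0n.
  rewrite !sqE; apply: le_trans; rewrite le_eqVlt; apply/orP; left; apply/eqP.
  congr `|_|; rewrite big_mkcond; apply: eq_bigr => m _.
  case: ifP => Pm; last by rewrite big1 // => k _; rewrite !mul0r.
  rewrite big_mkcond; apply: eq_bigr => k _.
  by case: ifP; rewrite ?mulr0 ?mul0r.
have le_nrm (r : seq nat) (P Q : pred nat) (g : nat -> R) : (forall k, P k -> Q k) ->
    Num.sqrt (\sum_(k <- r | P k) g k ^+ 2) <= Num.sqrt (\sum_(k <- r | Q k) g k ^+ 2).
  move=> PQ; apply: ler_wsqrtr; rewrite [leRHS](bigID P) /=.
  rewrite (eq_bigl (fun i => Q i && P i)) ?lerDl // => k.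
  by case: (boolP (P k)) => [/PQ ->|]; rewrite ?andbF.
elim=> [|J IH] s f a b hf.
  have -> : \sum_(0 <= m < M) \sum_(0 <= k < K | (s <= k < f m)%N) a m * b k * G m k =
     \sum_(0 <= m < M | (s < f m)%N) \sum_(0 <= k < K | (s <= k < s + 2 ^ 0)%N) a m * b k * G m k.
    rewrite [RHS]big_mkcond; apply: eq_bigr => m _; case: ifP => h.
      by apply: eq_bigl => k; have := hf m; move: h; clear; rewrite expn0; lia.
    by rewrite big_pred0 // => k; have := hf m; move: h; clear; rewrite expn0; lia.
  rewrite mul1r; apply: (le_trans (box _ _ _ _)).
  by apply: ler_wpM2l => //; apply: ler_wpM2r; [exact: sqrtr_ge0 | exact: le_nrm].
(* Rows reaching beyond the midpoint [s'] contain the whole left half, which forms a rectangle, and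
   leave a region in the right half. The other rows stay in the left half. The two recursive regions
   use disjoint rows and disjoint columns, so by [sqrt_cauchy2] they cost together as much as one,
   and each level adds a single [C]. *)
pose s' := (s + 2 ^ J)%N.
pose hi m := (s' < f m)%N.
pose Nh := \sum_(0 <= m < M | hi m) a m ^+ 2.
pose Nl := \sum_(0 <= m < M | ~~ hi m) a m ^+ 2.
pose B1 := \sum_(0 <= k < K | (s <= k < s')%N) b k ^+ 2.
pose B2 := \sum_(0 <= k < K | (s' <= k < s' + 2 ^ J)%N) b k ^+ 2.
have NE : \sum_(0 <= m < M) a m ^+ 2 = Nh + Nl by rewrite (bigID hi).
have BE : \sum_(0 <= k < K | (s <= k < s + 2 ^ J.+1)%N) b k ^+ 2 = B1 + B2.
  rewrite (bigID (fun k => k < s')%N) /=; congr (_ + _); apply: eq_bigl => k;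
    rewrite /s' expnS; clear; lia.
have maskE (P : pred nat) : \sum_(0 <= m < M) (if P m then a m else 0) ^+ 2 =
    \sum_(0 <= m < M | P m) a m ^+ 2.
  by rewrite [RHS]big_mkcond; apply: eq_bigr => m _; case: ifP; rewrite ?expr0n.
have E1 := box hi (fun k => (s <= k < s')%N) a b.
have E2 := IH s' (fun m => if hi m then f m else 0%N) (fun m => if hi m then a m else 0) b.
have E3 := IH s (fun m => if hi m then 0%N else f m) (fun m => if ~~ hi m then a m else 0) b.
rewrite !maskE -/Nh -/Nl -/B1 -/B2 in E1 E2 E3.
rewrite NE BE.
have -> : \sum_(0 <= m < M) \sum_(0 <= k < K | (s <= k < f m)%N) a m * b k * G m k =
   \sum_(0 <= m < M | hi m) \sum_(0 <= k < K | (s <= k < s')%N) a m * b k * G m k +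
   \sum_(0 <= m < M) \sum_(0 <= k < K | (s' <= k < if hi m then f m else 0)%N)
     (if hi m then a m else 0) * b k * G m k +
   \sum_(0 <= m < M) \sum_(0 <= k < K | (s <= k < if hi m then 0 else f m)%N)
     (if ~~ hi m then a m else 0) * b k * G m k.
  rewrite [X in _ = X + _ + _]big_mkcond -!big_split /=; apply: eq_bigr => m _.
  case: ifP => hm /=; last first.
    by rewrite [X in _ = _ + X + _]big1 ?add0r // => k _; rewrite !mul0r.
  rewrite [X in _ = _ + _ + X]big1 ?addr0 => [|k _]; last by rewrite !mul0r.
  rewrite (bigID (fun k => k < s')%N) /=; congr (_ + _); apply: eq_bigl => k;
    move: hm; rewrite /hi /s'; clear; lia.
have hJ : J.+2%:R = 1 + J.+1%:R :> R by rewrite -natr1 addrC.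
have cs : Num.sqrt Nh * Num.sqrt B2 + Num.sqrt Nl * Num.sqrt B1 <=
     Num.sqrt (Nh + Nl) * Num.sqrt (B1 + B2).
  by rewrite (addrC B1); apply: sqrt_cauchy2; apply: sq0.
have cs1 : Num.sqrt Nh * Num.sqrt B1 <= Num.sqrt (Nh + Nl) * Num.sqrt (B1 + B2).
  by apply: ler_pM; rewrite ?sqrtr_ge0 // ler_wsqrtr // lerDl; apply: sq0.
apply: (le_trans (ler_normD _ _)); apply: (le_trans (lerD (ler_normD _ _) (lexx _))).
apply: (@le_trans _ _ (C * (Num.sqrt Nh * Num.sqrt B1) +
   J.+1%:R * C * (Num.sqrt Nh * Num.sqrt B2) + J.+1%:R * C * (Num.sqrt Nl * Num.sqrt B1))).
  apply: lerD; first apply: lerD.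
  - exact: E1.
  - by apply: E2 => m; case: ifP => // _; have := hf m; rewrite /s' expnS; clear; lia.
  - apply: E3 => m; case: ifP => //.
    by rewrite /hi /s' => /negbT; rewrite -leqNgt.
rewrite hJ -addrA -mulrDr.
rewrite mulrDl mul1r mulrDl; apply: lerD; first exact: ler_wpM2l.
by apply: ler_wpM2l => //; rewrite mulr_ge0 // ler0n.
Qed.

(** Allows a bilinear estimate to be used under a constraint such as $mk\le N$, with a loss of $J+1$
    before squaring. *)
Lemma triangular_truncation (R : realType) (G : nat -> nat -> R) (C : R) (M K J : nat)
    (f : nat -> nat) (a b : nat -> R) : 0 <= C ->
  (forall a b : nat -> R,
     (\sum_(0 <= m < M) \sum_(0 <= k < K) a m * b k * G m k) ^+ 2 <=
     C * (\sum_(0 <= m < M) a m ^+ 2) * (\sum_(0 <= k < K) b k ^+ 2)) ->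
  (forall m, f m <= 2 ^ J)%N ->
  (\sum_(0 <= m < M) \sum_(0 <= k < K | (k < f m)%N) a m * b k * G m k) ^+ 2 <=
  J.+1%:R ^+ 2 * C * (\sum_(0 <= m < M) a m ^+ 2) * (\sum_(0 <= k < K) b k ^+ 2).
Proof.
move=> C0 hG hf.
have sq0 (n : nat) (P : pred nat) (g : nat -> R) : 0 <= \sum_(0 <= k < n | P k) g k ^+ 2.
  by apply: sumr_ge0 => k _; exact: sqr_ge0.
have h0 (a0 b0 : nat -> R) : `|\sum_(0 <= m < M) \sum_(0 <= k < K) a0 m * b0 k * G m k| <=
    Num.sqrt C * (Num.sqrt (\sum_(0 <= m < M) a0 m ^+ 2) *
      Num.sqrt (\sum_(0 <= k < K) b0 k ^+ 2)).
  rewrite -!sqrtrM ?mulr_ge0 ?sq0 // -sqrtr_sqr; apply: ler_wsqrtr.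
  by rewrite mulrA; exact: hG.
have := @triangular_truncation_aux R G (Num.sqrt C) M K (sqrtr_ge0 _) h0 J 0 f a b hf.
rewrite -(@ler_pXn2r R 2) ?nnegrE ?mulr_ge0 ?sqrtr_ge0 ?ler0n // real_normK ?num_real //.
rewrite !exprMn !sqr_sqrtr ?sq0 // mulrA.
move/le_trans; apply; apply: ler_wpM2l.
  by rewrite !mulr_ge0 ?sq0 ?sqr_ge0.
rewrite [leRHS](bigID (fun k => k < 0 + 2 ^ J)%N) /= lerDl; exact: sq0.
Qed.

(** * Vaughan's identity *)

(** At most one pair (p, k) contributes. Summing over all pairs turns sums against [mangoldt] into
    sums over prime powers by a mere exchange of summations. *)
Definition mangoldt (R : realType) (n : nat) : R :=
  \sum_(0 <= p < n.+1 | prime p) \sum_(1 <= k < n.+1)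
    (if (p ^ k == n)%N then ln p%:R else 0).

Lemma mangoldt_widen (R : realType) (n N : nat) : (0 < n <= N)%N ->
  mangoldt R n = \sum_(0 <= p < N.+1 | prime p) \sum_(1 <= k < N.+1)
    (if (p ^ k == n)%N then ln p%:R else 0).
Proof.
move=> /andP[n0 nN].
rewrite [RHS](big_cat_nat (leq0n n.+1)) //= [X in _ = _ + X]big1_seq ?addr0.
  rewrite /mangoldt; apply: eq_bigr => p pp.
  rewrite [RHS](big_cat_nat (n := n.+1)) //= [X in _ = _ + X]big1_seq ?addr0 // => k.
  rewrite mem_index_iota => /andP[_ /andP[nk _]].
  rewrite gtn_eqF //; apply: leq_trans (ltn_expl k (prime_gt1 pp)); exact: ltnW.
move=> p /andP[pp]; rewrite mem_index_iota => /andP[np _].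
rewrite big1_seq // => k; rewrite mem_index_iota => /andP[_ /andP[k1 _]].
rewrite gtn_eqF // (leq_trans np) // -{1}(expn1 p) leq_exp2l ?prime_gt1 //.
Qed.

Lemma sum_mangoldt (R : realType) (N : nat) (g : nat -> R) :
  \sum_(1 <= n < N.+1) mangoldt R n * g n =
  \sum_(0 <= p < N.+1 | prime p) \sum_(1 <= k < N.+1 | (p ^ k <= N)%N)
    ln p%:R * g (p ^ k)%N.
Proof.
transitivity (\sum_(1 <= n < N.+1) \sum_(0 <= p < N.+1 | prime p)
   \sum_(1 <= k < N.+1) (if (p ^ k == n)%N then ln p%:R else 0) * g n).
  apply: eq_big_nat => n nN; rewrite (@mangoldt_widen R n N) // mulr_suml.
  by apply: eq_bigr => p _; rewrite mulr_suml.
rewrite exchange_big /=; apply: eq_bigr => p pp.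
rewrite exchange_big [RHS]big_mkcond /=; apply: eq_bigr => k _.
have pk : (0 < p ^ k)%N by rewrite expn_gt0 prime_gt0.
case: leqP => h.
  rewrite (bigD1_seq (p ^ k)%N) ?mem_index_iota ?iota_uniq ?pk //= eqxx big1 ?addr0 // => n.
  by rewrite eq_sym => /negbTE ->; rewrite mul0r.
rewrite big1_seq // => n; rewrite mem_index_iota => /andP[_ /andP[_ nN]].
by rewrite gtn_eqF ?mul0r // (leq_trans nN).
Qed.

Lemma ln_prime_ge0 (R : realType) (p : nat) : prime p -> 0 <= ln p%:R :> R.
Proof. by move=> pp; rewrite ln_ge0 // ler1n prime_gt0. Qed.

Lemma mangoldt_ge0 (R : realType) (n : nat) : 0 <= mangoldt R n.
Proof.
apply: sumr_ge0 => p pp; apply: sumr_ge0 => k _.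
by case: ifP => // _; exact: ln_prime_ge0.
Qed.

Lemma ln_prod (R : realType) (r : seq nat) (P : pred nat) (f : nat -> nat) :
  (forall i, P i -> 0 < f i)%N ->
  ln (\prod_(i <- r | P i) f i)%:R = \sum_(i <- r | P i) ln (f i)%:R :> R.
Proof.
move=> hf.
have : (0 < \prod_(i <- r | P i) f i)%N /\
   ln (\prod_(i <- r | P i) f i)%:R = \sum_(i <- r | P i) ln (f i)%:R :> R.
  apply: (big_ind2 (fun (x : nat) (y : R) => (0 < x)%N /\ ln x%:R = y)).
  - by rewrite ln1.
  - move=> x1 y1 x2 y2 [x10 <-] [x20 <-]; rewrite muln_gt0 x10 x20; split => //.
    by rewrite natrM lnM // posrE ltr0n.
  - by move=> i Pi; rewrite hf.
by case.
Qed.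

(** The prime p contributes [ln p] once for each k from 1 to [logn p n], which is its share in the
    factorisation of n. *)
Lemma sum_dvd_mangoldt (R : realType) (n : nat) : (0 < n)%N ->
  \sum_(1 <= d < n.+1 | (d %| n)%N) mangoldt R d = ln n%:R.
Proof.
move=> n0.
have -> : \sum_(1 <= d < n.+1 | (d %| n)%N) mangoldt R d =
   \sum_(1 <= d < n.+1) mangoldt R d * (d %| n)%N%:R.
  by rewrite big_mkcond; apply: eq_bigr => d _; case: ifP; rewrite ?mulr1 ?mulr0.
rewrite sum_mangoldt.
rewrite -[in RHS](partnT n0) /partn ln_prod => [|p _]; last first.
  case: (posnP p) => [->|p0]; last by rewrite expn_gt0 p0.
  by rewrite lognE /= expn0.
rewrite [RHS](bigID prime) /= [X in _ = _ + X]big1 ?addr0 => [|p pp]; last first.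
  by rewrite lognE (negPf pp) /= expn0 ln1.
apply: eq_bigr => p pp; rewrite natrX lnXn ?ltr0n ?prime_gt0 //.
transitivity (\sum_(1 <= k < n.+1 | (k <= logn p n)%N) ln p%:R : R).
  rewrite big_mkcond [RHS]big_mkcond /=; apply: eq_bigr => k _.
  rewrite pfactor_dvdn //; case: (leqP k (logn p n)) => h; last by rewrite mulr0 if_same.
  by rewrite mulr1 dvdn_leq // pfactor_dvdn.
rewrite (big_cat_nat (n := (logn p n).+1)) //=; last by rewrite ltnS ltnW // ltn_logl.
rewrite [X in _ + X]big1_seq ?addr0 => [|k]; last first.
  by rewrite mem_index_iota => /andP[h /andP[h1 _]]; rewrite leqNgt h1 in h.
rewrite big_nat_cond (eq_bigl (fun k => 1 <= k < (logn p n).+1)%N) -?big_nat ?sumr_const_nat ?subSS ?subn0 //.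
by move=> k; clear; lia.
Qed.

Lemma mangoldt_le_ln (R : realType) (n : nat) : (0 < n)%N -> mangoldt R n <= ln n%:R.
Proof.
move=> n0; rewrite -(sum_dvd_mangoldt R n0) big_mkcond (bigD1_seq n) ?iota_uniq ?mem_index_iota ?n0 ?leqnn //=.
by rewrite dvdnn lerDl; apply: sumr_ge0 => d _; case: ifP => // _; exact: mangoldt_ge0.
Qed.

Lemma sum_multiples (R : realType) (N b : nat) (F : nat -> R) : (0 < b)%N ->
  \sum_(1 <= d < N.+1 | (b %| d)%N) F d =
  \sum_(1 <= e < N.+1 | (b * e <= N)%N) F (b * e)%N.
Proof.
move=> b0; rewrite -big_filter -[RHS]big_filter -(big_map (muln b) xpredT F).
apply: perm_big; apply: uniq_perm; rewrite ?map_inj_uniq ?filter_uniq ?iota_uniq //.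
  by move=> x y /eqP; rewrite eqn_pmul2l // => /eqP.
move=> d; rewrite mem_filter mem_index_iota.
apply/idP/mapP => [/andP[/dvdnP[e ->] /andP[h1 h2]]|[e]].
  have e0 : (0 < e)%N by move: h1; rewrite muln_gt0 => /andP[].
  exists e; last by rewrite mulnC.
  rewrite mem_filter mem_index_iota mulnC -ltnS h2 e0 /= ltnS.
  by rewrite (leq_trans _ (_ : e * b <= N)%N) ?leq_pmulr.
rewrite mem_filter mem_index_iota => /andP[h1 /andP[h2 h3]] ->.
by rewrite dvdn_mulr // muln_gt0 b0 h2 ltnS.
Qed.

(** Write $k=bl$. As [F] vanishes beyond [N], the condition $bl\le N$ may be dropped and both
    variables run over the full range. *)
Lemma sum_dvd_reindex (R : realType) (N : nat) (h F : nat -> R) :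
  (forall n, (N < n)%N -> F n = 0) ->
  \sum_(1 <= k < N.+1) (\sum_(1 <= b < k.+1 | (b %| k)%N) h b) * F k =
  \sum_(1 <= b < N.+1) h b * \sum_(1 <= l < N.+1) F (b * l)%N.
Proof.
move=> F0.
transitivity (\sum_(1 <= k < N.+1) \sum_(1 <= b < N.+1 | (b %| k)%N) h b * F k).
  apply: eq_big_nat => k /andP[k1 kN]; rewrite mulr_suml.
  rewrite [RHS](big_cat_nat (n := k.+1)) //= [X in _ = _ + X]big1_seq ?addr0 // => b.
  by rewrite mem_index_iota => /andP[/(dvdn_leq k1) h1 /andP[h2 _]]; rewrite leqNgt h2 in h1.
rewrite (exchange_big_dep xpredT) //=; apply: eq_big_nat => b /andP[b0 _].
rewrite sum_multiples // mulr_sumr big_mkcond /=; apply: eq_bigr => l _.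
by case: leqP => // /F0 ->; rewrite mulr0.
Qed.

(** * The Moebius function and Vaughan's decomposition *)

Definition moebius (R : realType) (n : nat) : R :=
  \prod_(p <- primes n) (if logn p n == 1%N then -1 else 0).

Lemma moebius1 (R : realType) : moebius R 1 = 1.
Proof. by rewrite /moebius big_nil. Qed.

Lemma norm_moebius_le1 (R : realType) (n : nat) : `|moebius R n| <= 1.
Proof.
rewrite /moebius normr_prod; apply: prodr_ile1 => p _.
by case: ifP => _; rewrite ?normrN1 ?normr0 ?lexx ?ler01.
Qed.

Lemma moebius_prime_mul (R : realType) (p e : nat) : prime p -> (0 < e)%N ->
  moebius R (p * e) = if (p %| e)%N then 0 else - moebius R e.
Proof.
move=> pp e0; have p0 := prime_gt0 pp.
have pe0 : (0 < p * e)%N by rewrite muln_gt0 p0.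
have pin : p \in primes (p * e) by rewrite mem_primes pp pe0 dvdn_mulr.
have lp : logn p (p * e) = (logn p e).+1 by rewrite lognM // logn_prime // eqxx.
rewrite /moebius (bigD1_seq p) ?primes_uniq //= lp eqSS.
have [pe|pe] := boolP (p %| e)%N.
  by rewrite gtn_eqF ?mul0r // logn_gt0 mem_primes pp e0.
rewrite (_ : logn p e = 0%N) ?eqxx ?mulN1r; last first.
  by apply/eqP; rewrite -leqn0 leqNgt logn_gt0 mem_primes pp e0.
congr (- _); rewrite -big_filter.
rewrite (perm_big (primes e)) /=; last first.
  apply: uniq_perm; rewrite ?filter_uniq ?primes_uniq // => q.
  rewrite mem_filter primesM // [primes p]primes_prime // inE.
  case: eqVneq => [->|] //=; by rewrite mem_primes (negPf pe) !andbF.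
rewrite !big_seq; apply: eq_bigr => q qe.
rewrite lognM // logn_prime // eq_sym.
case: (eqVneq p q) => [pq|_]; last by rewrite add0n eq_sym.
by move: qe; rewrite -pq mem_primes (negPf pe) !andbF.
Qed.

(** With p the least prime factor of n, a divisor e prime to p cancels against p e, and [moebius]
    vanishes at p e when p divides e. *)
Lemma sum_dvd_moebius (R : realType) (n : nat) : (1 < n)%N ->
  \sum_(1 <= d < n.+1 | (d %| n)%N) moebius R d = 0.
Proof.
move=> n1; set p := pdiv n.
have pp : prime p by exact: pdiv_prime.
have pn : (p %| n)%N by exact: pdiv_dvd.
rewrite (bigID (fun d => p %| d)%N) /=.
rewrite (eq_bigl (fun d => (p %| d) && (d %| n))%N) => [|d]; last by rewrite andbC.
rewrite big_mkcondr /= sum_multiples ?prime_gt0 //.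
rewrite big_mkcond [X in _ + X]big_mkcond -big_split big_nat_cond big1 //= => e.
rewrite andbT => /andP[e0 _].
rewrite moebius_prime_mul //.
have [pe|pe] := boolP (p %| e)%N; first by rewrite andbF addr0 !if_same.
rewrite andbT Gauss_dvd ?prime_coprime // pn /=.
case: (boolP (e %| n)%N) => en; last by rewrite if_same addr0.
by rewrite dvdn_leq ?addNr // 1?ltnW // Gauss_dvd ?prime_coprime // pn.
Qed.

Definition moebius_trunc (R : realType) (V b : nat) : R := if (b <= V)%N then moebius R b else 0.

(** The Dirichlet convolution of the truncated Moebius function with 1; it agrees with the identity
    for convolution up to [V]. *)
Definition vaughan_coef (R : realType) (V k : nat) : R :=
  \sum_(1 <= b < k.+1 | (b %| k)%N) moebius_trunc R V b.

Lemma vaughan_coef_small (R : realType) (V k : nat) : (0 < k <= V)%N ->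
  vaughan_coef R V k = (k == 1%N)%:R.
Proof.
move=> /andP[k0 kV].
have -> : vaughan_coef R V k = \sum_(1 <= b < k.+1 | (b %| k)%N) moebius R b.
  rewrite /vaughan_coef big_nat_cond [RHS]big_nat_cond; apply: eq_bigr => b.
  by move=> /andP[/andP[_ bk] _]; rewrite /moebius_trunc (leq_trans _ kV).
case: eqVneq => [->|k1]; first by rewrite big_mkcond big_nat1 /= moebius1.
by rewrite sum_dvd_moebius // ltn_neqAle eq_sym k1.
Qed.

(** All terms come from the sum of [mangoldt R m * vaughan_coef R V k * F (m * k)] over all m and k.
    Since the convolution of [mangoldt] with 1 is the logarithm, that sum equals the first term.
    Removing m <= U gives the second. For m > U, the indices k <= V contribute only k = 1, which is
    the left side, and k > V gives the last term. *)
Lemma vaughan (R : realType) (N U V : nat) (F : nat -> R) :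
  (forall n, (N < n)%N -> F n = 0) -> (U <= N)%N -> (0 < V <= N)%N ->
  \sum_(U.+1 <= m < N.+1) mangoldt R m * F m =
  \sum_(1 <= b < N.+1) moebius_trunc R V b * \sum_(1 <= c < N.+1) ln c%:R * F (b * c)%N -
  \sum_(1 <= m < U.+1) mangoldt R m * \sum_(1 <= b < N.+1) moebius_trunc R V b *
     \sum_(1 <= l < N.+1) F (m * (b * l))%N -
  \sum_(U.+1 <= m < N.+1) mangoldt R m * \sum_(V.+1 <= k < N.+1) vaughan_coef R V k * F (m * k)%N.
Proof.
move=> F0 UN /andP[V0 VN].
have Fm m n : (0 < m)%N -> (N < n)%N -> F (m * n)%N = 0.
  by move=> m0 nN; apply: F0; apply: leq_trans nN _; exact: leq_pmull.
have coefE m : (0 < m)%N -> \sum_(1 <= k < N.+1) vaughan_coef R V k * F (m * k)%N =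
    \sum_(1 <= b < N.+1) moebius_trunc R V b * \sum_(1 <= l < N.+1) F (m * (b * l))%N.
  by move=> m0; rewrite /vaughan_coef sum_dvd_reindex // => n; exact: Fm.
have -> : \sum_(1 <= b < N.+1) moebius_trunc R V b * \sum_(1 <= c < N.+1) ln c%:R * F (b * c)%N =
    \sum_(1 <= m < N.+1) mangoldt R m * \sum_(1 <= k < N.+1) vaughan_coef R V k * F (m * k)%N.
  transitivity (\sum_(1 <= b < N.+1) moebius_trunc R V b *
      \sum_(1 <= m < N.+1) mangoldt R m * \sum_(1 <= l < N.+1) F (b * (m * l))%N).
    apply: eq_big_nat => b /andP[b0 _]; congr (_ * _).
    rewrite -(sum_dvd_reindex (mangoldt R) (F := fun c => F (b * c)%N)) => [|n]; last exact: Fm.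
    by apply: eq_big_nat => c /andP[c0 _]; rewrite sum_dvd_mangoldt.
  under eq_bigr do rewrite mulr_sumr.
  rewrite exchange_big /=; apply: eq_big_nat => m /andP[m0 _].
  rewrite coefE // mulr_sumr; apply: eq_bigr => b _.
  rewrite mulrCA; congr (_ * (_ * _)); apply: eq_bigr => l _.
  by rewrite mulnCA.
have -> : \sum_(1 <= m < U.+1) mangoldt R m * (\sum_(1 <= b < N.+1) moebius_trunc R V b *
     \sum_(1 <= l < N.+1) F (m * (b * l))%N) =
   \sum_(1 <= m < U.+1) mangoldt R m * \sum_(1 <= k < N.+1) vaughan_coef R V k * F (m * k)%N.
  by apply: eq_big_nat => m /andP[m0 _]; rewrite coefE.
rewrite [X in _ = X - _ - _](big_cat_nat (n := U.+1)) //=.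
have cancel (x y z : R) : x + y - x - z = y - z by ring.
rewrite cancel -sumrB.
apply: eq_big_nat => m /andP[m0 _].
rewrite -mulrBr; congr (_ * _).
rewrite [X in _ = X - _](big_cat_nat (n := V.+1)) //= addrK.
rewrite big_nat_recl // vaughan_coef_small ?V0 // eqxx mul1r muln1 big_nat_cond big1 ?addr0 // => k.
rewrite andbT => /andP[k0 kV].
by rewrite vaughan_coef_small ?kV // eqSS gtn_eqF ?mul0r.
Qed.

(** * Chebyshev and Mertens estimates *)

Definition psi (R : realType) (N : nat) : R := \sum_(1 <= n < N.+1) mangoldt R n.

Lemma psi_le_mono (R : realType) (m n : nat) : (m <= n)%N -> psi R m <= psi R n.
Proof.
move=> mn; rewrite /psi [leRHS](big_cat_nat (n := m.+1)) //= lerDl.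
by apply: sumr_ge0 => k _; exact: mangoldt_ge0.
Qed.

Lemma sum_leq_mul (R : realType) (n d : nat) : (0 < d)%N ->
  \sum_(1 <= l < n.+1) ((d * l <= n)%N)%:R = (n %/ d)%:R :> R.
Proof.
move=> d0; rewrite (big_cat_nat (n := (n %/ d).+1)) //=; last by rewrite ltnS leq_div.
rewrite (eq_big_nat _ _ (F2 := fun=> 1)) => [|l /andP[_ l1]]; last first.
  by rewrite mulnC -leq_divRL // -ltnS l1.
rewrite [X in _ + X]big_nat_cond [X in _ + X]big1 ?addr0 ?sumr_const_nat ?subSS ?subn0 // => l.
by rewrite andbT => /andP[l1 _]; rewrite mulnC -leq_divRL // leqNgt l1.
Qed.

Lemma ln_fact_sum (R : realType) (n : nat) :
  ln (n`!)%:R = \sum_(1 <= k < n.+1) ln k%:R :> R.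
Proof.
elim: n => [|n IH]; first by rewrite big_geq // fact0 ln1.
by rewrite big_nat_recr //= -IH factS natrM lnM ?posrE ?ltr0n ?fact_gt0 // addrC.
Qed.

Lemma ln_factE (R : realType) (n : nat) :
  ln (n`!)%:R = \sum_(1 <= m < n.+1) mangoldt R m * (n %/ m)%:R :> R.
Proof.
transitivity (\sum_(1 <= k < n.+1) (\sum_(1 <= b < k.+1 | (b %| k)%N) mangoldt R b) *
   (k <= n)%N%:R).
  rewrite ln_fact_sum; apply: eq_big_nat => k /andP[k0]; rewrite ltnS => ->.
  by rewrite mulr1 sum_dvd_mangoldt.
rewrite sum_dvd_reindex => [|m]; last by rewrite ltnNge => /negbTE ->.
by apply: eq_big_nat => m /andP[m0 _]; rewrite sum_leq_mul.
Qed.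

Lemma ln2_bounds (R : realType) : 2^-1 <= ln (2 : R) <= 1.
Proof.
apply/andP; split; last by have := @le_ln1Dx R 1; rewrite -natr1 addrC; apply; lra.
have h : 1 + - 2^-1 = 2^-1 :> R by field.
by have := @le_ln1Dx R (- 2^-1); rewrite h lnV ?posrE // lerN2; apply; lra.
Qed.

(** Chebyshev's argument: the logarithm of the central binomial coefficient is the sum of
    [mangoldt R m] times $\lfloor 2n/m\rfloor-2\lfloor n/m\rfloor\ge0$, a weight that is at least 1
    for $n<m\le 2n$. *)
Lemma psi_double_le (R : realType) (n : nat) : psi R (2 * n) - psi R n <= (2 * n)%:R.
Proof.
have nn : (n <= 2 * n)%N by rewrite leq_pmull.
have c0 : (0 < 'C(2 * n, n))%N by rewrite bin_gt0.
have lnC : ln ('C(2 * n, n))%:R + 2 * ln (n`!)%:R = ln ((2 * n)`!)%:R :> R.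
  rewrite -(bin_fact nn) !natrM !lnM ?posrE ?mulr_gt0 ?ltr0n ?fact_gt0 //.
  by rewrite (_ : (2 * n - n)%N = n); [ring | clear; lia].
have Cle : ln ('C(2 * n, n))%:R <= (2 * n)%:R :> R.
  apply: (@le_trans _ _ (ln (2 ^ (2 * n))%:R)).
    rewrite ler_ln ?posrE ?ltr0n ?expn_gt0 // ler_nat.
    rewrite -{2}[2%N]/(1 + 1)%N Pascal (bigD1 (inord n)) //= inordK ?ltnS //.
    by rewrite !exp1n !muln1 leq_addr.
  rewrite natrX lnXn ?ltr0n // -[leLHS]mulr_natl; apply: ler_piMr => //.
  by have /andP[] := ln2_bounds R.
apply: le_trans Cle.
rewrite (_ : ln _ = ln ((2 * n)`!)%:R - 2 * ln (n`!)%:R); last by rewrite -lnC; ring.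
rewrite !ln_factE.
have -> : \sum_(1 <= m < n.+1) mangoldt R m * (n %/ m)%:R =
    \sum_(1 <= m < (2 * n).+1) mangoldt R m * (n %/ m)%:R.
  rewrite [RHS](big_cat_nat (n := n.+1)) //= [X in _ = _ + X]big_nat_cond.
  rewrite [X in _ = _ + X]big1 ?addr0 // => m; rewrite andbT => /andP[nm _].
  by rewrite divn_small // mulr0.
rewrite mulr_sumr -sumrB /psi (big_cat_nat (n := n.+1) (F := mangoldt R)) //= addrAC subrr add0r.
rewrite [leRHS](big_cat_nat (n := n.+1)) //=; apply: ler_wpDl.
  rewrite big_nat_cond; apply: sumr_ge0 => m; rewrite andbT => /andP[m0 _].
  rewrite mulrCA -mulrBr mulr_ge0 ?mangoldt_ge0 // subr_ge0.
  by rewrite -natrM ler_nat leq_divRL // -mulnA leq_mul2l leq_divM orbT.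
rewrite big_nat_cond [leRHS]big_nat_cond; apply: ler_sum => m.
rewrite andbT => /andP[nm mn].
rewrite [X in _ - 2 * (_ * X%:R)]divn_small // !mulr0 subr0; apply: ler_peMr; first exact: mangoldt_ge0.
by rewrite ler1n divn_gt0 // (leq_trans _ nm).
Qed.

(** Doubling gives the constant 2 at powers of 2; rounding [N] up to the next power costs another
    factor 2. *)
Lemma psi_le (R : realType) (N : nat) : psi R N <= 4 * N%:R.
Proof.
have h k : psi R (2 ^ k) <= 2 * (2 ^ k)%:R.
  elim: k => [|k IH].
    rewrite /psi expn0 big_nat1; apply: (le_trans (mangoldt_le_ln R (n := 1) isT)).
    by rewrite ln1 mulr1.
  rewrite expnS; have := psi_double_le R (2 ^ k); rewrite natrM; lra.
case: (posnP N) => [->|N0]; first by rewrite /psi big_geq // mulr0.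
have /andP[h1 h2] := @trunc_log_bounds 2 N isT N0.
apply: (le_trans (psi_le_mono R (ltnW h2))); apply: (le_trans (h _)).
rewrite expnS natrM; have : (2 ^ trunc_log 2 N)%:R <= N%:R :> R by rewrite ler_nat.
lra.
Qed.

Lemma ln_succ_sub_le (R : realType) (n : nat) : (0 < n)%N ->
  ln n.+1%:R - ln n%:R <= n%:R^-1 :> R.
Proof.
move=> n0; have n0' : 0 < n%:R :> R by rewrite ltr0n.
rewrite -ln_div ?posrE ?ltr0n //.
have -> : n.+1%:R / n%:R = 1 + n%:R^-1 :> R by rewrite -natr1 mulrDl divff ?gt_eqF // mul1r.
by apply: le_ln1Dx; rewrite (lt_trans (ltrN10 _)) // invr_gt0.
Qed.

Lemma inv_le_ln_succ_sub (R : realType) (n : nat) : (0 < n)%N ->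
  n.+1%:R^-1 <= ln n.+1%:R - ln n%:R :> R.
Proof.
move=> n0; have n0' : 0 < n.+1%:R :> R by rewrite ltr0n.
have n1 : n%:R / n.+1%:R = 1 - n.+1%:R^-1 :> R.
  by rewrite -[n.+1%:R]natr1; field; rewrite natr1 gt_eqF.
rewrite -opprB -ln_div ?posrE ?ltr0n // n1 lerNr; apply: le_ln1Dx.
by rewrite ltrN2 invf_lt1 // ltr1n.
Qed.

Lemma ln_fact_ge (R : realType) (n : nat) : n%:R * ln n%:R - n%:R <= ln (n`!)%:R :> R.
Proof.
elim: n => [|n IH]; first by rewrite mul0r subr0 fact0 ln1.
rewrite factS natrM lnM ?posrE ?ltr0n ?fact_gt0 //.
case: (posnP n) => [->|n0]; first by rewrite fact0 !ln1 -natr1; lra.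
have := ln_succ_sub_le R n0; have n0' : 0 < n%:R :> R by rewrite ltr0n.
rewrite -(ler_pM2l n0') divff ?gt_eqF // -[n.+1%:R]natr1; nra.
Qed.

Lemma ln_fact_le (R : realType) (n : nat) : ln (n`!)%:R <= n%:R * ln n%:R :> R.
Proof.
rewrite ln_fact_sum; apply: (@le_trans _ _ (\sum_(1 <= k < n.+1) ln n%:R)).
  apply: ler_sum_nat => k /andP[k0]; rewrite ltnS => kn.
  by rewrite ler_ln ?posrE ?ltr0n ?ler_nat // (leq_trans k0).
by rewrite sumr_const_nat subSS subn0 mulr_natl.
Qed.

Lemma mertens_ge (R : realType) (N : nat) : (0 < N)%N ->
  ln N%:R - 1 <= \sum_(1 <= n < N.+1) mangoldt R n / n%:R.
Proof.
move=> N0; have N0' : 0 < N%:R :> R by rewrite ltr0n.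
rewrite -(ler_pM2l N0') mulrBr mulr1; apply: (le_trans (ln_fact_ge R N)).
rewrite ln_factE mulr_sumr; apply: ler_sum_nat => n /andP[n0 _].
rewrite mulrCA; apply: ler_wpM2l; first exact: mangoldt_ge0.
by rewrite ler_pdivlMr ?ltr0n // -natrM ler_nat leq_divM.
Qed.

(** Replacing $\lfloor N/n\rfloor$ by $N/n$ in the formula for $\log N!$ costs at most [psi R N],
    hence the 4 of [psi_le]. *)
Lemma mertens_le (R : realType) (N : nat) : (0 < N)%N ->
  \sum_(1 <= n < N.+1) mangoldt R n / n%:R <= ln N%:R + 4.
Proof.
move=> N0; have N0' : 0 < N%:R :> R by rewrite ltr0n.
rewrite -(ler_pM2l N0') mulrDr.
suff : N%:R * \sum_(1 <= n < N.+1) mangoldt R n / n%:R <= ln (N`!)%:R + psi R N.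
  have := ln_fact_le R N; have := psi_le R N; lra.
rewrite ln_factE mulr_sumr -big_split /=; apply: ler_sum_nat => n /andP[n0 _].
rewrite mulrCA -{3}[mangoldt R n]mulr1 -mulrDr; apply: ler_wpM2l; first exact: mangoldt_ge0.
by rewrite ler_pdivrMr ?ltr0n // natr1 -natrM ler_nat ltnW // -ltn_divLR.
Qed.

(** The two Mertens bounds show that the terms [mangoldt R n / n] with n between N/K and N sum to at
    least $\log K-5$, and there 1/n is at most K/N. *)
Lemma psi_ge (R : realType) : exists2 K : nat, (0 < K)%N &
  forall N : nat, (K <= N)%N -> N%:R / K%:R <= psi R N.
Proof.
have [K K0 lK] : exists2 K : nat, (0 < K)%N & 6 <= ln K%:R :> R.
  (* From $\log 2\ge 1/2$ one gets $\log K\ge 6$, one more than the sum of the errors 1 and 4 in the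
     Mertens bounds. *)
  exists (2 ^ 12)%N; first by rewrite expn_gt0.
  rewrite natrX lnXn // -[leRHS]mulr_natl; have /andP[] := ln2_bounds R; lra.
exists K => // N N1; pose N' := (N %/ K)%N.
have N'0 : (0 < N')%N by rewrite divn_gt0.
have N0 : (0 < N)%N by apply: leq_trans N1.
have N'N : (N' <= N)%N by exact: leq_div.
have K0' : 0 < K%:R :> R by rewrite ltr0n.
have N0' : 0 < N%:R :> R by rewrite ltr0n.
have N'0' : 0 < N'%:R :> R by rewrite ltr0n.
have := mertens_ge R N0; have := mertens_le R N'0.
rewrite (big_cat_nat (n := N'.+1) (p := N.+1)) //=.
set S := \sum_(1 <= i < N'.+1) _; set T := \sum_(_ <= _ < _) _.
have lN : ln N%:R - ln N'%:R >= 6 :> R.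
  rewrite -ln_div ?posrE //; apply: (le_trans lK).
  rewrite ler_ln ?posrE ?divr_gt0 // ler_pdivlMr //.
  by rewrite -natrM ler_nat mulnC leq_divM.
have TN : T <= K%:R / N%:R * psi R N.
  rewrite /psi mulr_sumr [leRHS](big_cat_nat (n := N'.+1)) //=; apply: ler_wpDl.
    by apply: sumr_ge0 => n _; rewrite mulr_ge0 ?mangoldt_ge0 // divr_ge0.
  apply: ler_sum_nat => n /andP[n0 _]; rewrite mulrC; apply: ler_wpM2r; first exact: mangoldt_ge0.
  rewrite ler_pdivlMr // mulrC ler_pdivrMr ?ltr0n ?(leq_trans _ n0) //.
  by rewrite -natrM ler_nat ltnW // mulnC -ltn_divLR.
move=> h1 h2.
have : 1 <= K%:R / N%:R * psi R N by lra.
by rewrite mulrAC ler_pdivlMr // mul1r ler_pdivrMr // mulrC.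
Qed.

Lemma sum_geometric_tail_le (R : realType) (p n : nat) : (1 < p)%N ->
  \sum_(2 <= k < n) (p ^ k)%:R^-1 <= (p * p.-1)%:R^-1 :> R.
Proof.
case: p => // p; rewrite ltnS => p0 /=.
have p0' : 0 < p%:R :> R by rewrite ltr0n.
have p1' : 0 < p.+1%:R :> R by rewrite ltr0n.
case: (leqP n 1) => [n1|]; first by rewrite big_geq ?invr_ge0 // ltnW.
case: n => [|[|n]] // _.
suff -> : \sum_(2 <= k < n.+2) (p.+1 ^ k)%:R^-1 =
    (p.+1 * p)%:R^-1 - (p.+1 ^ n.+1 * p)%:R^-1 :> R.
  by rewrite gerBl invr_ge0.
elim: n => [|n IH]; first by rewrite big_geq // expn1 subrr.
rewrite big_nat_recr //= IH !expnS !natrM -[in LHS]natr1 -[in RHS]natr1.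
by field; rewrite natr1 !gt_eqF // natrX exprn_gt0.
Qed.

Lemma sum_ln_telescope_le (R : realType) (Q : nat) :
  \sum_(2 <= j < Q.+1) ln j%:R * (j * j.-1)%:R^-1 <= 3 :> R.
Proof.
case: Q => [|Q]; first by rewrite big_geq.
(* The subtracted term majorises the tail: it drops by at least the next summand, because the
   logarithm grows by at most 1/n. The constant 3 is what the start of the induction needs, namely
   $\log 2+2\le 3$. *)
apply: (@le_trans _ _ (3 - (ln Q.+2%:R + 2) / Q.+1%:R)); last first.
  by rewrite gerBl divr_ge0 // addr_ge0 // ln_ge0 // ler1n.
elim: Q => [|Q IH].
  rewrite big_geq // divr1; have /andP[_] := ln2_bounds R; lra.
rewrite big_nat_recr //=; apply: (le_trans (lerD IH (lexx _))).
have l0 : 0 <= ln Q.+2%:R :> R by rewrite ln_ge0 // ler1n.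
have := @ln_succ_sub_le R Q.+2 isT.
set l := ln Q.+2%:R in l0 *; set l' := ln Q.+3%:R.
have y0 : 0 < Q.+1%:R :> R by rewrite ltr0n.
rewrite natrM -[Q.+2%:R]natr1; set y := Q.+1%:R in y0 *.
have y1 : 0 < y + 1 by rewrite addr_gt0.
rewrite -(ler_pM2l y1) divff ?gt_eqF // => h.
rewrite -subr_ge0.
have -> : 3 - (l' + 2) / (y + 1) - (3 - (l + 2) / y + l * ((y + 1) * y)^-1) =
   (2 + y * (l - l')) / ((y + 1) * y) by field; rewrite !gt_eqF.
apply: divr_ge0; last by rewrite mulr_ge0 // ltW.
nra.
Qed.

(** The loss 8 is 1 + 4 from the two Mertens bounds plus 3 for the prime powers with exponent at
    least 2. *)
Lemma sum_primes_ln_ge (R : realType) (P Q : nat) : (0 < P <= Q)%N ->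
  ln Q%:R - ln P%:R - 8 <= \sum_(P.+1 <= p < Q.+1 | prime p) ln p%:R / p%:R :> R.
Proof.
move=> /andP[P0 PQ].
have := mertens_ge R (leq_trans P0 PQ); have := mertens_le R P0.
rewrite (big_cat_nat (n := P.+1) (p := Q.+1)) //=.
set S := \sum_(1 <= i < P.+1) _; set T := \sum_(P.+1 <= _ < _) _.
suff : T <= \sum_(P.+1 <= p < Q.+1 | prime p) ln p%:R / p%:R + 3 by lra.
have -> : T = \sum_(1 <= n < Q.+1) mangoldt R n * (if (P < n)%N then n%:R^-1 else 0).
  rewrite [RHS](big_cat_nat (n := P.+1)) //= [X in _ = X + _]big_nat_cond.
  rewrite [X in _ = X + _]big1 ?add0r => [|n]; last first.
    by rewrite andbT ltnS => /andP[_ nP]; rewrite ltnNge nP mulr0.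
  by apply: eq_big_nat => n /andP[-> _].
rewrite sum_mangoldt.
apply: (@le_trans _ _ (\sum_(0 <= p < Q.+1 | prime p) ((if (P < p)%N then ln p%:R / p%:R else 0) +
   ln p%:R * (p * p.-1)%:R^-1))).
  rewrite big_nat_cond [leRHS]big_nat_cond; apply: ler_sum => p /andP[/andP[_ pQ] pp].
  have p1 := prime_gt1 pp; have lp := ln_prime_ge0 R pp.
  rewrite ltnS in pQ.
  rewrite big_mkcond big_ltn ?ltnS ?(leq_trans P0) //= expn1 pQ.
  apply: lerD; first by case: ifP; rewrite ?mulr0.
  apply: le_trans (ler_wpM2l lp (sum_geometric_tail_le R Q.+1 p1)).
  rewrite mulr_sumr; apply: ler_sum => k _.
  case: ifP => _; last by rewrite mulr_ge0 // invr_ge0.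
  by case: ifP => _; rewrite ?mulr0 ?mulr_ge0 ?invr_ge0.
rewrite big_split /=; apply: lerD.
  rewrite (big_cat_nat (n := P.+1)) //=.
  rewrite big_nat_cond big1 ?add0r => [|p /andP[/andP[_ pP] _]]; last by rewrite ltnNge -ltnS pP.
  by rewrite big_nat_cond [leRHS]big_nat_cond; apply: ler_sum => p /andP[/andP[-> _] _].
apply: le_trans (sum_ln_telescope_le R Q).
rewrite big_mkcond (big_cat_nat (n := 2)) //=; last by rewrite ltnS (leq_trans P0).
rewrite [X in X + _]big_nat_cond [X in X + _]big1 ?add0r => [|[|[|p]]] //.
apply: ler_sum_nat => p /andP[p1 _]; case: ifP => // _.
by rewrite mulr_ge0 ?invr_ge0 // ln_ge0 // ler1n ltnW.
Qed.

(** If $p^k\le N$ and $k\ge2$, then $p\le\sqrt N$ and $k\le\log_2N$, so at most [s * t] pairs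
    occur. *)
Lemma sum_higher_powers_le (R : realType) (N s t : nat) : (0 < N)%N ->
  (N < s.+1 ^ 2)%N -> (N < 2 ^ t.+1)%N ->
  \sum_(0 <= p < N.+1 | prime p) \sum_(2 <= k < N.+1 | (p ^ k <= N)%N) ln p%:R <=
  s%:R * t%:R * ln N%:R :> R.
Proof.
move=> N0 hs ht.
have lN : 0 <= ln N%:R :> R by rewrite ln_ge0 // ler1n.
apply: (@le_trans _ _ (\sum_(0 <= p < N.+1 | prime p) \sum_(2 <= k < N.+1)
   (if (1 <= p < s.+1)%N && (1 <= k < t.+1)%N then ln N%:R else 0))).
  apply: ler_sum => p pp; rewrite big_mkcond; apply: ler_sum_nat => k /andP[k2 _].
  case: ifP => h; last by case: ifP.
  have p1 := prime_gt1 pp.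
  have ps : (p < s.+1)%N.
    have : (p ^ 2 < s.+1 ^ 2)%N by apply: leq_ltn_trans hs; apply: leq_trans h; rewrite leq_exp2l.
    by rewrite ltn_exp2r.
  have kt : (k < t.+1)%N.
    have : (2 ^ k < 2 ^ t.+1)%N by apply: leq_ltn_trans ht; apply: leq_trans h; rewrite leq_exp2r // ltnW.
    by rewrite ltn_exp2l.
  rewrite ps kt (prime_gt0 pp) (ltnW k2) /=.
  rewrite ler_ln ?posrE ?ltr0n ?(prime_gt0 pp) // ler_nat.
  by apply: leq_trans h; rewrite -{1}(expn1 p) leq_exp2l // ltnW.
have cnt (m n : nat) (c : R) : 0 <= c ->
    \sum_(m <= k < N.+1) (if (1 <= k < n.+1)%N then c else 0) <= n%:R * c.
  move=> c0; rewrite -big_mkcond /= mulr_natl -{2}(subn0 n) -subSS -sumr_const_nat.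
  rewrite -big_filter -[leRHS]big_filter; apply: (@le_trans _ _
    (\sum_(i <- [seq x <- index_iota 1 n.+1 | (m <= x < N.+1)%N]) c)).
    rewrite le_eqVlt (perm_big [seq x <- index_iota 1 n.+1 | (m <= x < N.+1)%N]) ?eqxx //.
    apply: uniq_perm; rewrite ?filter_uniq ?iota_uniq // => x.
    by rewrite !mem_filter !mem_index_iota andbC.
  rewrite !big_filter big_mkcond; apply: ler_sum => i _; by case: ifP.
apply: (@le_trans _ _ (\sum_(0 <= p < N.+1) (if (1 <= p < s.+1)%N then t%:R * ln N%:R else 0))).
  rewrite big_mkcond; apply: ler_sum => p _; case: ifP => _; last first.
    by case: ifP => // _; rewrite mulr_ge0.
  case: ifP => _ /=; last by rewrite big1.
  exact: cnt.
by apply: (le_trans (cnt _ _ _ _)); rewrite ?mulr_ge0 // mulrA.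
Qed.

(** * Mean square of Vaughan's coefficients *)

Lemma harmonic_le (R : realType) (n : nat) : (0 < n)%N ->
  \sum_(1 <= k < n.+1) k%:R^-1 <= 1 + ln n%:R :> R.
Proof.
case: n => // n _; elim: n => [|n IH]; first by rewrite big_nat1 invr1 ln1 addr0.
rewrite big_nat_recr //=; apply: (le_trans (lerD IH (lexx _))).
by rewrite -addrA lerD2l -lerBrDl; exact: inv_le_ln_succ_sub.
Qed.

(** As $1/\mathrm{lcm}(b,c)=\gcd(b,c)/(bc)$, replacing the gcd by the sum of all common divisors g
    separates b from c for fixed g. *)
Lemma inv_lcm_le (R : realType) (V b c : nat) : (0 < b <= V)%N -> (0 < c)%N ->
  (lcmn b c)%:R^-1 <=
  \sum_(1 <= g < V.+1) (if (g %| b)%N && (g %| c)%N then g%:R else 0) * (b%:R^-1 * c%:R^-1) :> R.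
Proof.
move=> /andP[b0 bV] c0.
have b0' : 0 < b%:R :> R by rewrite ltr0n.
have c0' : 0 < c%:R :> R by rewrite ltr0n.
have g0 : (0 < gcdn b c)%N by rewrite gcdn_gt0 b0.
have l0 : 0 < (lcmn b c)%:R :> R by rewrite ltr0n lcmn_gt0 b0.
rewrite (bigD1_seq (gcdn b c)) ?iota_uniq //=; last first.
  by rewrite mem_index_iota g0 ltnS (leq_trans _ bV) // dvdn_leq // dvdn_gcdl.
rewrite dvdn_gcdl dvdn_gcdr /=; apply: ler_wpDr.
  apply: sumr_ge0 => g _; rewrite mulr_ge0 ?mulr_ge0 ?invr_ge0 ?(ltW b0') ?(ltW c0') //.
  by case: ifP.
rewrite -invfM -natrM -muln_lcm_gcd natrM invfM mulrA mulrAC divff ?mul1r //.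
by rewrite pnatr_eq0 -lt0n.
Qed.

Lemma sum_multiples_inv_le (R : realType) (V g : nat) : (0 < g)%N -> (0 < V)%N ->
  \sum_(1 <= b < V.+1) (if (g %| b)%N then b%:R^-1 else 0) <= g%:R^-1 * (1 + ln V%:R) :> R.
Proof.
move=> g0 V0; rewrite -big_mkcond sum_multiples //=.
apply: le_trans (ler_wpM2l _ (harmonic_le R V0)); last by rewrite invr_ge0.
rewrite big_mkcond mulr_sumr; apply: ler_sum => e _; rewrite natrM invfM.
by case: ifP => // _; rewrite mulr_ge0 // invr_ge0.
Qed.

(** The coefficient is at most the number of divisors b <= V of k. Its square counts pairs (b, c)
    with lcm dividing k, and each pair occurs at most K/lcm(b, c) times. The three logarithms are
    the harmonic sums over b/g, c/g and g. *)
Lemma sum_sqr_vaughan_coef_le (R : realType) (V K : nat) : (0 < V)%N ->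
  \sum_(1 <= k < K.+1) vaughan_coef R V k ^+ 2 <= K%:R * (1 + ln V%:R) ^+ 3.
Proof.
move=> V0.
have lV : 0 <= 1 + ln V%:R :> R by rewrite addr_ge0 // ln_ge0 // ler1n.
apply: (@le_trans _ _ (\sum_(1 <= k < K.+1) \sum_(1 <= b < V.+1) \sum_(1 <= c < V.+1)
   ((lcmn b c %| k)%N)%:R)).
  apply: ler_sum_nat => k /andP[k0 kK].
  have h : `|vaughan_coef R V k| <= \sum_(1 <= b < V.+1) ((b %| k)%N)%:R.
    apply: (le_trans (ler_norm_sum _ _ _)).
    apply: (@le_trans _ _ (\sum_(1 <= b < k.+1 | (b %| k)%N) (if (b <= V)%N then 1 else 0))).
      apply: ler_sum => b _; rewrite /moebius_trunc; case: ifP => _; last by rewrite normr0.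
      exact: norm_moebius_le1.
    rewrite -big_mkcondr -big_filter.
    rewrite (perm_big [seq b <- index_iota 1 V.+1 | (b %| k)%N]) /=.
      by rewrite big_filter big_mkcond; apply: ler_sum => b _; case: ifP.
    apply: uniq_perm; rewrite ?filter_uniq ?iota_uniq // => b.
    rewrite !mem_filter !mem_index_iota !ltnS.
    case: (boolP (b %| k)%N) => //= bk; rewrite (dvdn_leq k0 bk) !andbT.
    by rewrite andbC.
  rewrite -real_normK ?num_real //.
  apply: (@le_trans _ _ ((\sum_(1 <= b < V.+1) ((b %| k)%N)%:R) ^+ 2)).
    by rewrite lerXn2r ?nnegrE ?normr_ge0 // sumr_ge0.
  rewrite expr2 big_distrlr /=; apply: ler_sum => b _; apply: ler_sum => c _.
  by rewrite -natrM mulnb dvdn_lcm.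
rewrite exchange_big /=; under eq_bigr do rewrite exchange_big /=.
apply: (@le_trans _ _ (\sum_(1 <= b < V.+1) \sum_(1 <= c < V.+1)
   K%:R * (lcmn b c)%:R^-1)).
  apply: ler_sum_nat => b /andP[b0 _]; apply: ler_sum_nat => c /andP[c0 _].
  have l0 : (0 < lcmn b c)%N by rewrite lcmn_gt0 b0.
  have l0' : 0 < (lcmn b c)%:R :> R by rewrite ltr0n.
  have -> : \sum_(1 <= k < K.+1) ((lcmn b c %| k)%N)%:R = (K %/ lcmn b c)%:R :> R.
    transitivity (\sum_(1 <= k < K.+1 | (lcmn b c %| k)%N) (1 : R)).
      by rewrite [RHS]big_mkcond; apply: eq_bigr => k _; case: (_ %| _)%N.
    rewrite sum_multiples // -sum_leq_mul // big_mkcond; apply: eq_bigr => k _.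
    by case: ifP.
  by rewrite ler_pdivlMr // -natrM ler_nat leq_divM.
apply: (@le_trans _ _ (\sum_(1 <= b < V.+1) \sum_(1 <= c < V.+1) \sum_(1 <= g < V.+1)
   K%:R * ((if (g %| b)%N && (g %| c)%N then g%:R else 0) * (b%:R^-1 * c%:R^-1)))).
  apply: ler_sum_nat => b /andP[b0 bV]; apply: ler_sum_nat => c /andP[c0 _].
  rewrite -mulr_sumr; apply: ler_wpM2l => //; apply: inv_lcm_le => //.
  by rewrite b0 -ltnS.
under eq_bigr do rewrite exchange_big /=.
rewrite exchange_big /=.
have -> : K%:R * (1 + ln V%:R) ^+ 3 = K%:R * (1 + ln V%:R) ^+ 2 * (1 + ln V%:R) :> R by ring.
apply: le_trans (ler_wpM2l _ (harmonic_le R V0)); last by rewrite mulr_ge0 // sqr_ge0.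
rewrite mulr_sumr; apply: ler_sum_nat => g /andP[g0 _].
have g0' : 0 < g%:R :> R by rewrite ltr0n.
have -> : \sum_(1 <= i < V.+1) \sum_(1 <= i0 < V.+1)
     K%:R * ((if (g %| i)%N && (g %| i0)%N then g%:R else 0) * (i%:R^-1 * i0%:R^-1)) =
   K%:R * g%:R * (\sum_(1 <= b < V.+1) (if (g %| b)%N then b%:R^-1 else 0)) ^+ 2 :> R.
  rewrite expr2 big_distrlr /= mulr_sumr; apply: eq_bigr => b _.
  rewrite mulr_sumr; apply: eq_bigr => c _.
  by case: (g %| b)%N; case: (g %| c)%N; rewrite /= ?(mul0r, mulr0) // !mulrA.
have h := sum_multiples_inv_le R g0 V0.
set X := \sum_(_ <= _ < _) _ in h *.
have X0 : 0 <= X by apply: sumr_ge0 => b _; case: ifP => // _; rewrite invr_ge0.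
have X2 : X ^+ 2 <= (g%:R^-1 * (1 + ln V%:R)) ^+ 2.
  by rewrite lerXn2r ?nnegrE // mulr_ge0 // invr_ge0.
apply: (@le_trans _ _ (K%:R * g%:R * (g%:R^-1 * (1 + ln V%:R)) ^+ 2)).
  by apply: ler_wpM2l => //; rewrite mulr_ge0.
by rewrite le_eqVlt; apply/orP; left; apply/eqP; field; rewrite gt_eqF.
Qed.

(** * Primes in progressions to prime moduli *)

Lemma sum_dvd_shift (d t K : nat) : (t < d)%N ->
  (\sum_(1 <= l < K.+1) (d %| l + t))%N = ((K + t) %/ d)%N.
Proof.
move=> td; elim: K => [|K IH]; first by rewrite big_geq // add0n divn_small.
by rewrite big_nat_recr //= IH addSn divnS ?(leq_ltn_trans _ td) // addnC.
Qed.

(** With $q=\lfloor K/d\rfloor$, both the number of solutions and its expected value $(K-q)/(d-1)$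
    lie in $[q,q+1]$. If [d] divides [b], every term is zero. *)
Lemma disc_sum_le (R : realType) (lam : int) (d b K : nat) : prime d ->
  ~~ (d%:Z %| lam)%Z -> `|\sum_(1 <= l < K.+1) disc R lam d (b * l)| <= 1.
Proof.
move=> pd dl; have d1 := prime_gt1 pd.
have dvdE n : (d%:Z %| n%:Z + lam)%Z = (n%:R + lam%:~R == 0 :> 'F_d).
  by rewrite -intr_Fp_eq0 // rmorphD /= -pmulrn.
have [db|db] := boolP (d %| b)%N.
  rewrite big1 ?normr0 // => l _; rewrite /disc dvdn_mulr //= mul0r subr0 dvdE.
  rewrite (_ : (b * l)%:R = 0 :> 'F_d); last by apply/eqP; rewrite natr_Fp_eq0 // dvdn_mulr.
  by rewrite add0r intr_Fp_eq0 // (negPf dl).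
have b0 : b%:R != 0 :> 'F_d by rewrite natr_Fp_eq0.
(* The least residue of [lam / b], so that $bl+\lambda\equiv b(l+t)$ and solutions are the l with d
   dividing l + t. *)
pose t : nat := (lam%:~R / b%:R : 'F_d).
have td : (t < d)%N by have := ltn_ord (lam%:~R / b%:R : 'F_d); rewrite [X in (_ < X)%N]Fp_cast.
have tE : t%:R = lam%:~R / b%:R :> 'F_d by exact: natr_Zp.
have lE l : (d%:Z %| (b * l)%:Z + lam)%Z = (d %| l + t)%N.
  rewrite dvdE -(natr_Fp_eq0 (l + t) pd) natrD tE.
  rewrite (_ : (b * l)%:R + _ = b%:R * (l%:R + lam%:~R / b%:R)).
    by rewrite mulf_eq0 (negPf b0).
  by rewrite natrM mulrDr mulrCA divff // mulr1.
have dE l : (d %| b * l)%N = (d %| l)%N by rewrite Euclid_dvdM // (negPf db).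
have -> : \sum_(1 <= l < K.+1) disc R lam d (b * l) =
   ((K + t) %/ d)%:R - (K - K %/ d)%:R / d.-1%:R.
  rewrite /disc sumrB -mulr_suml -sum_dvd_shift //; congr (_ - _ / _).
    by rewrite natr_sum; apply: eq_bigr => l _; rewrite lE.
  have KE : ((K %/ d) = \sum_(1 <= l < K.+1) (d %| l))%N.
    by rewrite -{1}(addn0 K) -sum_dvd_shift ?prime_gt0 //; apply: eq_bigr => l _; rewrite addn0.
  have KR : K%:R = \sum_(1 <= l < K.+1) (1 : R) by rewrite sumr_const_nat subSS subn0.
  rewrite natrB ?leq_div // KR KE natr_sum -sumrB; apply: eq_bigr => l _; rewrite dE.
  by case: (_ %| _)%N; rewrite /= ?subrr ?subr0.
have e0 : (0 < d.-1)%N by rewrite -ltnS prednK // ltnW.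
have e0' : 0 < d.-1%:R :> R by rewrite ltr0n.
have h1 : (K %/ d <= (K + t) %/ d)%N by rewrite leq_div2r // leq_addr.
have h2 : ((K + t) %/ d <= (K %/ d).+1)%N.
  have : (K + t <= K + d)%N by rewrite leq_add2l ltnW.
  move/(leq_div2r d)/leq_trans; apply.
  by rewrite divnDr // divnn (ltnW d1) addn1.
have [KE rd] : (K = K %/ d * d + K %% d)%N /\ (K %% d < d)%N.
  by split; [exact: divn_eq | rewrite ltn_mod ltnW].
have h3 : ((K %/ d) * d.-1 <= K - K %/ d)%N.
  by move: KE e0; set q := (K %/ d)%N; set r := (K %% d)%N; clear; nia.
have h4 : (K - K %/ d <= (K %/ d).+1 * d.-1)%N.
  by move: KE e0 rd; set q := (K %/ d)%N; set r := (K %% d)%N; clear; nia.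
have h3' : (K %/ d)%:R <= (K - K %/ d)%:R / d.-1%:R :> R.
  by rewrite ler_pdivlMr // -natrM ler_nat.
have h4' : (K - K %/ d)%:R / d.-1%:R <= (K %/ d)%:R + 1 :> R.
  by rewrite ler_pdivrMr // natr1 -natrM ler_nat.
have h1' : (K %/ d)%:R <= ((K + t) %/ d)%:R :> R by rewrite ler_nat.
have h2' : ((K + t) %/ d)%:R <= (K %/ d)%:R + 1 :> R by rewrite natr1 ler_nat.
rewrite ler_norml; move: h1' h2' h3' h4'; clear; set x := _ / d.-1%:R; lra.
Qed.

Lemma norm_disc_le1 (R : realType) (lam : int) (d n : nat) : prime d ->
  `|disc R lam d n| <= 1.
Proof.
move=> pd; have e0 : (0 < d.-1)%N by rewrite -ltnS prednK ?prime_gt1 // prime_gt0.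
have h : 0 <= ((~~ (d %| n)%N)%:R : R) / d.-1%:R <= 1.
  rewrite divr_ge0 //= ler_pdivrMr ?ltr0n // mul1r ler_nat.
  by case: (~~ _).
rewrite /disc ler_norml; case: (_ %| _)%Z; move: h; set x := _ / _; rewrite /=; lra.
Qed.

(** Summation by parts: the boundary term and the total variation of the nondecreasing weight [g]
    each cost at most [B * g K]. *)
Lemma abel_sum_le (R : realType) (g f : nat -> R) (B : R) (K : nat) :
  (forall k, `|\sum_(1 <= c < k.+1) f c| <= B) ->
  (forall k, (0 < k)%N -> 0 <= g k <= g k.+1) -> (0 < K)%N ->
  `|\sum_(1 <= c < K.+1) g c * f c| <= 2 * B * g K.
Proof.
move=> hB hg; case: K => // K _.
have B0 : 0 <= B by apply: le_trans (normr_ge0 _) (hB 0%N).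
pose S k := \sum_(1 <= c < k.+1) f c.
have key : `|\sum_(1 <= c < K.+2) g c * f c - g K.+1 * S K.+1| <= B * (g K.+1 - g 1%N).
  elim: K => [|K IH]; first by rewrite /S !big_nat1 !subrr normr0 mulr0 lexx.
  have -> : \sum_(1 <= c < K.+3) g c * f c - g K.+2 * S K.+2 =
     (\sum_(1 <= c < K.+2) g c * f c - g K.+1 * S K.+1) - (g K.+2 - g K.+1) * S K.+1.
    by rewrite /S !(big_nat_recr K.+2) //=; ring.
  apply: (le_trans (ler_normB _ _)).
  have gm : 0 <= g K.+2 - g K.+1 by have /andP[_] := hg K.+1 isT; rewrite subr_ge0.
  have -> : B * (g K.+2 - g 1%N) = B * (g K.+1 - g 1%N) + (g K.+2 - g K.+1) * B by ring.
  apply: lerD => //; rewrite normrM (ger0_norm gm); exact: ler_wpM2l gm _ _ (hB K.+1).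
have g1 : 0 <= g 1%N by have /andP[] := hg 1%N isT.
have gK : 0 <= g K.+1 by have /andP[] := hg K.+1 isT.
have := ler_normD (\sum_(1 <= c < K.+2) g c * f c - g K.+1 * S K.+1) (g K.+1 * S K.+1).
rewrite subrK => /le_trans; apply.
have : `|g K.+1 * S K.+1| <= g K.+1 * B by rewrite normrM (ger0_norm gK); exact: ler_wpM2l gK _ _ (hB K.+1).
have : 0 <= B * g 1%N by rewrite mulr_ge0.
move: key; nra.
Qed.

(** * Type I sums *)

Definition sumdisc (R : realType) (lam : int) (P Q n : nat) : R :=
  \sum_(P.+1 <= d < Q.+1 | prime d) disc R lam d n.

Lemma sum_primes_const_le (R : realType) (P Q : nat) (f : nat -> R) (c : R) : 0 <= c ->
  (forall d, prime d -> (P < d)%N -> `|f d| <= c) ->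
  `|\sum_(P.+1 <= d < Q.+1 | prime d) f d| <= Q%:R * c.
Proof.
move=> c0 hf; apply: (le_trans (ler_norm_sum _ _ _)).
apply: (@le_trans _ _ (\sum_(P.+1 <= d < Q.+1) c)).
  rewrite big_mkcond; apply: ler_sum_nat => d /andP[Pd _].
  by case: ifP => // pd; exact: hf.
rewrite sumr_const_nat subSS -[leLHS]mulr_natl; apply: ler_wpM2r => //.
by rewrite ler_nat leq_subr.
Qed.

Lemma ln_nat_mono (R : realType) (m n : nat) : (0 < m <= n)%N -> 0 <= ln (m%:R : R) <= ln n%:R.
Proof.
move=> /andP[m0 mn]; rewrite ln_ge0 ?ler1n //= ler_ln ?posrE ?ltr0n ?ler_nat //.
exact: leq_trans mn.
Qed.

Lemma sum_cutoff (R : realType) (N m : nat) (g D : nat -> R) : (0 < m)%N ->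
  \sum_(1 <= c < N.+1) g c * (if (m * c <= N)%N then D (m * c)%N else 0) =
  \sum_(1 <= c < (N %/ m).+1) g c * D (m * c)%N.
Proof.
move=> m0; rewrite (big_cat_nat (n := (N %/ m).+1)) ?ltnS ?leq_div //=.
rewrite [X in _ + X]big_nat_cond [X in _ + X]big1 ?addr0 => [|c]; last first.
  rewrite andbT => /andP[h _]; rewrite ifF ?mulr0 //.
  by apply/negbTE; rewrite mulnC -leq_divRL // -ltnNge.
by apply: eq_big_nat => c /andP[_ h]; rewrite mulnC -leq_divRL // -ltnS h.
Qed.

Section TypeOne.
Context (R : realType) (lam : int) (P Q N : nat).
Hypothesis hP : forall d, prime d -> (P < d)%N -> ~~ (d%:Z %| lam)%Z.
Let D := sumdisc R lam P Q.
(** The cutoff supplies the vanishing beyond [N] that Vaughan's identity asks for. *)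
Let F n := if (n <= N)%N then D n else 0.

Lemma sum_sumdisc_le m : (0 < m)%N -> `|\sum_(1 <= l < N.+1) F (m * l)| <= Q%:R.
Proof.
move=> m0; have := @sum_cutoff R N m (fun=> 1) D m0.
under eq_bigr do rewrite mul1r; under [X in _ = X -> _]eq_bigr do rewrite mul1r.
rewrite -/F => ->; rewrite /D /sumdisc exchange_big /= -[leRHS]mulr1.
by apply: sum_primes_const_le => // d pd Pd; apply: disc_sum_le => //; exact: hP.
Qed.

Lemma sum_ln_sumdisc_le m : (0 < m)%N -> (0 < N)%N ->
  `|\sum_(1 <= l < N.+1) ln l%:R * F (m * l)| <= Q%:R * (2 * ln N%:R).
Proof.
move=> m0 N0; rewrite /F sum_cutoff // /D /sumdisc.
have lN : 0 <= ln N%:R :> R by rewrite ln_ge0 // ler1n.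
under eq_bigr do rewrite mulr_sumr.
rewrite exchange_big /=; apply: sum_primes_const_le => [|d pd Pd]; first by rewrite mulr_ge0.
case: (posnP (N %/ m)) => [->|K0]; first by rewrite big_geq // normr0 mulr_ge0.
apply: (@le_trans _ _ (2 * 1 * ln (N %/ m)%:R)); last first.
  rewrite mulr1 ler_wpM2l //; have := @ln_nat_mono R (N %/ m) N.
  by rewrite K0 leq_div => /(_ isT) /andP[].
apply: (@abel_sum_le R (fun c => ln c%:R) (fun c => disc R lam d (m * c))) => //.
  by move=> k; apply: disc_sum_le => //; exact: hP.
by move=> k k0; apply: ln_nat_mono; rewrite k0 /=.
Qed.

Lemma type_one_ln_le V : (0 < N)%N -> (V <= N)%N ->
  `|\sum_(1 <= b < N.+1) moebius_trunc R V b * \sum_(1 <= c < N.+1) ln c%:R * F (b * c)| <=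
  V%:R * (Q%:R * (2 * ln N%:R)).
Proof.
move=> N0 VN.
have lN : 0 <= Q%:R * (2 * ln N%:R) :> R by rewrite !mulr_ge0 // ln_ge0 // ler1n.
apply: (le_trans (ler_norm_sum _ _ _)).
apply: (@le_trans _ _ (\sum_(1 <= b < V.+1) Q%:R * (2 * ln N%:R))); last first.
  by rewrite sumr_const_nat subSS subn0 -[leLHS]mulr_natl.
rewrite (big_cat_nat (n := V.+1)) //= [X in _ + X]big_nat_cond [X in _ + X]big1 ?addr0.
  apply: ler_sum_nat => b /andP[b0 bV]; rewrite normrM -[leRHS]mul1r.
  apply: ler_pM => //; last exact: sum_ln_sumdisc_le.
  by rewrite /moebius_trunc; case: ifP => _; rewrite ?normr0 // norm_moebius_le1.
by move=> b; rewrite andbT => /andP[h _]; rewrite /moebius_trunc leqNgt h mul0r normr0.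
Qed.

(** Each product [m * b] acts as one multiplier, so the innermost sum is at most [Q]. With
    multipliers up to $UV\le x^{1/4}$ and $Q\le x^{1/2}$ this trivial summation still saves a power
    of x. *)
Lemma type_one_le U V : (0 < N)%N -> (U <= N)%N -> (V <= N)%N ->
  `|\sum_(1 <= m < U.+1) mangoldt R m * \sum_(1 <= b < N.+1) moebius_trunc R V b *
     \sum_(1 <= l < N.+1) F (m * (b * l))| <= U%:R * (ln N%:R * (V%:R * Q%:R)).
Proof.
move=> N0 UN VN.
have lN : 0 <= ln N%:R :> R by rewrite ln_ge0 // ler1n.
apply: (le_trans (ler_norm_sum _ _ _)).
apply: (@le_trans _ _ (\sum_(1 <= m < U.+1) ln N%:R * (V%:R * Q%:R))); last first.
  by rewrite sumr_const_nat subSS subn0 -[leLHS]mulr_natl.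
apply: ler_sum_nat => m /andP[m0 mU]; rewrite normrM; apply: ler_pM => //.
  rewrite ger0_norm ?mangoldt_ge0 //; apply: (le_trans (mangoldt_le_ln R m0)).
  have := @ln_nat_mono R m N; rewrite m0 (leq_trans _ UN) // => /(_ isT) /andP[] //.
apply: (le_trans (ler_norm_sum _ _ _)).
apply: (@le_trans _ _ (\sum_(1 <= b < V.+1) Q%:R)); last first.
  by rewrite sumr_const_nat subSS subn0 -[leLHS]mulr_natl.
rewrite (big_cat_nat (n := V.+1)) //= [X in _ + X]big_nat_cond [X in _ + X]big1 ?addr0.
  apply: ler_sum_nat => b /andP[b0 bV]; rewrite normrM -[leRHS]mul1r.
  apply: ler_pM => //.
    by rewrite /moebius_trunc; case: ifP => _; rewrite ?normr0 // norm_moebius_le1.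
  under eq_bigr do rewrite mulnA.
  by apply: sum_sumdisc_le; rewrite muln_gt0 m0.
by move=> b; rewrite andbT => /andP[h _]; rewrite /moebius_trunc leqNgt h mul0r normr0.
Qed.

Lemma small_mangoldt_le U : (0 < N)%N -> (U <= N)%N ->
  `|\sum_(1 <= m < U.+1) mangoldt R m * F m| <= U%:R * (ln N%:R * Q%:R).
Proof.
move=> N0 UN.
have lN : 0 <= ln N%:R :> R by rewrite ln_ge0 // ler1n.
apply: (le_trans (ler_norm_sum _ _ _)).
apply: (@le_trans _ _ (\sum_(1 <= m < U.+1) ln N%:R * Q%:R)); last first.
  by rewrite sumr_const_nat subSS subn0 -[leLHS]mulr_natl.
apply: ler_sum_nat => m /andP[m0 mU]; rewrite normrM; apply: ler_pM => //.
  rewrite ger0_norm ?mangoldt_ge0 //; apply: (le_trans (mangoldt_le_ln R m0)).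
  have := @ln_nat_mono R m N; rewrite m0 (leq_trans _ UN) // => /(_ isT) /andP[] //.
rewrite /F; case: ifP => _; last by rewrite normr0.
rewrite -[leRHS]mulr1; apply: sum_primes_const_le => // d pd _.
exact: norm_disc_le1.
Qed.
End TypeOne.

(** * Type II sums *)

Lemma sum_itv_mkcond (R : realType) (m n n' : nat) (g : nat -> R) : (n <= n')%N ->
  \sum_(m <= k < n) g k = \sum_(0 <= k < n') (if (m <= k < n)%N then g k else 0).
Proof.
move=> nn; rewrite (big_nat_widenl m 0) // (big_nat_widen _ _ _ _ _ nn) big_mkcond /=.
by apply: eq_bigr => k _; rewrite /=.
Qed.

Lemma sum_dyadic (R : realType) (T : nat) (g : nat -> R) : g 0%N = 0 ->
  \sum_(0 <= m < 2 ^ T) g m =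
  \sum_(0 <= i < T) \sum_(0 <= m < 2 ^ i.+1) (if (2 ^ i <= m)%N then g m else 0).
Proof.
move=> g0; elim: T => [|T IH]; first by rewrite expn0 big_nat1 big_geq.
rewrite big_nat_recr //= -IH (big_cat_nat (n := (2 ^ T)%N)) ?leq_exp2l //=.
congr (_ + _); rewrite (sum_itv_mkcond _ _ (leqnn (2 ^ T.+1))) //.
by apply: eq_big_nat => k /andP[_ ->]; rewrite andbT.
Qed.

(** Here [q] stands for $Q^2$, [v] for the lower limit [V] of both variables, [L] and [H] for
    logarithmic factors. From $mk\le 2n$ and $m,k\ge v$ both lengths are at most $2n/v$, which
    controls the cross term $q(m+k)$. *)
Lemma type_two_arith (R : realType) (m k q n v L H : R) :
  0 < v -> v <= m -> v <= k -> 1 <= k -> 0 <= q -> m * k <= 2 * n ->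
  0 <= n -> 0 <= L -> 0 <= H ->
  (m + q) * (k + 1 + q) * (m * L) * (k * H) <= 16 * n * (n + q * n / v + q ^+ 2) * L * H.
Proof.
move=> v0 vm vk k1 q0 mk n0 L0 H0.
have m0 : 0 < m by lra.
have k0 : 0 < k by lra.
have mv : m <= 2 * (n / v).
  by rewrite mulrA ler_pdivlMr //; apply: le_trans mk; apply: ler_wpM2l => //; exact: ltW.
have kv : k <= 2 * (n / v).
  rewrite mulrA ler_pdivlMr //; apply: le_trans mk; rewrite [leRHS]mulrC.
  by apply: ler_wpM2l => //; exact: ltW.
rewrite -mulrA; set y := n / v in mv kv *.
have -> : q * n / v = q * y by rewrite mulrA.
have y0 : 0 <= y by rewrite divr_ge0 // ltW.
have e1 : (m + q) * (k + 1 + q) <= 4 * n + 8 * (q * y) + 2 * q ^+ 2.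
  apply: (@le_trans _ _ (2 * (m * k + q * (m + k) + q ^+ 2))).
    have : (m + q) * (k + 1 + q) <= (m + q) * (2 * (k + q)) by apply: ler_wpM2l; lra.
    by move/le_trans; apply; rewrite le_eqVlt; apply/orP; left; apply/eqP; ring.
  have : q * (m + k) <= q * (4 * y) by apply: ler_wpM2l; lra.
  lra.
have -> : m * L * (k * H) = m * k * (L * H) by ring.
have -> : 16 * n * (n + q * y + q ^+ 2) * L * H =
   8 * (n + q * y + q ^+ 2) * (2 * n * (L * H)) by ring.
have qy : 0 <= q * y by rewrite mulr_ge0.
have q2 : 0 <= q ^+ 2 by rewrite sqr_ge0.
apply: ler_pM.
- by rewrite mulr_ge0 //; lra.
- by rewrite !mulr_ge0 // ltW.
- lra.
- by apply: ler_wpM2r => //; rewrite mulr_ge0.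
Qed.

Section TypeTwo.
Context (R : realType) (lam : int) (P Q N V T : nat).
Hypothesis hP : forall d, prime d -> (P < d)%N -> ~~ (d%:Z %| lam)%Z.
Hypothesis (P0 : (0 < P)%N) (V0 : (0 < V)%N) (VN : (V <= N)%N) (NT : (N < 2 ^ T)%N).
Let D := sumdisc R lam P Q.
Let F n := if (n <= N)%N then D n else 0.
(** The squared bound for one dyadic block. The three summands are those of $(m+Q^2)(k+Q^2)$; the
    logarithms come from the mean squares of [mangoldt] and of [vaughan_coef]. *)
Let W : R := 160 ^+ 2 * (16 * N%:R * (N%:R + Q%:R ^+ 2 * N%:R / V%:R + (Q%:R ^+ 2) ^+ 2) *
   (ln N%:R) ^+ 2 * (1 + ln N%:R) ^+ 3) / P%:R ^+ 2.

Lemma type_two_block_le (i : nat) :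
  `|\sum_(0 <= m < 2 ^ i.+1) (if (2 ^ i <= m)%N && (V < m <= N)%N then
      mangoldt R m * \sum_(V.+1 <= k < N.+1) vaughan_coef R V k * F (m * k)%N else 0)| <=
  T.+1%:R * Num.sqrt W.
Proof.
have N0 : (0 < N)%N by apply: leq_trans VN.
have N0' : 0 < N%:R :> R by rewrite ltr0n.
have V0' : 0 < V%:R :> R by rewrite ltr0n.
have P0' : 0 < P%:R :> R by rewrite ltr0n.
have lN : 0 <= ln N%:R :> R by rewrite ln_ge0 // ler1n.
have lV : 0 <= ln (V%:R : R) <= ln N%:R by apply: ln_nat_mono; rewrite V0.
have W0 : 0 <= W.
  have h1 : 0 <= N%:R + Q%:R ^+ 2 * N%:R / V%:R + (Q%:R ^+ 2) ^+ 2 :> R.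
    by rewrite !addr_ge0 ?sqr_ge0 // divr_ge0 // mulr_ge0 // sqr_ge0.
  have h2 : 0 <= (1 + ln N%:R) ^+ 3 :> R by rewrite exprn_ge0 // addr_ge0.
  apply: divr_ge0; last exact: sqr_ge0.
  apply: mulr_ge0; first exact: sqr_ge0.
  apply: mulr_ge0 => //; apply: mulr_ge0; last exact: sqr_ge0.
  by apply: mulr_ge0 => //; rewrite mulr_ge0.
pose a m := if (2 ^ i <= m)%N && (V < m <= N)%N then mangoldt R m else 0.
pose b k := if (V < k)%N then vaughan_coef R V k else 0.
(* The truncation is strict, so the graph lies one above the last admissible k. Over the block
   [m >= 2 ^ i] it stays within [K'.+1]. *)
pose f m := (N %/ m).+1.
pose K' := (N %/ 2 ^ i)%N.
have p2 : (0 < 2 ^ i)%N by rewrite expn_gt0.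
have -> : \sum_(0 <= m < 2 ^ i.+1) (if (2 ^ i <= m)%N && (V < m <= N)%N then
      mangoldt R m * \sum_(V.+1 <= k < N.+1) vaughan_coef R V k * F (m * k)%N else 0) =
   \sum_(0 <= m < 2 ^ i.+1) \sum_(0 <= k < K'.+1 | (k < f m)%N) a m * b k * D (m * k)%N.
  apply: eq_bigr => m _; rewrite /a; case: ifP; last first.
    by move=> _; rewrite big1 // => k _; rewrite !mul0r.
  move=> /andP[h1 /andP[h2 h3]]; have m0 : (0 < m)%N by apply: leq_trans h2.
  have fK : (f m <= K'.+1)%N by rewrite /f ltnS leq_div2l.
  have fN : (f m <= N.+1)%N by rewrite ltnS leq_div.
  rewrite (sum_itv_mkcond _ _ (leqnn N.+1)) mulr_sumr.
  have -> : \sum_(0 <= k < K'.+1 | (k < f m)%N) mangoldt R m * b k * D (m * k)%N =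
      \sum_(0 <= k < f m) mangoldt R m * b k * D (m * k)%N.
    by rewrite [RHS](big_nat_widen _ _ _ _ _ fK).
  rewrite [RHS](big_nat_widen _ _ _ _ _ fN) /= [RHS]big_mkcond.
  apply: eq_big_nat => k /andP[_ kN]; rewrite kN andbT /F /b ltnS leq_divRL // mulnC.
  by case: ifP => _; case: ifP => _; rewrite ?mulr0 ?mul0r // mulrA.
have hf m : (f m <= 2 ^ T)%N by apply: leq_ltn_trans NT; exact: leq_div.
pose C : R := 160 ^+ 2 * ((2 ^ i.+1)%:R + Q%:R ^+ 2) * (K'.+1%:R + Q%:R ^+ 2) / P%:R ^+ 2.
have C0 : 0 <= C.
  by rewrite /C divr_ge0 ?sqr_ge0 // !mulr_ge0 ?sqr_ge0 // addr_ge0 ?sqr_ge0.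
have := @triangular_truncation R (fun m k => D (m * k)%N) C (2 ^ i.+1) K'.+1 T f a b C0
  (fun a b => sum_primes_bilinear_disc_le Q _ _ a b P0 hP) hf.
set S := \sum_(0 <= m < 2 ^ i.+1) _; set A := \sum_(0 <= m < _) a m ^+ 2.
set B := \sum_(0 <= k < _) b k ^+ 2 => hS.
suff CAB : C * A * B <= W.
  rewrite -(@ler_pXn2r R 2) ?nnegrE ?mulr_ge0 ?sqrtr_ge0 // real_normK ?num_real //.
  rewrite exprMn sqr_sqrtr //; apply: (le_trans hS).
  have -> : T.+1%:R ^+ 2 * C * A * B = T.+1%:R ^+ 2 * (C * A * B) by rewrite !mulrA.
  by apply: ler_wpM2l => //; exact: sqr_ge0.
(* A block whose m or k cannot exceed [V] is empty; otherwise both lengths exceed [V], as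
   [type_two_arith] requires. *)
case: (leqP (2 ^ i.+1) V) => [iV|Vi].
  rewrite (_ : A = 0) ?mulr0 ?mul0r //; rewrite /A big_nat_cond big1 // => m.
  rewrite andbT => /andP[_ mi]; rewrite /a ifF ?expr0n //.
  by apply/negbTE; rewrite negb_and negb_and -leqNgt (leq_trans (ltnW mi) iV) orbT.
case: (leqP K' V) => [KV|VK].
  rewrite (_ : B = 0) ?mulr0 //; rewrite /B big_nat_cond big1 // => k.
  rewrite andbT => /andP[_ ki]; rewrite /b ltnNge (leq_trans _ KV) ?expr0n //.
have Ale : A <= (2 ^ i.+1)%:R * (ln N%:R) ^+ 2.
  apply: (@le_trans _ _ (\sum_(0 <= m < 2 ^ i.+1) (ln N%:R) ^+ 2)).
    apply: ler_sum => m _; rewrite /a; case: ifP => h; last by rewrite expr0n sqr_ge0.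
    have /andP[_ /andP[Vm mN]] := h.
    rewrite lerXn2r ?nnegrE ?mangoldt_ge0 //.
    have m0 : (0 < m)%N by apply: leq_trans Vm.
    apply: (le_trans (mangoldt_le_ln R m0)).
    by have /andP[] : 0 <= ln (m%:R : R) <= ln N%:R by apply: ln_nat_mono; rewrite m0.
  by rewrite sumr_const_nat subn0 -[leLHS]mulr_natl.
have Ble : B <= K'%:R * (1 + ln N%:R) ^+ 3.
  rewrite /B big_ltn // {1}/b ltn0 expr0n add0r.
  apply: (@le_trans _ _ (\sum_(1 <= k < K'.+1) vaughan_coef R V k ^+ 2)).
    apply: ler_sum => k _; rewrite /b; case: ifP => // _; by rewrite expr0n sqr_ge0.
  apply: (le_trans (sum_sqr_vaughan_coef_le R K' V0)).
  apply: ler_wpM2l => //; have /andP[l1 l2] := lV.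
  by rewrite lerXn2r ?nnegrE ?addr_ge0 // lerD2l.
have A0 : 0 <= A by apply: sumr_ge0 => m _; rewrite sqr_ge0.
have B0 : 0 <= B by apply: sumr_ge0 => m _; rewrite sqr_ge0.
apply: (@le_trans _ _ (C * ((2 ^ i.+1)%:R * (ln N%:R) ^+ 2) * (K'%:R * (1 + ln N%:R) ^+ 3))).
  by apply: ler_pM; rewrite ?mulr_ge0 //; apply: ler_wpM2l.
have K1 : (0 < K')%N by apply: leq_ltn_trans VK.
have mK : (2 ^ i.+1)%:R * K'%:R <= 2 * N%:R :> R.
  by rewrite -!natrM ler_nat expnS -mulnA leq_mul2l /= mulnC leq_divM.
have := @type_two_arith R (2 ^ i.+1)%:R K'%:R (Q%:R ^+ 2) N%:R V%:R
  ((ln N%:R) ^+ 2) ((1 + ln N%:R) ^+ 3) V0'.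
rewrite !ler_nat => /(_ (ltnW Vi) (ltnW VK)); rewrite ler1n.
move=> /(_ K1 (sqr_ge0 _) mK (ler0n _ _) (sqr_ge0 _)).
move=> /(_ (exprn_ge0 _ (addr_ge0 ler01 lN))) h.
rewrite /C /W; set c : R := 160 ^+ 2.
have c0 : 0 <= c by exact: sqr_ge0.
have -> : c * ((2 ^ i.+1)%:R + Q%:R ^+ 2) * (K'.+1%:R + Q%:R ^+ 2) / P%:R ^+ 2 *
    ((2 ^ i.+1)%:R * ln N%:R ^+ 2) * (K'%:R * (1 + ln N%:R) ^+ 3) =
  c * (((2 ^ i.+1)%:R + Q%:R ^+ 2) * (K'%:R + 1 + Q%:R ^+ 2) *
    ((2 ^ i.+1)%:R * ln N%:R ^+ 2) * (K'%:R * (1 + ln N%:R) ^+ 3)) / P%:R ^+ 2.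
  by rewrite -[K'.+1%:R]natr1; set x := (2 ^ i.+1)%:R; field; rewrite gt_eqF.
by apply: ler_wpM2r; [rewrite invr_ge0 sqr_ge0 | exact: ler_wpM2l].
Qed.

Lemma type_two_le :
  `|\sum_(V.+1 <= m < N.+1) mangoldt R m *
     \sum_(V.+1 <= k < N.+1) vaughan_coef R V k * F (m * k)%N| <=
  T%:R * (T.+1%:R * Num.sqrt W).
Proof.
rewrite (sum_itv_mkcond V.+1 _ NT) sum_dyadic //.
apply: (le_trans (ler_norm_sum _ _ _)).
apply: (@le_trans _ _ (\sum_(0 <= i < T) T.+1%:R * Num.sqrt W)); last first.
  by rewrite sumr_const_nat subn0 -[leLHS]mulr_natl.
apply: ler_sum => i _; apply: le_trans (type_two_block_le i).
rewrite le_eqVlt; apply/orP; left; apply/eqP; congr `|_|.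
by apply: eq_bigr => m _; case: ifP.
Qed.

(* A Bombieri-Vinogradov estimate for prime moduli. *)
Lemma sum_mangoldt_sumdisc_le :
  `|\sum_(1 <= n < N.+1) mangoldt R n * sumdisc R lam P Q n| <=
  V%:R * (ln N%:R * Q%:R) + V%:R * (Q%:R * (2 * ln N%:R)) +
  V%:R * (ln N%:R * (V%:R * Q%:R)) + T%:R * (T.+1%:R * Num.sqrt W).
Proof.
have N0 : (0 < N)%N by apply: leq_trans VN.
have F0 n : (N < n)%N -> F n = 0 by rewrite /F ltnNge => /negbTE ->.
have -> : \sum_(1 <= n < N.+1) mangoldt R n * sumdisc R lam P Q n =
    \sum_(1 <= n < N.+1) mangoldt R n * F n.
  by apply: eq_big_nat => n /andP[_]; rewrite ltnS /F => ->.
(* Both cut points of the identity are taken to be [V]; the initial segment n <= V, which the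
   identity does not cover, is bounded trivially. *)
rewrite (big_cat_nat (n := V.+1)) //= (@vaughan R N V V F F0 VN) ?V0 //.
have h1 := small_mangoldt_le R lam P Q N0 VN.
have h2 := type_one_ln_le R Q hP N0 VN.
have h3 := type_one_le R Q hP N0 VN VN.
have h4 := type_two_le.
rewrite -/F in h1 h2 h3.
set s1 := \sum_(1 <= m < V.+1) mangoldt R m * F m in h1 *.
set s2 := \sum_(1 <= b < N.+1) _ in h2 *.
set s3 := \sum_(1 <= m < V.+1) _ in h3 *.
set s4 := \sum_(V.+1 <= m < N.+1) _ in h4 *.
have -> : s1 + (s2 - s3 - s4) = (s1 + s2) - s3 - s4 by rewrite !addrA.
apply: (le_trans (ler_normB _ _)); apply: lerD => //.
apply: (le_trans (ler_normB _ _)); apply: lerD => //.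
by apply: (le_trans (ler_normD _ _)); apply: lerD.
Qed.
End TypeTwo.

(** * Counting shifted primes *)

Definition omega (lam : int) (P Q n : nat) : nat :=
  (\sum_(P.+1 <= d < Q.+1 | prime d) nat_of_bool (d%:Z %| (n%:Z + lam)%R)%Z)%N.

(* Distinct primes exceeding P and dividing m have their product below m. *)
Lemma omega_le (lam : int) (P Q n m r : nat) : (0 < P)%N -> n%:Z + lam = m%:Z ->
  (0 < m)%N -> (m < P ^ r.+1)%N -> (omega lam P Q n <= r)%N.
Proof.
move=> P0 nm m0 mP.
have P1 : (1 < P)%N.
  by case: P P0 mP => [|[|P]] // _; rewrite exp1n ltnS leqNgt m0.
rewrite -ltnS -(@ltn_exp2l P) //; apply: leq_ltn_trans mP.
rewrite /omega nm.
have -> : (\sum_(P.+1 <= d < Q.+1 | prime d) nat_of_bool (d%:Z %| m%:Z)%Z)%N =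
    (\sum_(0 <= p < m.+1 | [&& P < p < Q.+1, prime p & p %| m]) 1)%N.
  transitivity (\sum_(P.+1 <= d < Q.+1 | prime d && (d %| m)) 1)%N.
    by rewrite big_mkcondr; apply: eq_bigr => d _; rewrite dvdzE /=; case: (_ %| _)%N.
  rewrite -big_filter -[RHS]big_filter; apply: perm_big.
  apply: uniq_perm; rewrite ?filter_uniq ?iota_uniq // => d.
  rewrite !mem_filter !mem_index_iota leq0n /= !ltnS.
  case: (boolP (prime d)) => pd /=; rewrite ?andbF //.
  case: (boolP (d %| m)%N) => dm; rewrite ?andbF //= (dvdn_leq m0 dm).
  by rewrite !andbT.
rewrite expn_sum.
rewrite -[X in (_ <= X)%N](partnT m0) /partn big_mkcond; apply: leq_prod => p _; case: ifP => [/and3P[/andP[Pp _] pp pm]|_].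
  rewrite expn1; apply: leq_trans (ltnW Pp) _; rewrite -{1}(expn1 p) leq_exp2l ?prime_gt1 //.
  by rewrite logn_gt0 mem_primes pp m0.
case: (posnP p) => [->|p0]; last by rewrite expn_gt0 p0.
by rewrite lognE.
Qed.

Lemma omega_leQ (lam : int) (P Q n : nat) : (omega lam P Q n <= Q)%N.
Proof.
apply: (@leq_trans (\sum_(P.+1 <= d < Q.+1) 1)%N).
  by rewrite /omega big_mkcond; apply: leq_sum => d _; case: ifP => // _; case: (_ %| _)%Z.
by rewrite sum_nat_const_nat muln1 subSS leq_subr.
Qed.

Section Count.
Context (R : realType) (lam : int) (P Q N : nat).
Hypothesis hP : forall d, prime d -> (P < d)%N -> ~~ (d%:Z %| lam)%Z.
Hypothesis (P0 : (0 < P)%N) (N0 : (0 < N)%N).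

Let rec_sum : R := \sum_(P.+1 <= d < Q.+1 | prime d) d%:R^-1.

(** [omega] is [sumdisc] plus its expected value, where d has weight $1/(d-1)\ge 1/d$ on the n prime
    to d. The multiples of d remove at most $N\log N/P$ from [psi R N]. *)
Lemma sum_mangoldt_omega_ge :
  rec_sum * (psi R N - N%:R * ln N%:R / P%:R) -
  `|\sum_(1 <= n < N.+1) mangoldt R n * sumdisc R lam P Q n| <=
  \sum_(1 <= n < N.+1) mangoldt R n * (omega lam P Q n)%:R.
Proof.
have P0' : 0 < P%:R :> R by rewrite ltr0n.
set E := \sum_(1 <= n < N.+1) mangoldt R n * sumdisc R lam P Q n.
have lN : 0 <= ln N%:R :> R by rewrite ln_ge0 // ler1n.
have -> : \sum_(1 <= n < N.+1) mangoldt R n * (omega lam P Q n)%:R =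
   E + \sum_(P.+1 <= d < Q.+1 | prime d)
     \sum_(1 <= n < N.+1) mangoldt R n * ((~~ (d %| n)%N)%:R / d.-1%:R).
  rewrite /E exchange_big /= -big_split /=; apply: eq_bigr => n _.
  rewrite -mulr_sumr -mulrDr; congr (_ * _).
  rewrite /sumdisc -big_split /= natr_sum; apply: eq_bigr => d _.
  by rewrite /disc subrK.
rewrite addrC; apply: lerD; first by have := ler_norm (- E); rewrite normrN lerNl.
rewrite /rec_sum mulr_suml big_nat_cond [leRHS]big_nat_cond.
apply: ler_sum => d /andP[/andP[Pd _] pd].
have d1 := prime_gt1 pd.
have d0' : 0 < d%:R :> R by rewrite ltr0n prime_gt0.
have e0' : 0 < d.-1%:R :> R by rewrite ltr0n -ltnS prednK // ltnW.
rewrite ler_pdivrMl //.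
have mult : \sum_(1 <= n < N.+1) mangoldt R n * ((d %| n)%N)%:R <= N%:R * ln N%:R / P%:R.
  apply: (@le_trans _ _ (\sum_(1 <= n < N.+1 | (d %| n)%N) ln N%:R)).
    rewrite [leRHS]big_mkcond; apply: ler_sum_nat => n /andP[n0 nN].
    case: (_ %| _)%N; rewrite ?mulr0 // mulr1; apply: (le_trans (mangoldt_le_ln R n0)).
    by have /andP[] : 0 <= ln (n%:R : R) <= ln N%:R by apply: ln_nat_mono; rewrite n0.
  rewrite sum_multiples ?prime_gt0 //.
  apply: (@le_trans _ _ (ln N%:R * (N %/ d)%:R)).
    rewrite -sum_leq_mul ?prime_gt0 // mulr_sumr big_mkcond; apply: ler_sum => e _.
    by case: ifP; rewrite ?mulr0 ?mulr1.
  rewrite [N%:R * _]mulrC -mulrA; apply: ler_wpM2l => //.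
  rewrite ler_pdivlMr // -natrM ler_nat.
  by apply: leq_trans (leq_divM N d); rewrite leq_mul2l ltnW ?orbT.
apply: (@le_trans _ _ (\sum_(1 <= n < N.+1) mangoldt R n * (~~ (d %| n)%N)%:R)).
  rewrite lerBlDr -lerBlDl; apply: le_trans mult.
  rewrite lerBlDr /psi -big_split /=; apply: ler_sum => n _.
  by case: (_ %| _)%N; rewrite /= ?mulr1 ?mulr0 ?addr0 ?add0r.
rewrite mulr_sumr; apply: ler_sum => n _.
rewrite mulrCA; apply: ler_wpM2l; first exact: mangoldt_ge0.
rewrite mulrCA; apply: ler_peMr => //.
by rewrite ler_pdivlMr // mul1r ler_nat leq_pred.
Qed.

Lemma rec_sum_ge : (1 < Q)%N -> (P <= Q)%N ->
  (ln Q%:R - ln P%:R - 8) / ln Q%:R <= rec_sum.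
Proof.
move=> Q1 PQ; have lQ : 0 < ln Q%:R :> R by rewrite ln_gt0 // ltr1n.
rewrite ler_pdivrMr //; apply: (le_trans (@sum_primes_ln_ge R P Q _)); first by rewrite P0.
rewrite /rec_sum mulr_suml big_nat_cond [leRHS]big_nat_cond.
apply: ler_sum => d /andP[/andP[_ dQ] pd].
rewrite mulrC; apply: ler_wpM2l; first by rewrite invr_ge0.
by have /andP[] : 0 <= ln (d%:R : R) <= ln Q%:R by apply: ln_nat_mono; rewrite prime_gt0.
Qed.

(** Four ranges. Up to [L0] the shift may be nonpositive, possibly 0 and divisible by every d, so
    only [omega] at most [Q] is available. Between [L0] and [L1] the terms are discarded by
    Chebyshev's bound. Above [L1] the proper prime powers are few, and each counted prime weighs at
    most [r * ln N]. *)
Lemma sum_mangoldt_omega_le (r L0 L1 s t : nat) :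
  (forall n, (L0 < n)%N -> (n <= N)%N -> (omega lam P Q n <= r)%N) ->
  (L0 <= L1 <= N)%N -> (N < s.+1 ^ 2)%N -> (N < 2 ^ t.+1)%N ->
  \sum_(1 <= n < N.+1) mangoldt R n * (omega lam P Q n)%:R <=
  L0%:R * ln N%:R * Q%:R + r%:R * (4 * L1%:R) + r%:R * (s%:R * t%:R * ln N%:R) +
  ln N%:R * r%:R *
    (count (fun p => prime p && (0 < omega lam P Q p)%N) (index_iota L1.+1 N.+1))%:R.
Proof.
move=> hr /andP[L01 L1N] hs ht.
have lN : 0 <= ln N%:R :> R by rewrite ln_ge0 // ler1n.
have vmN n : (0 < n <= N)%N -> mangoldt R n <= ln N%:R.
  move=> /andP[n0 nN]; apply: (le_trans (mangoldt_le_ln R n0)).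
  by have /andP[] : 0 <= ln (n%:R : R) <= ln N%:R by apply: ln_nat_mono; rewrite n0.
rewrite (big_cat_nat (n := L1.+1)) //= (big_cat_nat (n := L0.+1) (p := L1.+1)) //= -!addrA.
apply: lerD.
  apply: (@le_trans _ _ (\sum_(1 <= n < L0.+1) ln N%:R * Q%:R)).
    apply: ler_sum_nat => n /andP[n0 nL]; apply: ler_pM; rewrite ?mangoldt_ge0 //.
      by apply: vmN; rewrite n0 /=; apply: leq_trans (leq_trans L01 L1N).
    by rewrite ler_nat omega_leQ.
  by rewrite sumr_const_nat subSS subn0 -[leLHS]mulr_natl mulrA.
apply: lerD.
  apply: (@le_trans _ _ (r%:R * psi R L1)); last by apply: ler_wpM2l => //; exact: psi_le.
  rewrite /psi [in leRHS](big_cat_nat (n := L0.+1)) //= mulrDr; apply: ler_wpDl.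
    by rewrite mulr_ge0 // sumr_ge0 // => n _; exact: mangoldt_ge0.
  rewrite mulr_sumr; apply: ler_sum_nat => n /andP[nL nL1].
  rewrite mulrC; apply: ler_wpM2r; first exact: mangoldt_ge0.
  by rewrite ler_nat hr // (leq_trans _ L1N).
apply: (@le_trans _ _ (\sum_(L1.+1 <= n < N.+1)
     ((if prime n then 0 else r%:R * mangoldt R n) +
      (if prime n && (0 < omega lam P Q n)%N then r%:R * ln N%:R else 0)))).
  apply: ler_sum_nat => n /andP[nL nN].
  have hn : (omega lam P Q n <= r)%N by apply: hr => //; apply: leq_ltn_trans nL.
  case: ifP => pn /=.
    case: (posnP (omega lam P Q n)) => [->|_]; first by rewrite mulr0 addr0.
    rewrite add0r mulrC; apply: ler_pM; rewrite ?mangoldt_ge0 ?ler_nat //.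
    by apply: vmN; rewrite prime_gt0.
  by rewrite addr0 mulrC ler_wpM2r ?mangoldt_ge0 // ler_nat.
rewrite big_split /=; apply: lerD.
  have -> : \sum_(L1.+1 <= i < N.+1) (if prime i then 0 else r%:R * mangoldt R i) =
     r%:R * \sum_(L1.+1 <= i < N.+1) mangoldt R i * (~~ prime i)%:R.
    by rewrite mulr_sumr; apply: eq_bigr => i _; case: (prime i); rewrite ?mulr0 ?mulr1.
  apply: ler_wpM2l => //; apply: le_trans (sum_higher_powers_le R N0 hs ht).
  apply: (@le_trans _ _ (\sum_(1 <= i < N.+1) mangoldt R i * (~~ prime i)%:R)).
    rewrite [leRHS](big_cat_nat (n := L1.+1)) //= ler_wpDl // sumr_ge0 // => i _.
    by rewrite mulr_ge0 ?mangoldt_ge0.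
  rewrite sum_mangoldt; apply: ler_sum => p pp.
  rewrite [leLHS]big_mkcond big_ltn // expn1 pp /= mulr0n mulr0 if_same add0r -big_mkcond.
  apply: ler_sum => k _; rewrite -[leRHS]mulr1; apply: ler_wpM2l.
    exact: ln_prime_ge0.
  by case: (~~ _).
rewrite -big_mkcond big_const_seq iter_addr_0 -[leLHS]mulr_natr.
by rewrite (mulrC r%:R).
Qed.
End Count.

(** * Choice of parameters *)

Lemma truncn_half_le (R : realType) (y : R) : 2 <= y ->
  y / 2 <= (Num.truncn y)%:R <= y.
Proof.
move=> y2; have y0 : 0 <= y by lra.
have /andP[h1 h2] := truncn_itv y0.
rewrite h1 andbT; move: h2; rewrite -natr1; lra.
Qed.

Lemma powR_add (R : realType) (x r s : R) : 0 < x -> x `^ (r + s) = x `^ r * x `^ s.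
Proof. by move=> x0; rewrite powRD // (gt_eqF x0) implybT. Qed.

(** The three upper bounds on [sg] say that N, Q^2 N / V and Q^4, multiplied by N / P^2, are each at
    most a constant times $x^{2-2\sigma}$. Truncation constants add up to 4 + 8 + 4 = 16, so the
    square root of 16 times 16 is exact. *)
Lemma type_two_sqrt_le (R : realType) (x a1 b1 sg : R) (P Q V N : nat) :
  1 <= x -> x `^ a1 / 2 <= P%:R -> Q%:R <= x `^ b1 -> x `^ 8^-1 / 2 <= V%:R ->
  (0 < N)%N -> N%:R <= x -> sg <= a1 -> sg <= 16^-1 - (b1 - a1) -> sg <= 2^-1 - (b1 + b1 - a1) ->
  Num.sqrt (160 ^+ 2 * (16 * N%:R * (N%:R + Q%:R ^+ 2 * N%:R / V%:R + (Q%:R ^+ 2) ^+ 2) *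
   (ln N%:R) ^+ 2 * (1 + ln N%:R) ^+ 3) / P%:R ^+ 2) <=
  160 * 16 * (x `^ (1 - sg) * (1 + ln x) ^+ 3).
Proof.
move=> x1 hP hQ hV N0 hN s1 s2 s3.
have x0 : 0 < x by lra.
have pw e : 0 < x `^ e by exact: powR_gt0.
have l0 : 0 <= ln x by exact: ln_ge0.
have lN0 : 0 <= ln N%:R :> R by rewrite ln_ge0 // ler1n.
have lNx : ln N%:R <= ln x by rewrite ler_ln ?posrE ?ltr0n.
set y := 1 + ln x; have y1 : 1 <= y by rewrite lerDl.
have y0 : 0 <= y by lra.
have rhs0 : 0 <= 160 * 16 * (x `^ (1 - sg) * y ^+ 3).
  by rewrite !mulr_ge0 ?powR_ge0 ?exprn_ge0.
rewrite -(ger0_norm rhs0) -sqrtr_sqr; apply: ler_wsqrtr.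
have P0 : 0 < P%:R :> R by apply: lt_le_trans hP; rewrite divr_gt0.
have V0 : 0 < V%:R :> R by apply: lt_le_trans hV; rewrite divr_gt0.
pose A : R := N%:R + Q%:R ^+ 2 * N%:R / V%:R + (Q%:R ^+ 2) ^+ 2.
have Q2 : Q%:R ^+ 2 <= x `^ (b1 + b1).
  by rewrite powR_add // -expr2 lerXn2r ?nnegrE ?powR_ge0.
have Q4 : (Q%:R ^+ 2) ^+ 2 <= x `^ (b1 + b1 + (b1 + b1)).
  by rewrite (powR_add _ (b1 + b1)) // -expr2 lerXn2r ?nnegrE ?sqr_ge0 ?powR_ge0.
have iV : V%:R^-1 <= 2 * x `^ (- 8^-1).
  rewrite powRN -ler_pdivrMl // -invfM; apply: le_trans (_ : (x `^ 8^-1)^-1 <= _) => //.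
  by rewrite lef_pV2 ?posrE ?mulr_gt0 //; move: hV; lra.
have iP : (P%:R ^+ 2)^-1 <= 4 * x `^ (- (a1 + a1)).
  rewrite powRN powR_add // -expr2 -ler_pdivrMl // -invfM lef_pV2 ?posrE ?mulr_gt0 ?exprn_gt0 //.
  have : (x `^ a1 / 2) ^+ 2 <= P%:R ^+ 2 by rewrite lerXn2r ?nnegrE // ltW // divr_gt0.
  by rewrite exprMn exprVn; lra.
have hA : A <= x `^ 1 + 2 * x `^ (b1 + b1 + 1 - 8^-1) + x `^ (b1 + b1 + (b1 + b1)).
  rewrite /A; apply: lerD => //; apply: lerD; first by rewrite powRr1 // ltW.
  rewrite (powR_add _ (- 8^-1)) // (powR_add _ 1) // (powRr1 (ltW x0)) mulrCA.
  by apply: ler_pM; rewrite ?mulr_ge0 ?sqr_ge0 ?invr_ge0 //; apply: ler_pM; rewrite ?sqr_ge0.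
have A0 : 0 <= A by rewrite !addr_ge0 ?divr_ge0 ?mulr_ge0 ?sqr_ge0.
have key : N%:R * A / P%:R ^+ 2 <= 16 * x `^ (1 - sg) ^+ 2.
  apply: (@le_trans _ _ (x `^ 1 * (x `^ 1 + 2 * x `^ (b1 + b1 + 1 - 8^-1) +
      x `^ (b1 + b1 + (b1 + b1))) * (4 * x `^ (- (a1 + a1))))).
    apply: ler_pM; rewrite ?mulr_ge0 ?invr_ge0 ?sqr_ge0 //.
    by apply: ler_pM; rewrite // powRr1 // ltW.
  have E e : e + (1 - (a1 + a1)) <= (1 - sg) + (1 - sg) ->
      x `^ 1 * x `^ e * x `^ (- (a1 + a1)) <= x `^ (1 - sg) ^+ 2.
    by move=> h; rewrite expr2 -!powR_add //; apply: ler_powR => //; lra.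
  have e1 := E 1 _; have e2 := E (b1 + b1 + 1 - 8^-1) _; have e3 := E (b1 + b1 + (b1 + b1)) _.
  have {}e1 : x `^ 1 * x `^ 1 * x `^ (- (a1 + a1)) <= x `^ (1 - sg) ^+ 2 by apply: e1; lra.
  have {}e2 : x `^ 1 * x `^ (b1 + b1 + 1 - 8^-1) * x `^ (- (a1 + a1)) <= x `^ (1 - sg) ^+ 2
    by apply: e2; lra.
  have {}e3 : x `^ 1 * x `^ (b1 + b1 + (b1 + b1)) * x `^ (- (a1 + a1)) <= x `^ (1 - sg) ^+ 2
    by apply: e3; lra.
  rewrite !mulrDr !mulrDl; move: e1 e2 e3; clear; lra.
have ll : ln N%:R ^+ 2 * (1 + ln N%:R) ^+ 3 <= y ^+ 3 ^+ 2.
  apply: (@le_trans _ _ (y ^+ 2 * y ^+ 3)).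
    by apply: ler_pM; rewrite ?exprn_ge0 ?addr_ge0 // lerXn2r ?nnegrE ?addr_ge0 //;
      rewrite /y; lra.
  by rewrite -exprD -exprM ler_weXn2l.
have -> : 160 ^+ 2 * (16 * N%:R * A * ln N%:R ^+ 2 * (1 + ln N%:R) ^+ 3) / P%:R ^+ 2 =
   160 ^+ 2 * 16 * ((N%:R * A / P%:R ^+ 2) * (ln N%:R ^+ 2 * (1 + ln N%:R) ^+ 3)) by ring.
have -> : (160 * 16 * (x `^ (1 - sg) * y ^+ 3)) ^+ 2 =
  160 ^+ 2 * 16 * ((16 * x `^ (1 - sg) ^+ 2) * y ^+ 3 ^+ 2) by ring.
apply: ler_wpM2l; first by rewrite mulr_ge0 ?sqr_ge0.
by apply: ler_pM; rewrite ?divr_ge0 ?mulr_ge0 ?sqr_ge0 ?exprn_ge0 ?addr_ge0.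
Qed.

Lemma trunc_log2_le (R : realType) (N : nat) : (0 < N)%N ->
  (trunc_log 2 N)%:R <= 2 * ln N%:R :> R.
Proof.
move=> N0; have /andP[h _] := @trunc_log_bounds 2 N isT N0.
have : ln (2 ^ trunc_log 2 N)%:R <= ln N%:R :> R.
  by rewrite ler_ln ?posrE ?ltr0n ?expn_gt0 // ler_nat.
rewrite natrX lnXn // -[leLHS]mulr_natl; have /andP[l2 _] := ln2_bounds R.
have : 0 <= (trunc_log 2 N)%:R :> R by [].
nra.
Qed.

(** Collects the coefficients of $x^{1-\sigma}(1+\log x)^5$: 4 for the initial segment and type I
    sums, 4 times 160 times 16 for type II, then the ranges up to [L0] and [L1], and the proper
    prime powers. *)
Definition err_const (R : realType) (L0 r : nat) : R :=
  4 + 4 * (160 * 16) + L0%:R + 4 * r%:R * (1 + L0%:R) + 2 * r%:R.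

(** The whole comparison at one fixed x: every inequality that holds only for large x is an explicit
    hypothesis, so that all limits are taken at the very end. *)
Lemma count_at_ge (R : realType) (lam : int) (a1 b1 sg x : R) (K r L0 P Q V N L1 : nat) :
  L0 = `|lam|%N -> P = Num.truncn (x `^ a1) -> Q = Num.truncn (x `^ b1) ->
  V = Num.truncn (x `^ 8^-1) -> N = (Num.truncn x - L0)%N ->
  L1 = (Num.truncn (x `^ (1 - sg)) + L0)%N ->
  lam != 0 -> (0 < K)%N -> (0 < r)%N ->
  (forall n : nat, (K <= n)%N -> n%:R / K%:R <= psi R n) ->
  0 < a1 -> a1 < b1 -> 0 < sg -> b1 <= 2^-1 ->
  sg <= a1 -> sg <= 16^-1 - (b1 - a1) -> sg <= 2^-1 - (b1 + b1 - a1) ->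
  4 * (K%:R + L0%:R + 1) <= x -> 2 * (L0%:R + 1) <= x `^ a1 ->
  2 <= x `^ 8^-1 -> x < P%:R ^+ r.+1 -> 18 <= (b1 - a1) * ln x ->
  err_const R L0 r * (16 * K%:R) * (1 + ln x) ^+ 5 <= (b1 - a1) * x `^ sg ->
  8 * K%:R * (1 + ln x) ^+ 5 <= x `^ sg ->
  (b1 - a1) / (16 * K%:R * r%:R) * (x / ln x) <=
  (count (fun p => prime p && (0 < omega lam P Q p)%N) (index_iota L1.+1 N.+1))%:R.
Proof.
move=> L0E PE QE VE NE L1E lam0 K0 r0 hK a10 ab sg0 b12 s1 s2 s3 X1 X2 X3 X4 X5 X6 X7.
have L00 : 0 <= L0%:R :> R by [].
have K0' : 1 <= K%:R :> R by rewrite ler1n.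
have r0' : 1 <= r%:R :> R by rewrite ler1n.
have x4 : 4 <= x by lra.
have x1 : 1 <= x by lra.
have x0 : 0 < x by lra.
have pw e : 0 < x `^ e by exact: powR_gt0.
have l0 : 0 < ln x.
  by rewrite ln_gt0 //; lra.
set y := 1 + ln x in X6 X7 *.
have y1 : 1 <= y by rewrite lerDl ltW.
have y0 : 0 <= y by lra.
(* Five logarithms are the worst case: two from the dyadic blocks and the bisection depth, three
   from the square root of the type II bound. *)
set y5 := y ^+ 5 in X6 X7 *.
have y51 : 1 <= y5 by exact: exprn_ege1.
have yy5 : y <= y5 by rewrite -[leLHS]expr1; exact: ler_weXn2l.
have y2y5 : y * y <= y5 by rewrite -expr2; exact: ler_weXn2l.
set z := x `^ (1 - sg).
have z0 : 0 < z by exact: pw.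
have xz : x = z * x `^ sg by rewrite /z -powR_add // subrK powRr1 // ltW.
have pz (e : R) : e <= 1 - sg -> x `^ e <= z by move=> h; exact: ler_powR.
have z1 : 1 <= z by rewrite -(powRr0 x); apply: pz; lra.
have yz0 : 0 <= y5 * z by rewrite mulr_ge0 ?ltW // (lt_le_trans ltr01).
have zy5 : z <= y5 * z by rewrite ler_peMl // ltW.
have xa2 : 2 <= x `^ a1 by lra.
have /andP[P1 P2] := truncn_half_le xa2; rewrite -PE in P1 P2.
have xb2 : 2 <= x `^ b1 by apply: (le_trans xa2); apply: ler_powR => //; exact: ltW.
have /andP[Q1 Q2] := truncn_half_le xb2; rewrite -QE in Q1 Q2.
have /andP[V1 V2] := truncn_half_le X3; rewrite -VE in V1 V2.
have /andP[T1 T2] := truncn_itv (ltW x0).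
have L0t : (L0 <= Num.truncn x)%N by rewrite truncn_ge_nat ?(ltW x0) //; lra.
have NR : N%:R = (Num.truncn x)%:R - L0%:R :> R by rewrite NE natrB.
have N1 : x - 1 - L0%:R <= N%:R by rewrite NR; move: T2; rewrite -natr1; lra.
have N2 : N%:R <= x by rewrite NR; lra.
have Nhalf : x / 2 <= N%:R by lra.
have N0' : 1 <= N%:R :> R by lra.
have N0 : (0 < N)%N by rewrite -(ler1n R).
have P0' : 0 < P%:R :> R by lra.
have P0 : (0 < P)%N by rewrite -(ltr0n R).
have V0 : (0 < V)%N by rewrite -(ltr0n R); lra.
have zx : 8 * z <= x.
  have h1 : 8 * 1 <= 8 * K%:R * y5 by apply: ler_pM => //; move: K0'; clear; lra.
  have h2 : 8 <= x `^ sg by lra.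
  by rewrite [leRHS]xz mulrC ler_wpM2l // ltW.
have VN : (V <= N)%N.
  have : x `^ 8^-1 <= z by apply: pz; lra.
  rewrite -(ler_nat R); move: V2 Nhalf zx z0; clear; lra.
have L1R : L1%:R <= z + L0%:R.
  by rewrite L1E natrD lerD2r; have /andP[] := truncn_itv (ltW z0).
have L1N : (L1 <= N)%N by rewrite -(ler_nat R); move: L1R zx N1 X1 L00 K0'; clear; lra.
have L01 : (L0 <= L1)%N by rewrite L1E leq_addl.
have lN : 0 <= ln (N%:R : R) <= ln x by rewrite ln_ge0 //= ler_ln ?posrE // (lt_le_trans ltr01).
have /andP[lN0 lNx] := lN.
have lNy : ln N%:R <= y by rewrite /y; move: lNx; clear; lra.
have hP d : prime d -> (P < d)%N -> ~~ (d%:Z %| lam)%Z.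
  move=> pd Pd; rewrite dvdzE /= gtnNdvd // ?absz_gt0 //.
  apply: leq_trans Pd; rewrite ltnS -(ler_nat R) -L0E; move: P1 X2; clear; lra.
pose t := trunc_log 2 N.
have tR : t%:R <= 2 * ln N%:R :> R by exact: trunc_log2_le.
have /andP[_ Nt] := @trunc_log_bounds 2 N isT N0; rewrite -/t in Nt.
pose s := Num.truncn (x `^ 2^-1).
have sR : s%:R <= x `^ 2^-1 by have /andP[] := truncn_itv (ltW (pw 2^-1)).
have Ns : (N < s.+1 ^ 2)%N.
  rewrite -(ltr_nat R); apply: (le_lt_trans N2).
  have /andP[_ h] := truncn_itv (ltW (pw 2^-1)); rewrite -/s in h.
  have -> : x = (x `^ 2^-1) ^+ 2.
    by rewrite expr2 -powR_add // -[LHS](powRr1 (ltW x0)); congr (_ `^ _); field.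
  by rewrite natrX ltrXn2r ?nnegrE // ltW.
have hr n : (L0 < n)%N -> (n <= N)%N -> (omega lam P Q n <= r)%N.
  move=> Ln nN; have [m mE] : exists m : nat, n%:Z + lam = m%:Z.
    by exists (`|(n%:Z + lam)%R|%N); rewrite gez0_abs //; move: Ln; rewrite L0E; clear; lia.
  apply: (@omega_le lam P Q n m r P0 mE).
    by move: mE Ln; rewrite L0E; clear; lia.
  rewrite -(ltr_nat R) natrX; apply: le_lt_trans X4; apply: le_trans T1; rewrite ler_nat.
  by move: mE nN L0t; rewrite NE L0E; clear; lia.
have c1 := @sum_mangoldt_omega_ge R lam P Q N P0 N0.
have c2 := @sum_mangoldt_omega_le R lam P Q N N0 r L0 L1 s t hr _ Ns Nt.
rewrite L01 L1N in c2; have {}c2 := c2 isT.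
have c3 := @sum_mangoldt_sumdisc_le R lam P Q N V t.+1 hP P0 V0 VN Nt.
have c4 := @type_two_sqrt_le R x a1 b1 sg P Q V N x1 P1 Q2 V1 N0 N2 s1 s2 s3.
rewrite -/z -/y in c4.
have Q1' : (1 < Q)%N by rewrite QE truncn_ge_nat // ltW.
have PQ : (P <= Q)%N by rewrite PE QE; apply: le_truncn; apply: ler_powR => //; exact: ltW.
have c5 := @rec_sum_ge R P Q P0 Q1' PQ.
move: c1 c2 c3 c4 c5.
set S := \sum_(1 <= n < N.+1) mangoldt R n * (omega lam P Q n)%:R.
set cnt := (count _ _)%:R.
set rs := \sum_(P.+1 <= d < Q.+1 | prime d) d%:R^-1.
set E := `| _ |.
set W := Num.sqrt _ => c1 c2 c3 c4 c5.
have cnt0 : 0 <= cnt by [].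
have W0 : 0 <= W by exact: sqrtr_ge0.
have rs0 : 0 <= rs by apply: sumr_ge0 => d _; rewrite invr_ge0.
have Q0' : 0 < Q%:R :> R by apply: lt_le_trans Q1; rewrite divr_gt0.
have lQ0 : 0 < ln Q%:R :> R by rewrite ln_gt0 // ltr1n.
have /andP[_ l21] := ln2_bounds R.
have lQ1 : b1 * ln x - 1 <= ln Q%:R.
  apply: (@le_trans _ _ (ln (x `^ b1 / 2))); last by rewrite ler_ln ?posrE ?divr_gt0.
  by rewrite ln_div ?posrE // ln_powR lerB.
have lP1 : ln P%:R <= a1 * ln x by rewrite -ln_powR ler_ln ?posrE.
have lQ2 : ln Q%:R <= ln x.
  apply: (@le_trans _ _ (b1 * ln x)); first by rewrite -ln_powR ler_ln ?posrE.
  by rewrite ler_piMl ?(ltW l0) //; move: b12; clear; lra.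
(* The losses 8 in [rec_sum_ge] and 1 from rounding Q down make 9, at most half of $(b_1-a_1)\log
   x\ge 18$. *)
have rs1 : (b1 - a1) / 2 <= rs.
  rewrite -(ler_pM2r l0); move: c5; rewrite ler_pdivrMr // => c5.
  have : rs * ln Q%:R <= rs * ln x by exact: ler_wpM2l.
  move: X5 lQ1 lP1 c5; clear; lra.
have KN : (K <= N)%N by rewrite -(ler_nat R); move: X1 Nhalf L00 K0'; clear; lra.
have K1 : 0 < K%:R :> R by exact: lt_le_trans K0'.
pose u := x / K%:R.
have u0 : 0 < u by rewrite divr_gt0.
have psiN : u / 2 <= psi R N.
  by apply: le_trans (hK N KN); rewrite /u mulrAC ler_pM2r ?invr_gt0.
(* The multiples of d take at most half of the lower bound for [psi R N], since $P\ge 4K(1+\log x)$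
   follows from $\sigma\le a_1$ and the assumed size of $x^\sigma$. *)
have PNl : N%:R * ln N%:R / P%:R <= u / 4.
  have hsg : x `^ sg <= x `^ a1 by exact: ler_powR.
  have P4 : 4 * K%:R * y <= P%:R.
    have : 8 * K%:R * y <= 8 * K%:R * y5 by rewrite ler_wpM2l // mulr_ge0.
    move: hsg X7 P1; clear; lra.
  rewrite ler_pdivrMr //; apply: (@le_trans _ _ (x * y)).
    exact: ler_pM.
  have -> : x * y = u / 4 * (4 * K%:R * y) by rewrite /u; field; rewrite gt_eqF.
  by rewrite ler_wpM2l // divr_ge0 // ltW.
have main : (b1 - a1) * u / 8 <= rs * (psi R N - N%:R * ln N%:R / P%:R).
  have -> : (b1 - a1) * u / 8 = (b1 - a1) / 2 * (u / 4) by field.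
  apply: ler_pM => //; last by move: psiN PNl; clear; lra.
    by rewrite divr_ge0 // subr_ge0 ltW.
  by rewrite divr_ge0 // ltW.
set w := y5 * z.
have w0 : 0 <= w by [].
have y50 : 0 <= y5 by exact: le_trans y51.
have lN5 : ln N%:R <= y5 by exact: le_trans yy5.
have eps0 : 0 < b1 - a1 by rewrite subr_gt0.
have e1 : V%:R * (ln N%:R * Q%:R) <= w.
  apply: (@le_trans _ _ (x `^ 8^-1 * (y5 * x `^ b1))).
    by apply: ler_pM; rewrite ?mulr_ge0 //; apply: ler_pM.
  by rewrite mulrCA -powR_add // ler_wpM2l // pz //; move: b12 s2 eps0; clear; lra.
have e2 : V%:R * (Q%:R * (2 * ln N%:R)) <= 2 * w.
  have -> : V%:R * (Q%:R * (2 * ln N%:R)) = 2 * (V%:R * (ln N%:R * Q%:R)) :> R by ring.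
  by rewrite ler_wpM2l.
have e3 : V%:R * (ln N%:R * (V%:R * Q%:R)) <= w.
  apply: (@le_trans _ _ (x `^ 8^-1 * (y5 * (x `^ 8^-1 * x `^ b1)))).
    by apply: ler_pM; rewrite ?mulr_ge0 //; apply: ler_pM; rewrite ?mulr_ge0 //; apply: ler_pM.
  by rewrite mulrCA -!powR_add // ler_wpM2l // pz //; move: b12 s2 eps0; clear; lra.
have e4 : t.+1%:R * (t.+2%:R * W) <= 4 * (160 * 16) * w.
  apply: (@le_trans _ _ (2 * y * (2 * y * (160 * 16 * (z * y ^+ 3))))).
    apply: ler_pM; rewrite ?mulr_ge0 //.
      by rewrite -natr1 /y; move: tR lNx; clear; lra.
    by apply: ler_pM => //; rewrite -natr1 -natr1 /y; move: tR lNx; clear; lra.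
  by rewrite le_eqVlt; apply/orP; left; apply/eqP; rewrite /w /y5; ring.
have lQw : ln N%:R * Q%:R <= w.
  by apply: ler_pM => //; apply: (le_trans Q2); apply: pz; move: b12 s2 eps0; clear; lra.
have e5 : L0%:R * ln N%:R * Q%:R <= L0%:R * w by rewrite -mulrA ler_wpM2l.
have zw : z <= w by [].
have e6 : r%:R * (4 * L1%:R) <= 4 * r%:R * (1 + L0%:R) * w.
  have -> : 4 * r%:R * (1 + L0%:R) * w = r%:R * (4 * ((1 + L0%:R) * w)) by ring.
  do 2 apply: ler_wpM2l => //.
  apply: (le_trans L1R); rewrite mulrDl mul1r; apply: lerD => //.
  by rewrite ler_peMr // (le_trans z1).
have e7 : r%:R * (s%:R * t%:R * ln N%:R) <= 2 * r%:R * w.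
  have -> : 2 * r%:R * w = r%:R * (2 * w) by ring.
  apply: ler_wpM2l => //.
  apply: (@le_trans _ _ (z * (2 * y) * y)).
    apply: ler_pM; rewrite ?mulr_ge0 //; apply: ler_pM => //; last by move: tR lNy; clear; lra.
    by apply: (le_trans sR); apply: pz; move: s2 eps0; clear; lra.
  have -> : z * (2 * y) * y = 2 * (z * (y * y)) by ring.
  by rewrite ler_wpM2l // /w mulrC ler_wpM2r // ltW.
have errw : err_const R L0 r * w <= (b1 - a1) * u / 16.
  rewrite -(ler_pM2r (_ : 0 < 16 * K%:R)) ?mulr_gt0 //.
  have -> : (b1 - a1) * u / 16 * (16 * K%:R) = z * ((b1 - a1) * x `^ sg).
    by rewrite [RHS]mulrCA -xz /u; field; rewrite gt_eqF.
  have -> : err_const R L0 r * w * (16 * K%:R) = z * (err_const R L0 r * (16 * K%:R) * y5).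
    by rewrite /w; ring.
  by rewrite ler_wpM2l // ltW.
(* The main term is $(b_1-a_1)u/8$ and the errors take at most half of it. *)
have fin : (b1 - a1) * u / 16 <= ln x * r%:R * cnt.
  have : ln N%:R * r%:R * cnt <= ln x * r%:R * cnt.
    by rewrite -!mulrA ler_wpM2r // mulr_ge0.
  have : E <= w + 2 * w + w + 4 * (160 * 16) * w.
    by apply: (le_trans c3); rewrite !lerD.
  move: errw; rewrite /err_const 4!mulrDl.
  set k1 := 4 * (160 * 16) * w; move: main c1 c2 e5 e6 e7; clear; lra.
have -> : (b1 - a1) / (16 * K%:R * r%:R) * (x / ln x) = (b1 - a1) * u / 16 / (ln x * r%:R).
  by rewrite /u; field; rewrite !gt_eqF //; exact: lt_le_trans r0'.
have r1 : 0 < r%:R :> R by exact: lt_le_trans r0'.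
by rewrite ler_pdivrMr ?mulr_gt0 // [leRHS]mulrC.
Qed.

(** * Growth comparisons at infinity *)

Lemma near_powR_ge (R : realType) (e C : R) : 0 < e ->
  \forall x \near +oo, C <= x `^ e.
Proof.
move=> e0; pose M := `|C| + 1.
have M0 : 0 <= M by rewrite addr_ge0.
near=> x; apply: (@le_trans _ _ M).
  by rewrite (le_trans (ler_norm C)) // lerDl.
have -> : M = (M `^ e^-1) `^ e by rewrite -powRrM mulVf ?gt_eqF // powRr1.
have xM : M `^ e^-1 <= x by near: x; apply: nbhs_pinfty_ge; rewrite num_real.
have x0 : 0 <= x by exact: le_trans (powR_ge0 _ _) xM.
by apply: ge0_ler_powR; rewrite ?nnegrE ?powR_ge0 ?(ltW e0).
Unshelve. all: by end_near. Qed.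

Lemma near_ln_pow_le (R : realType) (k : nat) (C e D : R) : 0 < e -> 0 < D ->
  \forall x \near +oo, C * (1 + ln x) ^+ k <= D * x `^ e.
Proof.
(* Each factor $1+\log x$ is at most $(1+1/s)x^s$, and k of them use up at most $x^{e/2}$; the other
   half of the exponent absorbs the constants. The denominator has k + 1 so that k = 0 is
   covered. *)
move=> e0 D0; pose s := e / (2 * k.+1%:R).
have k0 : 0 < k.+1%:R :> R by rewrite ltr0n.
have s0 : 0 < s by rewrite divr_gt0 // mulr_gt0.
pose c := `|C| * (1 + s^-1) ^+ k / D.
near=> x.
have x1 : 1 <= x by near: x; apply: nbhs_pinfty_ge; rewrite num_real.
have hc : c <= x `^ (e / 2) by near: x; apply: near_powR_ge; rewrite divr_gt0.
have x0 : 0 < x by exact: lt_le_trans x1.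
have xs0 : 0 < x `^ s by exact: powR_gt0.
have l0 : 0 <= ln x by exact: ln_ge0.
have xs1 : 1 <= x `^ s by rewrite -(powRr0 x) ler_powR // ltW.
have hl : 1 + ln x <= (1 + s^-1) * x `^ s.
  have : ln (x `^ s) < x `^ s by exact: ln_sublinear.
  rewrite ln_powR => h; rewrite mulrDl mul1r; apply: lerD => //.
  by rewrite ler_pdivlMl // ltW.
have hk : (1 + ln x) ^+ k <= (1 + s^-1) ^+ k * x `^ (e / 2).
  apply: (@le_trans _ _ (((1 + s^-1) * x `^ s) ^+ k)).
    by rewrite lerXn2r ?nnegrE ?mulr_ge0 ?powR_ge0 ?addr_ge0 ?invr_ge0 ?(ltW s0).
  rewrite exprMn ler_wpM2l ?exprn_ge0 ?addr_ge0 ?invr_ge0 ?(ltW s0) //.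
  rewrite -powR_mulrn ?powR_ge0 // -powRrM ler_powR //.
  have -> : s * k%:R = e / 2 * (k%:R / k.+1%:R) by rewrite /s; field; rewrite !gt_eqF.
  by rewrite ler_piMr ?divr_ge0 ?(ltW e0) // ler_pdivrMr // mul1r ler_nat.
apply: (@le_trans _ _ (`|C| * (1 + ln x) ^+ k)).
  by rewrite ler_wpM2r ?ler_norm // exprn_ge0 // addr_ge0.
apply: (@le_trans _ _ (`|C| * ((1 + s^-1) ^+ k * x `^ (e / 2)))); first by rewrite ler_wpM2l.
have ee : x `^ e = x `^ (e / 2) * x `^ (e / 2).
  by rewrite -powR_add //; congr (_ `^ _); field.
rewrite ee !mulrA; apply: ler_wpM2r; first exact: powR_ge0.
by move: hc; rewrite /c ler_pdivrMr // [D * _]mulrC.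
Unshelve. all: by end_near. Qed.

(** * Passage from counted primes to [H], and the conclusion *)

Lemma omega_gt0_ex (lam : int) (P Q n : nat) : (0 < omega lam P Q n)%N ->
  exists d, [/\ prime d, (P < d <= Q)%N & (d%:Z %| (n%:Z + lam)%R)%Z].
Proof.
rewrite lt0n /omega sum_nat_seq_neq0 => /hasP[d]; rewrite mem_index_iota ltnS => hd /andP[pd].
by case: (boolP (_ %| _)%Z) => // h _; exists d.
Qed.

(** The shift by [lam] is injective, and n = p + lam lies in $(x^{1-\sigma},x]$. Hence a prime
    divisor d in $(x^{a_1},x^{b_1}]$ has its codivisor between $x^{1-\sigma-b_1}$ and $x^{1-a_1}$;
    the alternative says which of the two fits into the required interval. *)
Lemma count_le_H (R : realType) (lam : int) (a b a1 b1 sg x : R) :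
  1 <= x -> sg <= 1 ->
  (a <= a1 /\ b1 <= b) \/ (1 - a1 <= b /\ a <= 1 - sg - b1) ->
  (count (fun p => prime p &&
      (0 < omega lam (Num.truncn (x `^ a1)) (Num.truncn (x `^ b1)) p)%N)
    (index_iota (Num.truncn (x `^ (1 - sg)) + `|lam|).+1 (Num.truncn x - `|lam|).+1) <=
   H x (x `^ a) (x `^ b) (shifted_primes lam))%N.
Proof.
move=> x1 sg1 hab.
set P := Num.truncn (x `^ a1); set Q := Num.truncn (x `^ b1).
set L1 := (Num.truncn (x `^ (1 - sg)) + _)%N; set N := (Num.truncn x - _)%N.
have x0 : 0 < x by exact: lt_le_trans x1.
have pw (e : R) : 0 < x `^ e by exact: powR_gt0.
rewrite /H -!size_filter.
set s1 := [seq p <- _ | _]; set s2 := [seq n <- _ | _].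
have s1P p : p \in s1 -> exists n : nat, [/\ p%:Z + lam = n%:Z, prime p,
    (Num.truncn (x `^ (1 - sg)) < n <= Num.truncn x)%N & (0 < omega lam P Q p)%N].
  rewrite mem_filter mem_index_iota => /andP[/andP[pp op] /andP[h1 h2]].
  exists (`|(p%:Z + lam)%R|%N); split => //.
    by rewrite gez0_abs //; move: h1; rewrite /L1; clear; lia.
  by move: h1 h2; rewrite /L1 /N; clear; lia.
rewrite -(size_map (fun p : nat => `|(p%:Z + lam)%R|%N)).
apply: uniq_leq_size.
  rewrite map_inj_in_uniq ?filter_uniq ?iota_uniq // => p q /s1P[n [pn _ _ _]] /s1P[m [qm _ _ _]].
  by rewrite pn qm /= => nm; move: pn qm; rewrite nm; clear; lia.
move=> _ /mapP[p /s1P[n [pn pp /andP[n1 n2] op]] ->].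
rewrite pn /= mem_filter mem_iota add1n ltnS n2 (leq_ltn_trans _ n1) //= andbT.
apply/andP; split; first by rewrite inE; exists p.
have [d [pd /andP[Pd dQ]]] := omega_gt0_ex op.
rewrite pn dvdzE /= => dn.
have n0 : (0 < n)%N by exact: leq_ltn_trans n1.
have nx : n%:R <= x by rewrite (le_trans _ (_ : (Num.truncn x)%:R <= x)) ?ler_nat ?truncn_le ?(ltW x0).
have nsg : x `^ (1 - sg) < n%:R by apply: lt_le_trans (truncnS_gt _) _; rewrite ler_nat.
have d1 : x `^ a1 < d%:R by apply: lt_le_trans (truncnS_gt _) _; rewrite ler_nat.
have d2 : d%:R <= x `^ b1.
  by rewrite (le_trans (_ : d%:R <= Q%:R)) ?ler_nat // truncn_le powR_ge0.
have d0 : 0 < d%:R :> R by rewrite ltr0n prime_gt0.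
rewrite /tau -has_count; apply/hasP.
case: hab => [[aa bb]|[bb aa]].
  exists d; first by rewrite -dvdn_divisors.
  apply/andP; split; first by apply: le_lt_trans d1; exact: ler_powR.
  by apply: (le_trans d2); exact: ler_powR.
have ne : n%:R = (n %/ d)%:R * d%:R :> R by rewrite -natrM divnK.
exists (n %/ d)%N; first by rewrite -dvdn_divisors // dvdn_div.
apply/andP; split.
  rewrite -(ltr_pM2r d0) -ne; apply: le_lt_trans nsg.
  apply: (@le_trans _ _ (x `^ (1 - sg - b1) * x `^ b1)); last by rewrite -powR_add // subrK.
  by apply: ler_pM => //; rewrite ?powR_ge0 ?(ltW d0) //; exact: ler_powR.
rewrite -(ler_pM2r d0) -ne; apply: (le_trans nx).
apply: (@le_trans _ _ (x `^ (1 - a1) * x `^ a1)); first by rewrite -powR_add // subrK powRr1 // ltW.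
by apply: ler_pM; rewrite ?powR_ge0 //; [exact: ler_powR | exact: ltW].
Qed.

Lemma exponents_ex (R : realType) (a b : R) : 0 <= a -> a < b -> b <= 1 ->
  exists a1 b1 sg : R,
  [/\ 0 < a1, a1 < b1, 0 < sg, sg <= 1 & b1 <= 2^-1] /\
  [/\ sg <= a1, sg <= 16^-1 - (b1 - a1), sg <= 2^-1 - (b1 + b1 - a1) &
  (a <= a1 /\ b1 <= b) \/ (1 - a1 <= b /\ a <= 1 - sg - b1)].
Proof.
move=> a0 ab b1.
have win (al be : R) : 0 <= al -> al < be -> be <= 2^-1 ->
   exists a1 e sg : R, [/\ al < a1, 0 < e, a1 + e + sg <= be, 0 < sg & sg <= a1] /\
    [/\ sg <= 16^-1 - e, sg <= 2^-1 - (a1 + e + e), sg <= 1 & a1 + e <= be].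
  move=> al0 ale beh.
  (* The window starts at the midpoint of (al, be) and has length [e], with [sg = e]. An eighth of
     the gap leaves room for the three further steps of length [e] below [be], and 1/64 keeps the
     length well under the limit 1/16. *)
  have [e [e0 e1 e2]] : exists e : R, [/\ 0 < e, e <= (be - al) / 8 & e <= 64^-1].
    exists (Num.min ((be - al) / 8) 64^-1).
    split; [| by rewrite ge_min lexx | by rewrite ge_min lexx orbT].
    rewrite lt_min; apply/andP; split; last by rewrite invr_gt0 ltr0n.
    by move: ale; clear; lra.
  exists ((al + be) / 2), e, e.
  by split; split; move: e0 e1 e2 al0 ale beh; clear; lra.
have [ah|ah] := ltP a 2^-1.
  have [|||a1 [e [sg [[h1 h2 h3 h4 h5] [h6 h7 h8 h9]]]]] := win a (Num.min b 2^-1) => //.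
  - by rewrite lt_min ab ah.
  - by rewrite ge_min lexx orbT.
  move: h3 h9; rewrite !le_min => /andP[h3 h3'] /andP[h9 h9'].
  exists a1, (a1 + e), sg; split; first by split; move: h1 h2 h4 h8 h9' a0; clear; lra.
  split=> //.
  - by move: h6; clear; lra.
  - by move: h7; clear; lra.
  - by left; split => //; exact: ltW.
have [|||a1 [e [sg [[h1 h2 h3 h4 h5] [h6 h7 h8 h9]]]]] := win (1 - b) (1 - a).
- by rewrite subr_ge0.
- by rewrite ltrD2l ltrN2.
- by move: ah; clear; lra.
exists a1, (a1 + e), sg; split; first by split; move: h1 h2 h4 h8 h9 ah b1; clear; lra.
split=> //.
- by move: h6; clear; lra.
- by move: h7; clear; lra.
- by right; split; move: h1 h3; clear; lra.
Qed.

Theorem theorem7 (R : realType) (lambda : int) (a b : R)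
    (lambda_neq0 : lambda != 0) (a_ge0 : 0 <= a) (ab : a < b) (b_le1 : b <= 1) :
  exists2 c : R, 0 < c &
    \forall x \near +oo,
      c * (x / ln x) <= (H x (x `^ a) (x `^ b) (shifted_primes lambda))%:R.
Proof.
have [a1 [b1 [sg [[a10 ab1 sg0 sg1 b12] [s1 s2 s3 hab]]]]] := exponents_ex a_ge0 ab b_le1.
have [K K0 hK] := psi_ge R.
(* Eventually $P\ge x^{a_1/2}$, so $r>2/a_1$ makes $P^{r+1}$ exceed x; thus [r] bounds the number of
   prime factors above P of any integer up to x. *)
pose r := (Num.truncn (2 / a1)).+1.
have K0' : 0 < K%:R :> R by rewrite ltr0n.
have eps0 : 0 < b1 - a1 by rewrite subr_gt0.
exists ((b1 - a1) / (16 * K%:R * r%:R)); first by rewrite divr_gt0 // !mulr_gt0 // ltr0n.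
near=> x.
have x1 : 1 <= x by near: x; apply: nbhs_pinfty_ge; rewrite num_real.
have x0 : 0 < x by exact: lt_le_trans x1.
apply: (@le_trans _ _ (count (fun p => prime p && (0 < omega lambda (Num.truncn (x `^ a1))
   (Num.truncn (x `^ b1)) p)%N) (index_iota (Num.truncn (x `^ (1 - sg)) + `|lambda|).+1
   (Num.truncn x - `|lambda|).+1))%:R); last by rewrite ler_nat; exact: count_le_H.
apply: (@count_at_ge R lambda a1 b1 sg x K r `|lambda|%N _ _ (Num.truncn (x `^ 8^-1))) => //.
- by near: x; exact: near_powR_ge.
- by near: x; apply: near_powR_ge; rewrite invr_gt0.
- have ha2 : 2 <= x `^ (a1 / 2) by near: x; apply: near_powR_ge; rewrite divr_gt0.
  have aa : x `^ a1 = x `^ (a1 / 2) * x `^ (a1 / 2).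
    by rewrite -powR_add //; congr (_ `^ _); field.
  have Pge : x `^ (a1 / 2) <= (Num.truncn (x `^ a1))%:R.
    have h2 : 2 <= x `^ a1 by rewrite aa; move: ha2; clear; nra.
    have /andP[h _] := truncn_half_le h2; apply: le_trans h; rewrite aa.
    by move: ha2; clear; nra.
  apply: (@lt_le_trans _ _ ((x `^ (a1 / 2)) ^+ r.+1)); last first.
    by rewrite lerXn2r ?nnegrE ?powR_ge0.
  rewrite -powR_mulrn ?powR_ge0 // -powRrM.
  apply: (@lt_le_trans _ _ (x `^ (1 + a1 / 2))).
    by rewrite powR_add // powRr1 ?(ltW x0) // ltr_pMr //; apply: lt_le_trans ha2; rewrite ltr1n.
  apply: ler_powR => //.
  have h : 2 < r%:R * a1 by rewrite -ltr_pdivrMr //; exact: truncnS_gt.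
  have -> : a1 / 2 * r.+1%:R = r%:R * a1 / 2 + a1 / 2 by rewrite -[r.+1%:R]natr1; field.
  by rewrite lerD2r ler_pdivlMr // mul1r ltW.
- have : 18 / (b1 - a1) <= ln x.
    by rewrite -[leLHS]expRK ler_ln ?posrE ?expR_gt0.
  by rewrite ler_pdivrMr // mulrC.
- by near: x; exact: near_ln_pow_le.
- rewrite -[leRHS]mul1r; near: x; exact: near_ln_pow_le.
Unshelve. all: by end_near. Qed.
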